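(* Let $\varepsilon>0$ and let $F:\Gamma_{\varepsilon,\varepsilon}\to\mathbb R$ be a continuous function. Then there exists a continuous function $u_\varepsilon:\overline{\Omega}_\varepsilon\to\mathbb R$ with boundary data $F$ that satisfies the dynamic programming principle, i.e. $u_\varepsilon(x)=T_\varepsilon u_\varepsilon(x)$ for all $x\in\overline{\Omega}_\varepsilon$. Moreover, this function is unique, and it is the value function of the tug-of-war game, i.e. $u_\varepsilon=u_{\mathrm I}=u_{\mathrm{II}}$ on $\Omega$.
   Context: Setting. Fix an integer $n\ge 2$, $\varepsilon>0$ and a bounded domain $\Omega\subset\mathbb R^n$. Put $I_\varepsilon=\{x\in\Omega:\operatorname{dist}(x,\partial\Omega)<\varepsilon\}$, $O_\varepsilon=\{x\in\mathbb R^n\setminus\overline\Omega:\operatorname{dist}(x,\partial\Omega)<\varepsilon\}$, $\Omega_\varepsilon=\overline\Omega\cup O_\varepsilon$, $\overline\Omega_\varepsilon$ its closure, and $\Gamma_{\varepsilon,\varepsilon}=\overline{I_\varepsilon}\cup\overline{O_\varepsilon}$. Let $\delta:\overline\Omega_\varepsilon\to[0,1]$ be $\delta(x)=0$ for $x\in\Omega\setminus I_\varepsilon$, $\delta(x)=1-\varepsilon^{-1}\operatorname{dist}(x,\partial\Omega)$ for $x\in I_\varepsilon$, and $\delta(x)=1$ for $x\in\overline{O_\varepsilon}\cup\partial\Omega$. Let $p:\overline\Omega\to\mathbb R$ be continuous with $1<\inf_\Omega p\le\sup_\Omega p<\infty$, and set $\alpha(x)=\frac{p(x)-1}{p(x)+n}$,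 $\beta(x)=1-\alpha(x)=\frac{n+1}{p(x)+n}$ for $x\in\overline\Omega$. For $\nu\ne0$ let $B_\varepsilon^\nu=\{z\in\mathbb R^n:|z|<\varepsilon,\ \langle z,\nu\rangle=0\}$, let $\mathcal L^{n-1}$ be $(n-1)$-dimensional Lebesgue measure, and let $A_\nu u(x)=\frac1{\mathcal L^{n-1}(B_\varepsilon^\nu)}\int_{B_\varepsilon^\nu}u(x+h)\,d\mathcal L^{n-1}(h)$. Put $W(u;x,\nu)=\alpha(x)u(x+\nu)+\beta(x)A_\nu u(x)$ and $$T_\varepsilon u(x)=\frac{1-\delta(x)}2\Big[\sup_{|\nu|=\varepsilon}W(u;x,\nu)+\inf_{|\nu|=\varepsilon}W(u;x,\nu)\Big]+\delta(x)F(x),$$ with the conventions $T_\varepsilon u(x)=F(x)$ for $x\in\overline\Omega_\varepsilon\setminus\overline\Omega$ and $\delta(x)F(x)=0$ for $x\in\Omega\setminus I_\varepsilon$. The game. Players $P_{\mathrm I}$ and $P_{\mathrm{II}}$ move a token starting at $x_0\in\Omega$. With $c_0=0$, the states are $(c_j,x_j)$, $c_j\in\{0,1\}$. A strategy $\mathcal S_i$ of player $i\in\{\mathrm I,\mathrm{II}\}$ is a sequence of Borel measurable functions $\mathcal S_i^{j}$, $j\ge1$, assigning to each history $((c_0,x_0),\dots,(c_{j-1},x_{j-1}))$ (with positions in $\Omega_\varepsilon$) a vector $\nu_j^i$ with $|\nu_j^i|=\varepsilon$. Given $x_0$ and strategies, $\mathbb P^{x_0}_{\mathcal S_{\mathrm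 I},\mathcal S_{\mathrm{II}}}$ is the law (from Kolmogorov's extension theorem) of the process with the following transitions. If $c_j=1$, then $(c_{j+1},x_{j+1})=(1,x_j)$. If $c_j=0$: with probability $\delta(x_j)$, $(c_{j+1},x_{j+1})=(1,x_j)$; with probability $1-\delta(x_j)$, $c_{j+1}=0$ and $x_{j+1}$ is chosen as follows: a fair coin selects the player $i$, and then with probability $\alpha(x_j)$ one has $x_{j+1}=x_j+\nu_{j+1}^i$, and with probability $\beta(x_j)$, $x_{j+1}$ is uniformly distributed in $x_j+B_\varepsilon^{\nu_{j+1}^i}$. The game ends at time $\tau=\inf\{j\ge0:c_{j+1}=1\}$, and $P_{\mathrm{II}}$ pays $P_{\mathrm I}$ the amount $F(x_\tau)$. The value functions are, for $x_0\in\Omega$, $$u_{\mathrm I}(x_0)=\sup_{\mathcal S_{\mathrm I}}\inf_{\mathcal S_{\mathrm{II}}}\mathbb E^{x_0}_{\mathcal S_{\mathrm I},\mathcal S_{\mathrm{II}}}[F(x_\tau)],\qquad u_{\mathrm{II}}(x_0)=\inf_{\mathcal S_{\mathrm{II}}}\sup_{\mathcal S_{\mathrm I}}\mathbb E^{x_0}_{\mathcal S_{\mathrm I},\mathcal S_{\mathrm{II}}}[F(x_\tau)].$$ *)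

(* Defs.v *)
From HB Require Import structures.
From mathcomp Require Import all_boot all_order all_algebra.
From mathcomp Require Import all_classical all_reals all_analysis.
From mathcomp Require Import measurable_realfun lra ring.

Set Implicit Arguments.
Unset Strict Implicit.
Unset Printing Implicit Defensive.
Import Order.TTheory GRing.Theory Num.Theory.
Import numFieldNormedType.Exports.
Local Open Scope classical_set_scope.
Local Open Scope ring_scope.

Section euclidean.
Context {R : realType} {n : nat}.
Implicit Types (x y u v : 'rV[R]_n) (A : set 'rV[R]_n).

Definition dot u v : R := \sum_i u 0 i * v 0 i.

(* The norm that the library puts on ['rV[R]_n] is the sup norm; it induces the
   same topology, but the geometry below needs the Euclidean one. *)
Definition enorm u : R := Num.sqrt (dot u u).

Definition dist x A : R := inf [set enorm (x - y) | y in A].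

Definition boundary A : set 'rV[R]_n := closure A `\` A°.

Definition esphere (r : R) : set 'rV[R]_n := [set nu | enorm nu = r].

Definition disc (r : R) (nu : 'rV[R]_n) : set 'rV[R]_n :=
  [set z | enorm z < r /\ dot z nu = 0].

Lemma dotC u v : dot u v = dot v u.
Proof. by apply: eq_bigr => i _; rewrite mulrC. Qed.

Lemma dotE u v : dot u v = (u *m v^T) 0 0.
Proof. by rewrite mxE; apply: eq_bigr => i _; rewrite mxE. Qed.

Lemma dotBr x u v : dot x (u - v) = dot x u - dot x v.
Proof.
by rewrite -sumrB; apply: eq_bigr => i _; rewrite !mxE mulrBr.
Qed.

Lemma dotZr x (a : R) u : dot x (a *: u) = a * dot x u.
Proof.
by rewrite mulr_sumr; apply: eq_bigr => i _; rewrite !mxE mulrCA.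
Qed.

Lemma dot_ge0 u : 0 <= dot u u.
Proof. by apply: sumr_ge0 => i _; rewrite -expr2 sqr_ge0. Qed.

Lemma dot_eq0 u : (dot u u == 0) = (u == 0).
Proof.
apply/eqP/eqP => [u0|->]; last by apply: big1 => i _; rewrite mxE mul0r.
apply/rowP => i; rewrite mxE; apply/eqP; rewrite -sqrf_eq0 expr2; apply/eqP.
by apply: (psumr_eq0P _ u0) => // j _; rewrite -expr2 sqr_ge0.
Qed.

Lemma enorm_sqr u : enorm u ^+ 2 = dot u u.
Proof. by rewrite sqr_sqrtr// dot_ge0. Qed.

End euclidean.

Notation borelRn R n := (g_sigma_algebraType (@open 'rV[R]_n)).

Lemma measurable_fun_borelRn d (T : measurableType d) (R : realType) n
    (f : T -> 'rV[R]_n) :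
  (forall i, measurable_fun setT (fun t => f t 0 i)) ->
  measurable_fun setT (f : T -> borelRn R n).
Proof.
move=> mf; apply: (@measurability _ _ T (borelRn R n) setT f open) => //.
move=> _ [U oU <-]; rewrite setTI.
pose B (qk : 'rV[rat]_n * nat) : set 'rV[R]_n :=
  [set y | forall i, ball (ratr (qk.1 0 i) : R) (qk.2.+1%:R^-1) (y 0 i)].
have -> : f @^-1` U =
    \bigcup_(qk in [set qk | B qk `<=` U]) (f @^-1` B qk).
  apply/seteqP; split => [t Uft|t [qk BU]]; last exact: BU.
  have /nbhs_ballP[r /= r0 rU] : nbhs (f t) U by apply: open_nbhs_nbhs.
  have [k kr] : exists k, k.+1%:R^-1 < r / 2 :> R.
    have r20 : 0 < r / 2 by rewrite divr_gt0.
    have [N _ /(_ N (leqnn N)) H] := near_infty_natSinv_lt (PosNum r20).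
    by exists N.
  have k0 : 0 < k.+1%:R^-1 :> R by rewrite invr_gt0.
  have /choice[q qP] i : exists q : rat,
      ball (ratr q : R) k.+1%:R^-1 (f t 0 i).
    have : f t 0 i < f t 0 i + k.+1%:R^-1 by rewrite ltrDl.
    move=> /rat_in_itvoo[q]; rewrite in_itv/= => q12; exists q.
    move: k0 q12; rewrite /ball/= ltr_norml.
    move: (k.+1%:R^-1) (ratr q) => e z e0 /andP[? ?].
    by apply/andP; split; lra.
  exists (\row_i q i, k).
    move=> y /= By; apply: rU; split => // i j; rewrite !ord1.
    have {}By := By j; have qj := qP j; rewrite /= mxE in By.
    move: By qj kr; rewrite /ball/= !ltr_norml.
    move: (k.+1%:R^-1) (ratr (q j)) => e z /andP[? ?] /andP[? ?] ?.
    by apply/andP; split; lra.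
  by move=> i /=; rewrite mxE; exact: qP.
rewrite bigcup_mkcond; apply: countable_bigcupT_measurable => // qk.
case: ifPn => // _.
have -> : f @^-1` B qk = \bigcap_(i in [set: 'I_n])
    ((fun t => f t 0 i) @^-1` ball (ratr (qk.1 0 i) : R) (qk.2.+1%:R^-1)).
  by apply/seteqP; split => t h i => [_|]; exact: h.
apply: fin_bigcap_measurable => // i _; rewrite -[X in measurable X]setTI.
by apply: mf => //; exact: measurable_ball.
Qed.

Section lebesgue.
Context {R : realType}.
Local Notation RR := (measurableTypeR R).

Definition consT k (p : RR * k.-tuple RR) : k.+1.-tuple RR :=
  [the k.+1.-tuple RR of p.1 :: p.2].

Lemma measurable_consT k : measurable_fun setT (@consT k).
Proof. exact: measurable_cons. Qed.

Section lebesgue_succ.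
Context k (m : {sigma_finite_measure set (k.-tuple RR) -> \bar R}).

Definition lebesgue_succ : set (k.+1.-tuple RR) -> \bar R :=
  pushforward (lebesgue_measure \x m)%E (@consT k).

Let lebesgue_succ0 : lebesgue_succ set0 = 0%E.
Proof. by rewrite /lebesgue_succ /pushforward preimage_set0 measure0. Qed.

Let lebesgue_succ_ge0 A : (0 <= lebesgue_succ A)%E.
Proof. by rewrite /lebesgue_succ /pushforward measure_ge0. Qed.

Let lebesgue_succ_sigma_additive : semi_sigma_additive lebesgue_succ.
Proof.
move=> F mF tF mUF; rewrite /lebesgue_succ /pushforward preimage_bigcup.
have mcF A : measurable A -> measurable (@consT k @^-1` A).
  by move=> mA; rewrite -[X in measurable X]setTI; exact: measurable_consT.
apply: measure_semi_sigma_additive.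
- by move=> i; exact: mcF.
- apply/trivIsetP => /= i j _ _ ij; rewrite -preimage_setI.
  by move/trivIsetP : tF => /(_ _ _ _ _ ij) ->//; rewrite preimage_set0.
- by rewrite -preimage_bigcup; exact: mcF.
Qed.

HB.instance Definition _ := isMeasure.Build _ _ _ lebesgue_succ
  lebesgue_succ0 lebesgue_succ_ge0 lebesgue_succ_sigma_additive.

Let lebesgue_succ_sigma_finite : sigma_finite setT lebesgue_succ.
Proof.
have [F FT Foo] := sigma_finiteT (@lebesgue_measure R).
have [G GT Goo] := sigma_finiteT m.
pose H (ij : nat * nat) : set (k.+1.-tuple RR) :=
  [set t | F ij.1 (thead t) /\ G ij.2 [tuple of behead t]].
have mH ij : measurable (H ij).
  apply: measurableI.
    rewrite -[X in measurable X]setTI; apply: (measurable_tnth ord0) => //.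
    by have [] := Foo ij.1.
  rewrite -[X in measurable X]setTI; apply: measurable_behead => //.
  by have [] := Goo ij.2.
have /card_esym/ppcard_eqP[f] := card_nat2.
exists (H \o f).
  apply/seteqP; split => // t _.
  have [i _ Fi] : (\bigcup_i F i) (thead t) by rewrite -FT.
  have [j _ Gj] : (\bigcup_j G j) [tuple of behead t] by rewrite -GT.
  by exists (f^-1%FUN (i, j)) => //=; rewrite invK ?inE.
move=> l; split; first exact: mH.
have [mF Fl] := Foo (f l).1; have [mG Gl] := Goo (f l).2.
rewrite /lebesgue_succ /pushforward.
rewrite [X in (lebesgue_measure \x m)%E X](_ : _ = F (f l).1 `*` G (f l).2).
  by rewrite product_measure1E// lte_mul_pinfty// ge0_fin_numE.
apply/seteqP; split => -[x t] /=; rewrite /H/= theadE.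
  move=> [? Gt]; split => //.
  by rewrite [t](_ : _ = [tuple of behead (consT (x, t))])//; exact/val_inj.
move=> [? Gt]; split => //.
by rewrite [X in G _ X](_ : _ = t)//; exact/val_inj.
Qed.

HB.instance Definition _ := Measure_isSigmaFinite.Build _ _ _ lebesgue_succ
  lebesgue_succ_sigma_finite.

End lebesgue_succ.

(* Lebesgue measure on the Borel sets of $R^k$, as an iterated product. *)
Fixpoint lebesgue k : {sigma_finite_measure set (k.-tuple RR) -> \bar R} :=
  match k with
  | 0 => \d_([tuple] : 0.-tuple RR)
  | k'.+1 => lebesgue_succ (lebesgue k')
  end.

End lebesgue.

Section hyperplane.
Context {R : realType} {n : nat}.
Local Notation RR := (measurableTypeR R).
Implicit Types (nu z : 'rV[R]_n) (t : n.-1.-tuple RR).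

Definition last_axis : 'rV[R]_n := \row_i (i == n.-1 :> nat)%:R.

Definition axis_gap nu : 'rV[R]_n := last_axis - (enorm nu)^-1 *: nu.

(* The Householder reflection exchanging [last_axis] and [nu / |nu|]; it is the
   identity when these coincide, because [0^-1 = 0]. *)
Definition reflection nu : 'M[R]_n :=
  1%:M - (2 / dot (axis_gap nu) (axis_gap nu))
           *: ((axis_gap nu)^T *m axis_gap nu).

Definition pad t : 'rV[R]_n := \row_i nth 0 t i.

(* A linear isometry of $R^{n-1}$ onto the hyperplane orthogonal to [nu]: see
   [dot_plane_pt], [plane_pt_perp] and [plane_pt_onto]. *)
Definition plane_pt nu t : 'rV[R]_n := pad t *m reflection nu.

Lemma trmx_reflection nu : (reflection nu)^T = reflection nu.
Proof.
by rewrite /reflection linearB/= trmx1 linearZ/= trmx_mul trmxK.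
Qed.

Lemma reflectionK nu : reflection nu *m reflection nu = 1%:M.
Proof.
rewrite /reflection; set v := axis_gap nu; set M := v^T *m v.
have MM : M *m M = dot v v *: M.
  rewrite /M -mulmxA [v *m _]mulmxA [v *m v^T]mx11_scalar -dotE.
  by rewrite mul_scalar_mx -scalemxAr.
rewrite mulmxBl mul1mx mulmxBr mulmx1 -scalemxAl -scalemxAr MM !scalerA.
have -> : 2 / dot v v * (2 / dot v v) * dot v v = 2 / dot v v + 2 / dot v v.
  have [->|v0] := eqVneq (dot v v) 0; first by rewrite invr0 !mulr0 addr0.
  by field.
by rewrite scalerDl opprB addrK subrK.
Qed.

Lemma enorm_eq0 nu : (enorm nu == 0) = (nu == 0).
Proof. by rewrite -dot_eq0 -enorm_sqr sqrf_eq0. Qed.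

Lemma rV_neq0_gt0 nu : nu != 0 -> (0 < n)%N.
Proof. by case: (n) nu => // u; rewrite [u]thinmx0 eqxx. Qed.

Lemma mul_reflection nu : nu != 0 ->
  ((enorm nu)^-1 *: nu) *m reflection nu = last_axis.
Proof.
move=> nu0; have n0 := rV_neq0_gt0 nu0; set w := _ *: nu.
have n1 : (n.-1 < n)%N by rewrite prednK.
have ww : dot w w = 1.
  rewrite /w dotZr dotC dotZr -enorm_sqr.
  by field; rewrite enorm_eq0.
have ee : dot last_axis last_axis = 1.
  rewrite /dot (bigD1 (Ordinal n1))//= !mxE/= eqxx mulr1 big1 ?addr0// => i.
  by rewrite !mxE -val_eqE/= => /negbTE->; rewrite mul0r.
rewrite /reflection mulmxBr mulmx1 -scalemxAr mulmxA.
rewrite [w *m _]mx11_scalar -dotE mul_scalar_mx scalerA.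
have vv : dot (axis_gap nu) (axis_gap nu) = 2 - 2 * dot last_axis w.
  rewrite /axis_gap -/w dotBr ![dot (_ - _) _]dotC !dotBr ww ee.
  by rewrite [dot w last_axis]dotC; ring.
have wv : dot w (axis_gap nu) = dot last_axis w - 1.
  by rewrite /axis_gap -/w dotBr ww dotC.
have [v0|v0] := eqVneq (axis_gap nu) 0.
  by rewrite v0 scaler0 subr0; apply/esym/eqP; rewrite -subr_eq0; apply/eqP.
have -> : 2 / dot (axis_gap nu) (axis_gap nu) * dot w (axis_gap nu) = -1.
  move: v0; rewrite -dot_eq0 vv wv => v0.
  by field; move: v0; apply: contra => /eqP v0; apply/eqP; lra.
by rewrite scaleN1r opprK /axis_gap -/w addrC subrK.
Qed.

Lemma dot_pad s t : dot (pad s) (pad t) = \sum_i tnth s i * tnth t i.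
Proof.
rewrite /dot /pad; case: n s t => [|m] s t; first by rewrite !big_ord0.
rewrite big_ord_recr/= !mxE nth_default ?size_tuple// mul0r addr0.
by apply: eq_bigr => i _; rewrite !mxE !(tnth_nth 0).
Qed.

Lemma dot_plane_pt nu s t :
  dot (plane_pt nu s) (plane_pt nu t) = \sum_i tnth s i * tnth t i.
Proof.
rewrite -dot_pad !dotE /plane_pt trmx_mul trmx_reflection.
by rewrite -mulmxA [reflection nu *m _]mulmxA reflectionK mul1mx.
Qed.

Lemma dot_last_axis z : (0 < n)%N ->
  forall i : 'I_n, i = n.-1 :> nat -> dot z last_axis = z 0 i.
Proof.
move=> n0 i iE; rewrite /dot (bigD1 i)//= !mxE iE eqxx mulr1 big1 ?addr0// => j.
by rewrite mxE -val_eqE/= iE => /negbTE->; rewrite mulr0.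
Qed.

Lemma plane_pt_perp nu t : nu != 0 -> dot (plane_pt nu t) nu = 0.
Proof.
move=> nu0.
have n0 := rV_neq0_gt0 nu0.
have n1 : (n.-1 < n)%N by rewrite prednK.
suff : dot (plane_pt nu t) ((enorm nu)^-1 *: nu) = 0.
  by rewrite dotZr => /eqP; rewrite mulf_eq0 invr_eq0 enorm_eq0 (negbTE nu0)/= => /eqP.
rewrite dotE /plane_pt -mulmxA -trmx_reflection -trmx_mul mul_reflection//.
rewrite -dotE (@dot_last_axis _ n0 (Ordinal n1))// mxE nth_default//.
by rewrite size_tuple.
Qed.

Lemma plane_pt_onto nu z : nu != 0 -> dot z nu = 0 ->
  exists t, plane_pt nu t = z.
Proof.
move=> nu0 znu.
have n0 := rV_neq0_gt0 nu0.
have n1 : (n.-1 < n)%N by rewrite prednK.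
pose y := z *m reflection nu.
have y0 : y 0 (Ordinal n1) = 0.
  rewrite -(@dot_last_axis _ n0 (Ordinal n1))// dotE -(mul_reflection nu0).
  rewrite trmx_mul trmx_reflection mulmxA -[y *m _]mulmxA reflectionK.
  by rewrite mulmx1 -dotE dotZr znu mulr0.
exists [tuple y 0 (widen_ord (leq_pred n) i) | i < n.-1].
rewrite /plane_pt (_ : pad _ = y); last first.
  apply/rowP => i; rewrite mxE.
  have [ni|ni] := leqP n.-1 i.
    rewrite nth_default ?size_tuple// -y0; congr (y _ _).
    by apply/val_inj => /=; apply/eqP; rewrite eqn_leq ni -ltnS prednK// ltn_ord.
  rewrite -(tnth_nth 0 _ (Ordinal ni)) tnth_mktuple; congr (y _ _).
  exact/val_inj.
by rewrite -mulmxA reflectionK mulmx1.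
Qed.

Lemma measurable_plane_pt nu :
  measurable_fun setT (plane_pt nu : _ -> borelRn R n).
Proof.
apply: measurable_fun_borelRn => i; under eq_fun do rewrite mxE.
apply: measurable_sum => j; apply: measurable_funM => //.
have [jn|jn] := leqP n.-1 j.
  rewrite (_ : (fun t => _) = cst 0)//; apply/funext => t.
  by rewrite mxE nth_default ?size_tuple.
rewrite (_ : (fun t => _) = (fun t : n.-1.-tuple RR => tnth t (Ordinal jn))).
  exact: measurable_tnth.
by apply/funext => t; rewrite mxE (tnth_nth 0).
Qed.

(* $\mathcal L^{n-1}$ on the hyperplane orthogonal to [nu], extended by zero to
   the Borel sets of $R^n$. *)
Definition hyperplane_lebesgue nu : set (borelRn R n) -> \bar R :=
  pushforward (lebesgue n.-1) (plane_pt nu : _ -> borelRn R n).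

Let hyperplane_lebesgue0 nu : hyperplane_lebesgue nu set0 = 0%E.
Proof. by rewrite /hyperplane_lebesgue /pushforward preimage_set0 measure0. Qed.

Let hyperplane_lebesgue_ge0 nu A : (0 <= hyperplane_lebesgue nu A)%E.
Proof. by rewrite /hyperplane_lebesgue /pushforward measure_ge0. Qed.

Let hyperplane_lebesgue_sigma_additive nu :
  semi_sigma_additive (hyperplane_lebesgue nu).
Proof.
move=> F mF tF mUF; rewrite /hyperplane_lebesgue /pushforward preimage_bigcup.
have mpF (A : set (borelRn R n)) :
    measurable A -> measurable (plane_pt nu @^-1` A).
  by move=> mA; rewrite -[X in measurable X]setTI; exact: measurable_plane_pt.
apply: measure_semi_sigma_additive.
- by move=> i; exact: mpF.
- apply/trivIsetP => /= i j _ _ ij; rewrite -preimage_setI.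
  by move/trivIsetP : tF => /(_ _ _ _ _ ij) ->//; rewrite preimage_set0.
- by rewrite -preimage_bigcup; exact: mpF.
Qed.

HB.instance Definition _ nu := isMeasure.Build _ _ _ (hyperplane_lebesgue nu)
  (hyperplane_lebesgue0 nu) (hyperplane_lebesgue_ge0 nu)
  (@hyperplane_lebesgue_sigma_additive nu).

Definition disc_avg (eps : R) nu (f : 'rV[R]_n -> R) : R :=
  (fine (hyperplane_lebesgue nu (disc eps nu)))^-1 *
  \int[hyperplane_lebesgue nu]_(h in disc eps nu) f h.

Definition unif_disc (eps : R) nu (B : set 'rV[R]_n) : \bar R :=
  ((fine (hyperplane_lebesgue nu (disc eps nu)))^-1%:E *
   hyperplane_lebesgue nu (disc eps nu `&` B))%E.

End hyperplane.

Section dynamic_programming.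
Context {R : realType} {n : nat}.
Variables (eps : R) (Omega : set 'rV[R]_n) (p F : 'rV[R]_n -> R).
Implicit Types (x nu : 'rV[R]_n) (u : 'rV[R]_n -> R).

Definition inner_strip : set 'rV[R]_n :=
  [set x | Omega x /\ dist x (boundary Omega) < eps].

Definition outer_strip : set 'rV[R]_n :=
  [set x | ~ closure Omega x /\ dist x (boundary Omega) < eps].

Definition Omega_eps : set 'rV[R]_n := closure Omega `|` outer_strip.

Definition Gamma : set 'rV[R]_n := closure inner_strip `|` closure outer_strip.

Definition delta x : R :=
  if x \in Omega `\` inner_strip then 0
  else if x \in inner_strip then 1 - eps^-1 * dist x (boundary Omega)
  else 1.

Definition alpha x : R := (p x - 1) / (p x + n%:R).
Definition beta x : R := 1 - alpha x.

Definition W u x nu : R :=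
  alpha x * u (x + nu) + beta x * disc_avg eps nu (fun h => u (x + h)).

Definition T u x : R :=
  if x \in closure Omega then
    (1 - delta x) / 2 * (sup [set W u x nu | nu in esphere eps] +
                         inf [set W u x nu | nu in esphere eps])
    + delta x * F x
  else F x.

End dynamic_programming.

Notation gstate R n := (bool * borelRn R n)%type.

Definition cylinders (R : realType) (n : nat) : set (set (nat -> gstate R n)) :=
  [set C | exists j, exists2 B, measurable B & C = [set w | B (w j)]].

Notation play R n := (g_sigma_algebraType (@cylinders R n)).

Section game.
Context {R : realType} {n : nat}.
Variables (eps : R) (Omega : set 'rV[R]_n) (p F : 'rV[R]_n -> R).
Local Notation state := (gstate R n).
Local Notation history j := (j.+1.-tuple state).

Definition legal j : set (history j) :=
  [set h | forall i, Omega_eps eps Omega (tnth h i).2].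

(* [S j] chooses the vector $\nu_{j+1}$ from the states at times 0, ..., j. Only
   its values on [legal] histories matter. *)
Definition strategy (S : forall j, history j -> 'rV[R]_n) : Prop :=
  forall j, measurable_fun (@legal j) (S j : _ -> borelRn R n) /\
            forall h, legal h -> enorm (S j h) = eps.

Definition turn (x nu : 'rV[R]_n) (B : set state) : \bar R :=
  ((alpha p x)%:E * \d_((false, (x + nu)%R) : state) B +
   (beta p x)%:E * unif_disc eps nu [set z | B (false, (x + z)%R)])%E.

Definition transition (S1 S2 : forall j, history j -> 'rV[R]_n) j
    (h : history j) (B : set state) : \bar R :=
  let x := (tnth h ord_max).2 in
  if (tnth h ord_max).1 then \d_((true, x) : state) B
  else ((delta eps Omega x)%:E * \d_((true, x) : state) B +
        (1 - delta eps Omega x)%R%:E *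
          (2^-1%:E * turn x (S1 j h) B + 2^-1%:E * turn x (S2 j h) B))%E.

Definition past j (w : play R n) : history j := [tuple w i | i < j.+1].

Definition is_law (x0 : 'rV[R]_n) S1 S2 (P : probability (play R n) R) : Prop :=
  (forall B : set state, measurable B ->
     P [set w | B (w 0%N)] = \d_((false, x0) : state) B) /\
  (forall j (A : set (history j)) (B : set state),
     measurable A -> A `<=` @legal j -> measurable B ->
     P [set w | A (past j w) /\ B (w j.+1)] =
     \int[P]_(w in [set w | A (past j w)]) transition S1 S2 (past j w) B)%E.

(* The default value is never used: by Kolmogorov's theorem a law exists, and it
   is unique, for all strategies and all [x0] in [Omega]. *)
Definition law (x0 : 'rV[R]_n) S1 S2 : probability (play R n) R :=
  xget (\d_((fun=> (false, x0)) : play R n) : probability (play R n) R)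
       [set P | is_law x0 S1 S2 P].

Definition exit_time (w : play R n) : option nat :=
  if pselect (exists j, (w j.+1).1) is left e then Some (ex_minn e) else None.

(* [F] is only meaningful on [Gamma], which almost surely contains $x_\tau$; the
   value on the null event $\tau=\infty$ is irrelevant. *)
Definition payoff (w : play R n) : R :=
  if exit_time w is Some j then (F \_ (Gamma eps Omega)) (w j).2 else 0.

Definition expected_payoff x0 S1 S2 : \bar R := 'E_(law x0 S1 S2)[payoff].

Definition value1 x0 : \bar R :=
  ereal_sup [set ereal_inf [set expected_payoff x0 S1 S2 | S2 in strategy]
            | S1 in strategy].

Definition value2 x0 : \bar R :=
  ereal_inf [set ereal_sup [set expected_payoff x0 S1 S2 | S1 in strategy]
            | S2 in strategy].

End game.

(* Main.v *)
(* The noise is orthogonal to the chosen vector nu, so |x + h|^2 averages to more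
   than |x|^2 for every nu, and exp(s|x|^2) with s large grows by a fixed amount in
   mean over each turn, whatever the players do. Hence g = A - exp(s|x|^2), which is
   bounded between 1 and A on the domain, drops in mean by at least 1 per turn.
   - T contracts the sup norm weighted by g. It maps continuous functions to
     continuous functions: W(u; x, nu) is equicontinuous in x uniformly in nu, and
     1 - delta vanishes at the boundary. Picard iteration gives existence and
     uniqueness.
   - The game ends almost surely, uniformly in the strategies. So the laws of the
     game stopped after k turns, restricted to the plays that have exited, increase
     to a law of the whole game, and no extension theorem is needed.
   - When Player I follows a measurable near-optimal Markov strategy (constant
     choice on the cells of a fine grid), u - r g is a submartingale for a small
     r > 0, whatever Player II does; this gives u <= value1. The estimate for
     Player II is symmetric. *)
Require Import Defs.
From HB Require Import structures.
From mathcomp Require Import finmap all_boot all_order all_algebra.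
From mathcomp Require Import all_classical all_reals all_analysis.
From mathcomp Require Import measurable_realfun lra ring.

Set Implicit Arguments.
Unset Strict Implicit.
Unset Printing Implicit Defensive.
Import Order.TTheory GRing.Theory Num.Theory.
Import numFieldNormedType.Exports.
Local Open Scope classical_set_scope.
Local Open Scope ring_scope.

(** * Euclidean norm and continuity on compact sets *)

Section euclid.
Context {R : realType} {n : nat}.
Implicit Types (x y z u v : 'rV[R]_n) (A K : set 'rV[R]_n).

(** The drift has two sources: [p] is bounded above, so the noise branch keeps a probability bounded
    away from 0, and [n >= 2], so the noise has at least one dimension to live in. The chart
    [plane_pt nu] is built from a reflection that is discontinuous in [nu] at the last axis.
    Regularity is therefore taken in [x] alone, with one modulus for all [nu], and suprema over
    directions are approached without claiming a maximizer. Functions are continuous only on the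
    closure of [Omega_eps] and strategies are constrained only on legal histories, whereas
    integration wants total measurable functions. Everything is extended by a constant, and
    inequalities are asked only where the token almost surely is. The noise of a turn is drawn from
    one fixed space, whatever the direction. A turn becomes a measurable function of history and
    noise, and kernel integrals become integrals over a product measure. The estimates hold for
    every law of the game, hence for the one that [law] picks. They are made at a finite time, with
    a geometrically small error, in place of a stopping theorem. *)

Lemma dotDr x u v : dot x (u + v) = dot x u + dot x v.
Proof. by rewrite -big_split; apply: eq_bigr => i _; rewrite !mxE mulrDr. Qed.

Lemma dotDl x u v : dot (u + v) x = dot u x + dot v x.
Proof. by rewrite dotC dotDr !(dotC x). Qed.

Lemma dotZl x (a : R) u : dot (a *: u) x = a * dot u x.
Proof. by rewrite dotC dotZr dotC. Qed.

Lemma enorm_ge0 u : 0 <= enorm u.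
Proof. exact: sqrtr_ge0. Qed.

Lemma enorm0 : enorm (0 : 'rV[R]_n) = 0.
Proof. by apply/eqP; rewrite enorm_eq0. Qed.

Lemma enormZ (a : R) u : enorm (a *: u) = `|a| * enorm u.
Proof.
by rewrite /enorm dotZl dotZr mulrA -expr2 sqrtrM ?sqr_ge0// sqrtr_sqr.
Qed.

Lemma enormN u : enorm (- u) = enorm u.
Proof. by rewrite -scaleN1r enormZ normrN1 mul1r. Qed.

Lemma enormB u v : enorm (u - v) = enorm (v - u).
Proof. by rewrite -enormN opprB. Qed.

Lemma dot_le u v : dot u v <= enorm u * enorm v.
Proof.
have [->|v0] := eqVneq v 0.
  by rewrite enorm0 mulr0 /dot big1// => i _; rewrite mxE mulr0.
have vv : 0 < dot v v by rewrite lt_neqAle eq_sym dot_eq0 v0 dot_ge0.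
have [|uv] := leP (dot u v) 0.
  by move=> /le_trans; apply; rewrite mulr_ge0 ?enorm_ge0.
rewrite -(@ler_pXn2r _ 2)// ?nnegrE ?(ltW uv)//; last first.
  by rewrite mulr_ge0 ?enorm_ge0.
rewrite exprMn !enorm_sqr.
(* Cauchy-Schwarz: the squared norm of this combination is [dot v v] times the defect of the
   inequality. *)
have := dot_ge0 (dot v v *: u - dot u v *: v).
rewrite dotBr !dotZr !(dotC (_ - _)) !dotBr !dotZr (dotC v u).
rewrite (_ : _ - _ = dot v v * (dot u u * dot v v - dot u v ^+ 2)); last by ring.
by rewrite pmulr_rge0// subr_ge0.
Qed.

Lemma enormD u v : enorm (u + v) <= enorm u + enorm v.
Proof.
rewrite -(@ler_pXn2r _ 2)// ?nnegrE ?addr_ge0 ?enorm_ge0//.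
rewrite sqrrD !enorm_sqr dotDl !dotDr (dotC v u).
by have := dot_le u v; lra.
Qed.

Lemma enorm_dist u v w : enorm (u - w) <= enorm (u - v) + enorm (v - w).
Proof. by rewrite -(subrKA v); exact: enormD. Qed.

Lemma coord_le_enorm u i : `|u 0 i| <= enorm u.
Proof.
rewrite -sqrtr_sqr ler_sqrt ?dot_ge0// /dot (bigD1 i)//= expr2 lerDl sumr_ge0//.
by move=> j _; rewrite -expr2 sqr_ge0.
Qed.

Lemma enorm_le_coord u (r : R) : (forall i, `|u 0 i| <= r) -> enorm u <= n%:R * r.
Proof.
move=> ur; have [n0|n0] := posnP n.
  have i0 (i : 'I_n) : False by move: (ltn_ord i); rewrite [X in (_ < X)%N]n0.
  rewrite [X in X%:R](_ : _ = 0%N)// mul0r /enorm /dot big1 ?sqrtr0// => i.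
have r0 : 0 <= r by rewrite (le_trans _ (ur (Ordinal n0))).
rewrite -(@ler_pXn2r _ 2)// ?nnegrE ?enorm_ge0 ?mulr_ge0// enorm_sqr exprMn.
rewrite (@le_trans _ _ (\sum_(i < n) r ^+ 2))//.
  apply: ler_sum => i _; rewrite -expr2 -real_normK ?num_real//.
  by rewrite lerXn2r ?nnegrE.
rewrite sumr_const card_ord -(mulr_natl (r ^+ 2)) ler_wpM2r ?sqr_ge0//.
by rewrite expr2 ler_peMl ?ler1n.
Qed.

(** The bridge from the sup-norm balls of the library to Euclidean ones; the two norms differ by a
    factor of at most [n]. *)
Lemma enorm_nbhsP x (P : set 'rV[R]_n) :
  nbhs x P <-> exists2 d : R, 0 < d & forall y, enorm (y - x) < d -> P y.
Proof.
split=> [/nbhs_ballP[d /= d0 dP]|[d d0 dP]].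
  exists d => // y yx; apply: dP; split => // i j; rewrite !ord1 /ball/=.
  by rewrite -normrN opprB; apply: le_lt_trans yx; have := coord_le_enorm (y - x) j; rewrite !mxE.
apply/nbhs_ballP; exists (d / n.+1%:R) => /=; first by rewrite divr_gt0.
move=> y [_ xy]; apply: dP.
apply: (@le_lt_trans _ _ (n%:R * (d / n.+1%:R))).
  apply: enorm_le_coord => i; have := xy 0 i; rewrite /ball/= !mxE => /ltW.
  by rewrite -normrN opprB.
by rewrite mulrA ltr_pdivrMr// mulrC ltr_pM2l// ltr_nat.
Qed.

Lemma within_contP A (f : 'rV[R]_n -> R) : {within A, continuous f} <->
  forall x, A x -> forall e : R, 0 < e ->
    exists2 d : R, 0 < d & forall y, A y -> enorm (y - x) < d -> `|f y - f x| < e.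
Proof.
rewrite continuous_subspace_in; split => [fA x Ax e e0|fA x].
  have := fA x (mem_set Ax); move=> /cvgrPdist_lt/(_ _ e0).
  rewrite /prop_near1 /nbhs/= -nbhs_subspace_in// => /enorm_nbhsP[d d0 dP].
  by exists d => // y Ay yx; rewrite -normrN opprB; exact: dP.
rewrite inE => Ax; apply/cvgrPdist_lt => e e0.
rewrite /prop_near1 /nbhs/= -nbhs_subspace_in//; apply/enorm_nbhsP.
have [d d0 dP] := fA x Ax e e0; exists d => // y yx Ay.
by rewrite -normrN opprB; exact: dP.
Qed.

Lemma enorm_closure A x :
  closure A x <-> forall e : R, 0 < e -> exists2 y, A y & enorm (y - x) < e.
Proof.
split=> [Ax e e0|Ax B /enorm_nbhsP[d d0 dB]].
  have [|y [Ay]] := Ax [set y | enorm (y - x) < e]; first by apply/enorm_nbhsP; exists e.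
  by exists y.
by have [y Ay yx] := Ax d d0; exists y; split => //; exact: dB.
Qed.

Lemma enorm_bounded A : bounded_set A -> exists2 M : R, 0 < M & forall x, A x -> enorm x <= M.
Proof.
move=> [M [_ AM]]; exists (n%:R * (`|M| + 1) + 1).
  by rewrite ltr_pwDr// mulr_ge0// addr_ge0.
move=> x Ax; rewrite (le_trans (enorm_le_coord (r := `|M| + 1) _)) ?lerDl// => i.
have xM : `|x| <= `|M| + 1 by apply: AM => //; rewrite (le_lt_trans (ler_norm M))// ltrDl.
apply: le_trans xM; rewrite [leRHS]/Num.Def.normr/= mx_normrE.
exact: (le_bigmax _ (fun ij => `|x ij.1 ij.2|) (0, i)).
Qed.

Lemma bounded_enorm A (M : R) : (forall x, A x -> enorm x <= M) -> bounded_set A.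
Proof.
move=> AM; exists M; split; rewrite ?num_real// => r Mr x Ax.
rewrite /= [leLHS]/Num.Def.normr/= mx_normrE (bigmax_le _ _) => //[|[i j] _].
  by rewrite (le_trans (enorm_ge0 x))// (le_trans (AM _ Ax))// ltW.
by rewrite /= ord1 (le_trans (coord_le_enorm _ _))// (le_trans (AM _ Ax))// ltW.
Qed.

Lemma compact_within_bounded K (f : 'rV[R]_n -> R) : compact K ->
  {within K, continuous f} -> exists2 M : R, 0 < M & forall x, K x -> `|f x| <= M.
Proof.
move=> cK fK; have /compact_bounded[M [_ MK]] := continuous_compact fK cK.
exists (`|M| + 1); first by rewrite ltr_pwDr.
move=> x Kx; apply: (MK (`|M| + 1)); last by exists x.
by rewrite (le_lt_trans (ler_norm M))// ltrDl.
Qed.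

Lemma compact_within_unif K (f : 'rV[R]_n -> R) : compact K ->
  {within K, continuous f} -> forall e : R, 0 < e ->
  exists2 d : R, 0 < d & forall x y, K x -> K y -> enorm (y - x) < d -> `|f y - f x| < e.
Proof.
move=> cK /within_contP fK e e0.
have /choice[D DP] : forall x, exists d, K x -> 0 < d /\
    forall y, K y -> enorm (y - x) < d -> `|f y - f x| < e / 2.
  move=> x; have [Kx|Kx] := pselect (K x); last by exists 0.
  have [d d0 dP] := fK x Kx (e / 2) ltac:(by rewrite divr_gt0).
  by exists d.
move: cK; rewrite compact_cover => cK.
(* Half radii: if [x] is in the half ball of a centre and [y] is within half that radius of [x],
   both lie in the full ball. The least half radius of a finite subcover is the modulus. *)
pose B (x : 'rV[R]_n) := [set y | enorm (y - x) < D x / 2]%classic.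
have [] := cK _ K B.
- move=> x Kx; rewrite openE => y yB; rewrite /interior; apply/enorm_nbhsP.
  exists (D x / 2 - enorm (y - x)); first by rewrite subr_gt0.
  move=> z zy; rewrite /B/= (le_lt_trans (enorm_dist _ y _))//.
  by rewrite -ltrBrDr.
- by move=> x Kx; exists x => //; rewrite /B/= subrr enorm0 divr_gt0// (DP x Kx).1.
move=> s sK KB.
have sD : exists2 d : R, 0 < d & forall x, x \in s -> d <= D x / 2.
  have : forall x, x \in s -> 0 < D x / 2.
    by move=> x /sK; rewrite inE => /DP[? _]; rewrite divr_gt0.
  rewrite /=; elim/finSet_rect: s {sK KB} => s IH sD.
  have [->|[x xs]] := fset_0Vmem s; first by exists 1.
  have [d d0 dP] := IH _ (fproperD1 xs) (fun y ys => sD y (fsubsetP (fsubD1set _ _) y ys)).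
  exists (Num.min d (D x / 2)) => [|y ys]; first by rewrite lt_min d0 sD.
  have [->|yx] := eqVneq y x; first by rewrite ge_min lexx orbT.
  by rewrite ge_min dP// !inE yx ys.
have [d d0 dP] := sD; exists d => // x y Kx Ky yx.
have [z zs /=] := KB x Kx; rewrite /B/= => xz.
have [zD zP] : 0 < D z /\ forall y, K y -> enorm (y - z) < D z -> `|f y - f z| < e / 2.
  by apply: DP; have /= := sK z zs; rewrite inE.
have xzD : enorm (x - z) < D z by apply: lt_le_trans xz _; lra.
have yzD : enorm (y - z) < D z.
  have dz := dP z zs.
  by rewrite (le_lt_trans (enorm_dist _ x _))// (splitr (D z)) ltrD// (lt_le_trans yx).
rewrite -(subrKA (f z)) (splitr e) (le_lt_trans (ler_normD _ _))// ltrD ?zP//.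
by rewrite -normrN opprB zP.
Qed.

Lemma closed_measurable_Rn A : closed A -> measurable (A : set (borelRn R n)).
Proof.
move=> cA; rewrite -[A]setCK; apply: measurableC.
by apply: sub_gen_smallest; exact: closed_openC.
Qed.

Lemma open_measurable_Rn A : open A -> measurable (A : set (borelRn R n)).
Proof. exact: sub_gen_smallest. Qed.

(** The preimage of an open [U] is a relatively open part of [K], joined with all of the complement
    of [K] exactly when [U] contains 0. *)
Lemma within_patch_measurable K (f : 'rV[R]_n -> R) : closed K ->
  {within K, continuous f} -> measurable_fun setT (f \_ K : borelRn R n -> R).
Proof.
move=> cK /continuousP fK.
apply: (measurability _ (RGenOpens.measurableE R)).
move=> _ [_ [a [b ->] <-]]; rewrite setTI; set U := (X in _ @^-1` X).
have [V oV VK] := (open_subspaceP _ _).1 (fK U (interval_open (a := BRight a) (b := BLeft b) isT isT)).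
have -> : (f \_ K) @^-1` U = (V `&` K) `|` (if (0 : R) \in U then ~` K else set0).
  rewrite VK; apply/seteqP; split=> x /=; rewrite patchE.
    case: ifPn => [/set_mem Kx Ux|/negP Kx U0]; [by left|].
    by right; rewrite (mem_set U0) => Kx'; apply: Kx; exact: mem_set.
  move=> [[Ux Kx]|]; first by rewrite mem_set.
  by case: ifPn => // /set_mem U0 Kx; rewrite memNset.
apply: measurableU.
  by apply: measurableI; [exact: open_measurable_Rn|exact: closed_measurable_Rn].
by case: ifPn => // _; apply: measurableC; exact: closed_measurable_Rn.
Qed.

Lemma lipschitz_measurable (f : 'rV[R]_n -> R) :
  (forall x y, `|f x - f y| <= enorm (x - y)) -> measurable_fun setT (f : borelRn R n -> R).
Proof.
move=> lf; rewrite -(patch_setT (fun=> 0) f); apply: within_patch_measurable => //.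
apply/within_contP => x _ e e0; exists e => // y _ yx.
by rewrite (le_lt_trans (lf _ _)).
Qed.

Lemma coord_measurable (i : 'I_n) : measurable_fun setT (fun x : borelRn R n => x 0 i).
Proof.
apply: lipschitz_measurable => x y.
by have := coord_le_enorm (x - y) i; rewrite !mxE.
Qed.
End euclid.

(** * Means of bounded measurable functions *)

Section bounded_measurable.
Context {R : realType}.

(** Such functions are integrable against every probability measure and closed under the operations
    below, so means can be computed without integrability side conditions. *)
Definition bmeas d (T : measurableType d) (f : T -> R) :=
  measurable_fun setT f /\ exists M : R, forall x, `|f x| <= M.

Section bmeas_theory.
Context d (T : measurableType d).
Implicit Types f g : T -> R.

Lemma bmeas_cst (c : R) : bmeas (cst c : T -> R).
Proof. by split; [exact: measurable_cst|exists `|c|]. Qed.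

Lemma bmeasD f g : bmeas f -> bmeas g -> bmeas (fun x => f x + g x).
Proof.
move=> [mf [M fM]] [mg [N gN]]; split; first exact: measurable_funD.
by exists (M + N) => x; rewrite (le_trans (ler_normD _ _))// lerD.
Qed.

Lemma bmeasM f g : bmeas f -> bmeas g -> bmeas (fun x => f x * g x).
Proof.
move=> [mf [M fM]] [mg [N gN]]; split; first exact: measurable_funM.
by exists (M * N) => x; rewrite normrM ler_pM.
Qed.

Lemma bmeasZ (c : R) f : bmeas f -> bmeas (fun x => c * f x).
Proof. by apply: bmeasM; exact: bmeas_cst. Qed.

Lemma bmeasN f : bmeas f -> bmeas (fun x => - f x).
Proof.
by move=> /(bmeasZ (-1)); congr bmeas; apply/funext => x; rewrite mulN1r.
Qed.

Lemma bmeasB f g : bmeas f -> bmeas g -> bmeas (fun x => f x - g x).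
Proof. by move=> bf bg; apply: bmeasD => //; exact: bmeasN. Qed.

Lemma bmeas_indic (A : set T) : measurable A -> bmeas (\1_A : T -> R).
Proof.
move=> mA; split; first exact: measurable_indic.
by exists 1 => x; rewrite indicE; case: (_ \in _); rewrite ?normr1 ?normr0.
Qed.

Lemma bmeas_comp d' (T' : measurableType d') (phi : T' -> T) f :
  measurable_fun setT phi -> bmeas f -> bmeas (f \o phi).
Proof.
move=> mphi [mf [M fM]]; split; first exact: measurableT_comp.
by exists M => x /=.
Qed.

Lemma bmeas_integrable (P : probability T R) (A : set T) f :
  measurable A -> bmeas f -> P.-integrable A (EFin \o f).
Proof.
move=> mA [mf [M fM]]; apply: measurable_bounded_integrable => //.
- by rewrite ltey_eq fin_num_measure.
- exact: measurable_funTS.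
- exists M; split; first by rewrite num_real.
  by move=> N MN x _; rewrite /= (le_trans (fM x))// ltW.
Qed.

End bmeas_theory.

Section mean.
Context d (T : measurableType d) (P : probability T R).
Implicit Types f g : T -> R.

Lemma meanD f g : bmeas f -> bmeas g ->
  \int[P]_x (f x + g x) = \int[P]_x f x + \int[P]_x g x.
Proof. by move=> bf bg; rewrite RintegralD//; exact: bmeas_integrable. Qed.

Lemma meanZ (c : R) f : bmeas f -> \int[P]_x (c * f x) = c * \int[P]_x f x.
Proof. by move=> bf; rewrite RintegralZl//; exact: bmeas_integrable. Qed.

Lemma mean_cst (c : R) : \int[P]_x c = c.
Proof. by rewrite Rintegral_cst// (_ : _ setT = 1%E) ?mulr1//; exact: probability_setT. Qed.

Lemma meanN f : bmeas f -> \int[P]_x (- f x) = - \int[P]_x f x.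
Proof.
by move=> bf; rewrite -mulN1r -meanZ//; apply: eq_Rintegral => x _; rewrite mulN1r.
Qed.

Lemma meanB f g : bmeas f -> bmeas g ->
  \int[P]_x (f x - g x) = \int[P]_x f x - \int[P]_x g x.
Proof. by move=> bf bg; rewrite meanD ?meanN//; exact: bmeasN. Qed.

Lemma le_mean f g : bmeas f -> bmeas g -> (forall x, f x <= g x) ->
  \int[P]_x f x <= \int[P]_x g x.
Proof. by move=> bf bg fg; apply: le_Rintegral => //; exact: bmeas_integrable. Qed.

Lemma mean_norm_le f M : bmeas f -> (forall x, `|f x| <= M) ->
  `|\int[P]_x f x| <= M.
Proof.
move=> bf fM; rewrite ler_norml; apply/andP; split.
  rewrite -[leLHS]mean_cst; apply: le_mean => //; first exact: bmeas_cst.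
  by move=> x; have := fM x; rewrite ler_norml => /andP[].
rewrite -[leRHS]mean_cst; apply: le_mean => //; first exact: bmeas_cst.
by move=> x; have := fM x; rewrite ler_norml => /andP[].
Qed.

Lemma mean_indic (A : set T) : measurable A -> (\int[P]_x \1_A x)%:E = P A.
Proof.
move=> mA; rewrite fineK ?integral_indic ?setIT//.
by rewrite fin_num_measure.
Qed.

Lemma bmeas_mean f : bmeas f -> (\int[P]_x f x)%:E = (\int[P]_x (f x)%:E)%E.
Proof.
by move=> bf; rewrite fineK//; apply: integrable_fin_num => //; exact: bmeas_integrable.
Qed.

End mean.

Section mean_prod.
Context d1 (T1 : measurableType d1) d2 (T2 : measurableType d2).
Variables (P : probability T1 R) (Q : probability T2 R).

Lemma bmeas_fix (f : T1 * T2 -> R) x : bmeas f -> bmeas (fun y => f (x, y)).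
Proof. by move=> bf; apply: bmeas_comp bf; exact: measurable_pair1. Qed.

Lemma bmeas_fubini (f : T1 * T2 -> R) : bmeas f -> bmeas (fun x => \int[Q]_y f (x, y)).
Proof.
move=> bf; split.
  apply/measurable_EFinP.
  have : (P \x Q)%E.-integrable setT (EFin \o f).
    exact: (@bmeas_integrable _ _ ((P \x Q)%E : probability _ _)).
  move/measurable_fubini_F; congr measurable_fun; apply/funext => x.
  by rewrite /fubini_F /= bmeas_mean//; exact: bmeas_fix.
have [_ [M fM]] := bf; exists M => x.
by apply: mean_norm_le => //; exact: bmeas_fix.
Qed.

Lemma mean_prod (f : T1 * T2 -> R) : bmeas f ->
  \int[(P \x Q)%E]_z f z = \int[P]_x \int[Q]_y f (x, y).
Proof.
move=> bf; congr fine; rewrite -integral12_prod_meas1//; last first.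
  exact: (@bmeas_integrable _ _ ((P \x Q)%E : probability _ _)).
apply: eq_integral => x _; rewrite /fubini_F/= bmeas_mean//.
exact: bmeas_fix.
Qed.

End mean_prod.
End bounded_measurable.

(** * The uniform law on a disc *)

Section lebesgue_boxes.
Context {R : realType}.
Local Notation RR := (measurableTypeR R).

Definition box k (a b : 'I_k -> R) : set (k.-tuple RR) :=
  [set t | forall i, a i <= tnth t i <= b i].

Lemma box_measurable k (a b : 'I_k -> R) : measurable (box a b).
Proof.
have -> : box a b = \bigcap_(i in [set: 'I_k])
    ((fun t : k.-tuple RR => tnth t i) @^-1` `[a i, b i]).
  apply/seteqP; split => t /= h i; first by move=> _; rewrite /= in_itv/=.
  by have := h i Logic.I; rewrite /= in_itv.
apply: fin_bigcap_measurable => // i _; rewrite -[X in measurable X]setTI.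
exact: (measurable_tnth i).
Qed.

Lemma lebesgue_box k (a b : 'I_k -> R) : (forall i, a i <= b i) ->
  lebesgue k (box a b) = (\prod_(i < k) (b i - a i))%:E.
Proof.
elim: k a b => [|k IH] a b ab.
  rewrite big_ord0 /= diracE mem_set// => -[]//.
rewrite /= /lebesgue_succ /pushforward.
rewrite (_ : _ @^-1` _ = `[a ord0, b ord0] `*`
    box (a \o lift ord0) (b \o lift ord0)); last first.
  apply/seteqP; split => -[x t] /=; rewrite in_itv/=.
    move=> h; split; first by have := h ord0.
    by move=> i; have := h (lift ord0 i); rewrite !(tnth_nth 0).
  move=> [x01 h] i; case: (unliftP ord0 i) => [j ->|->]; last by [].
  by have := h j; rewrite !(tnth_nth 0).
rewrite product_measure1E//; last exact: box_measurable.
rewrite IH; last by move=> i; exact: ab.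
rewrite [X in (X * _)%E](_ : _ = (b ord0 - a ord0)%:E); last first.
  apply: etrans (lebesgue_measure_itv `[a ord0, b ord0]) _.
  rewrite /= lte_fin; case: ltP => // ba.
  by rewrite (_ : b ord0 = a ord0) ?subrr//; apply/eqP; rewrite eq_le ba ab.
by rewrite big_ord_recl EFinM.
Qed.

Definition eball k (r : R) : set (k.-tuple RR) :=
  [set t | \sum_i tnth t i ^+ 2 < r ^+ 2].

Lemma eball_measurable k (r : R) : measurable (@eball k r).
Proof.
rewrite (_ : eball _ = (fun t : k.-tuple RR => \sum_i tnth t i ^+ 2) @^-1` `]-oo, (r ^+ 2)[).
  rewrite -[X in measurable X]setTI; apply: measurable_sum => // i.
  by apply: measurable_funX; exact: measurable_tnth.
by apply/seteqP; split => t /=; rewrite in_itv.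
Qed.

Lemma eball_lty k (r : R) : 0 < r -> (lebesgue k (@eball k r) < +oo)%E.
Proof.
move=> r0; apply: (@le_lt_trans _ _ (lebesgue k (box (fun=> - r) (fun=> r)))).
  apply: le_measure; rewrite ?inE; [exact: eball_measurable|exact: box_measurable|].
  move=> t tr i; rewrite -ler_norml -(@ler_pXn2r _ 2) ?nnegrE ?(ltW r0)//.
  rewrite real_normK ?num_real// (le_trans _ (ltW tr))// (bigD1 i)//= lerDl.
  by rewrite sumr_ge0// => j _; rewrite sqr_ge0.
by rewrite lebesgue_box ?ltry// => _; rewrite (@le_trans _ _ 0) ?oppr_le0 ?ltW.
Qed.

Lemma box_eball k (r : R) (s : 'I_k -> bool) : 0 < r ->
  let c := r / (2 * k.+1%:R) in
  box (fun i => if s i then c else - (2 * c)) (fun i => if s i then 2 * c else - c)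
    `<=` @eball k r.
Proof.
move=> r0 c t h.
have c0 : 0 < c by rewrite divr_gt0// mulr_gt0.
(* Each of the [k] coordinates is at most [2 * c = r / k.+1] in modulus, and [k < k.+1 ^ 2]. The
   signs [s] are free, which [sign_box] exploits. *)
rewrite /eball/=; apply: (@le_lt_trans _ _ (\sum_(i < k) (2 * c) ^+ 2)).
  apply: ler_sum => i _; rewrite -real_normK ?num_real// lerXn2r ?nnegrE//.
    by rewrite mulr_ge0// ltW.
  by rewrite ler_norml; have := h i; case: (s i) => /andP[? ?]; apply/andP; split; lra.
rewrite sumr_const card_ord -(mulr_natl ((2 * c) ^+ 2)) (_ : 2 * c = r / k.+1%:R); last first.
  by rewrite /c; field.
rewrite expr_div_n mulrCA -[ltRHS]mulr1 ltr_pM2l ?exprn_gt0//.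
rewrite ltr_pdivrMr ?exprn_gt0// mul1r -natrX ltr_nat expnS.
by rewrite expn1 (leq_trans (ltnSn k))// leq_pmulr.
Qed.

Lemma eball_gt0 k (r : R) : 0 < r -> (0 < lebesgue k (@eball k r))%E.
Proof.
move=> r0; have c0 : 0 < r / (2 * k.+1%:R) by rewrite divr_gt0// mulr_gt0.
have /= sub := @box_eball k r (fun=> true) r0.
set c := r / _ in c0 sub.
apply: (@lt_le_trans _ _ (lebesgue k (box (fun=> c) (fun=> 2 * c)))).
  by rewrite lebesgue_box => [|i]; rewrite ?lte_fin ?prodr_gt0// => *; lra.
apply: le_measure sub; rewrite ?inE; [exact: box_measurable|exact: eball_measurable].
Qed.

End lebesgue_boxes.

(** * Means under a measure conditioned on a set *)

Section conditional_mean.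
Context {R : realType} d (T : measurableType d) d' (T' : measurableType d').
Variables (P : probability T R) (m : {measure set T' -> \bar R}) (D : set T').
Variables (phi : T -> T') (c : R).
Hypotheses (mD : measurable D) (mDy : (m D < +oo)%E) (mphi : measurable_fun setT phi).
Hypotheses (c0 : 0 <= c) (PE : forall A, measurable A -> P (phi @^-1` A) = (c%:E * m (D `&` A))%E).

Lemma bmeas_integrable_on (f : T' -> R) : bmeas f -> m.-integrable D (EFin \o f).
Proof.
move=> [mf [M fM]]; apply: measurable_bounded_integrable => //.
  exact: measurable_funTS.
exists M; split; first by rewrite num_real.
by move=> N MN x _; rewrite /= (le_trans (fM x))// ltW.
Qed.

(** The image of [P] under [phi] is [c] times the restriction of [m] to [D]. The abstract form
    serves both the measure on a hyperplane ([disc_avgE]) and Lebesgue measure on a ball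
    ([mean_ball]). *)
Lemma conditional_mean (f : T' -> R) : bmeas f ->
  \int[P]_x f (phi x) = c * \int[m]_(x in D) f x.
Proof.
move=> bf; have mf : measurable_fun setT (EFin \o f).
  by apply/measurable_EFinP; exact: bf.1.
have intf : P.-integrable (phi @^-1` setT) ((EFin \o f) \o phi).
  by rewrite preimage_setT; apply: bmeas_integrable => //; exact: bmeas_comp.
have -> : \int[P]_x f (phi x) = fine (\int[mscale (NngNum c0) m]_(x in D) (f x)%:E)%E.
  congr fine.
  rewrite -[LHS](integral_pushforward mphi mf intf)//.
  rewrite (@negligible_integral _ _ _ _ _ (~` D))//; first last.
  - apply: etrans (PE (measurableC mD)) _.
    by rewrite setICr measure0 mule0.
  - exact: integrable_pushforward.
  - exact: measurableC.
  rewrite setTD setCK; apply: eq_measure_integral => A mA AD.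
  apply: etrans (PE mA) _; rewrite /mscale/=.
  by rewrite (_ : D `&` A = A)//; apply/setIidPr.
have fin := integrable_fin_num mD (bmeas_integrable_on bf).
transitivity (fine (c%:E * \int[m]_(x in D) (f x)%:E)%E); last by rewrite fineM.
congr fine; rewrite [LHS]integralE [in RHS]integralE.
rewrite !ge0_integral_mscale//; first last.
- exact/measurable_funepos/measurable_funTS.
- exact/measurable_funeneg/measurable_funTS.
rewrite -muleBr// fin_num_adde_defl// fin_numN.
apply: integrable_fin_num => //; apply: integrable_funeneg => //.
exact: bmeas_integrable_on.
Qed.
End conditional_mean.

Lemma mnormalizeE (R : realType) d (T : measurableType d)
    (m : {measure set T -> \bar R}) (P : probability T R) (A : set T) :
  m setT != 0%E -> m setT != +oo%E ->
  mnormalize m P A = (m A * (fine (m setT))^-1%:E)%E.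
Proof. by move=> m0 my; rewrite /mnormalize (negbTE m0) (negbTE my). Qed.

(** * The uniform law on a ball and its image on a disc *)

Section unif_ball.
Context {R : realType}.
Local Notation RR := (measurableTypeR R).

(** The Dirac mass is the default of [mnormalize] for zero or infinite total mass; both cases are
    excluded when [0 < r]. *)
Definition unif_ball k (r : R) : probability (k.-tuple RR) R :=
  mnormalize (mrestr (lebesgue k) (@eball_measurable R k r))
    (\d_([tuple 0 | i < k] : k.-tuple RR) : probability _ R).

Lemma unif_ballE k (r : R) (A : set (k.-tuple RR)) : 0 < r -> measurable A ->
  unif_ball k r A =
  ((fine (lebesgue k (@eball R k r)))^-1%:E * lebesgue k (@eball R k r `&` A))%E.
Proof.
move=> r0 mA; have e0 := @eball_gt0 R k r r0; have ey := @eball_lty R k r r0.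
have eE : mrestr (lebesgue k) (@eball_measurable R k r) setT = lebesgue k (@eball R k r).
  by rewrite /mrestr setTI.
rewrite muleC setIC -eE; apply: mnormalizeE.
  by apply: (contraTneq _ e0) => e; rewrite -eE e ltxx.
by apply: (contraTneq _ ey) => e; rewrite -eE e ltxx.
Qed.

Context {n : nat} (eps : R) (eps0 : 0 < eps).

Lemma dot_enorm_lt (z : 'rV[R]_n) : (enorm z < eps) = (dot z z < eps ^+ 2).
Proof.
by rewrite -(@ltr_pXn2r _ 2) ?nnegrE ?enorm_ge0 ?(ltW eps0)// enorm_sqr.
Qed.

(** The chart is an isometry onto the hyperplane, so the discs of all directions pull back to the
    same ball. This is what allows the noise to be drawn independently of the direction. *)
Lemma plane_pt_disc (nu : 'rV[R]_n) : nu != 0 ->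
  plane_pt nu @^-1` disc eps nu = @eball R n.-1 eps.
Proof.
move=> nu0; have tE t : dot (plane_pt nu t) (plane_pt nu t) = \sum_i tnth t i ^+ 2.
  by rewrite dot_plane_pt; apply: eq_bigr => i _; rewrite expr2.
apply/seteqP; split => t /=; rewrite /disc/eball/= plane_pt_perp// dot_enorm_lt tE.
  by case.
by [].
Qed.

Lemma measurable_dot (nu : 'rV[R]_n) :
  measurable_fun setT (fun z : borelRn R n => dot z nu).
Proof.
apply: measurable_sum => i; apply: measurable_funM => //; exact: coord_measurable.
Qed.

Lemma disc_measurable (nu : 'rV[R]_n) : measurable (disc eps nu : set (borelRn R n)).
Proof.
have -> : disc eps nu = (enorm @^-1` `]-oo, eps[) `&` ((fun z => dot z nu) @^-1` [set 0]).
  by apply/seteqP; split => z /=; rewrite in_itv.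
apply: measurableI; rewrite -[X in measurable X]setTI.
  apply: lipschitz_measurable => // x y.
  rewrite ler_norml lerBDl; apply/andP; split.
    by have := enormD (y - x) x; rewrite subrK enormB; lra.
  by have := enormD (x - y) y; rewrite subrK; lra.
exact: measurable_dot.
Qed.

Lemma unif_discE (nu : 'rV[R]_n) (B : set (borelRn R n)) : nu != 0 -> measurable B ->
  unif_disc eps nu B = unif_ball n.-1 eps (plane_pt nu @^-1` B).
Proof.
move=> nu0 mB; rewrite unif_ballE//; last first.
  by rewrite -[X in measurable X]setTI; exact: measurable_plane_pt.
rewrite /unif_disc /hyperplane_lebesgue /pushforward.
by rewrite -(plane_pt_disc nu0).
Qed.

Lemma disc_avgE (nu : 'rV[R]_n) (f : borelRn R n -> R) : nu != 0 -> bmeas f ->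
  disc_avg eps nu f = \int[unif_ball n.-1 eps]_t f (plane_pt nu t).
Proof.
move=> nu0 bf; rewrite /disc_avg.
apply/esym/conditional_mean => //.
- exact: disc_measurable.
- rewrite /= /hyperplane_lebesgue /pushforward plane_pt_disc//.
  exact: eball_lty.
- exact: measurable_plane_pt.
- rewrite invr_ge0 fine_ge0//.
- by move=> A mA; rewrite -unif_discE.
Qed.
End unif_ball.

(** * One turn of the game as a function of independent noise *)

Section move.
Context {R : realType} {n : nat}.
Local Notation RR := (measurableTypeR R).
Local Notation E := (borelRn R n).

Lemma measurable_invr : measurable_fun setT (fun x : RR => x^-1).
Proof.
have -> : (fun x : RR => x^-1) = (fun x => if x == 0 then 0 else x^-1).
  by apply/funext => x; case: eqP => // ->; rewrite invr0.
have op : open [set x : R | x != 0].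
  rewrite (_ : mkset _ = ~` [set 0]); first exact/closed_openC/closed_eq.
  by apply/seteqP; split => x /= /eqP.
apply: measurable_fun_if => //.
- by apply: measurable_fun_eqr => //; exact: measurable_cst.
- rewrite setTI (_ : _ @^-1` _ = [set x : R | x != 0]); last first.
    by apply/seteqP; split => x /=; case: eqP.
  by apply: open_continuous_measurable_fun => // x; rewrite inE/=; exact: inv_continuous.
Qed.

Lemma enorm_measurable : measurable_fun setT (@enorm R n : E -> RR).
Proof.
apply: lipschitz_measurable => // x y.
rewrite ler_norml lerBDl; apply/andP; split.
  by have := enormD (y - x) x; rewrite subrK enormB; lra.
by have := enormD (x - y) y; rewrite subrK; lra.
Qed.

Section joint.
Context d (T : measurableType d).

Lemma measurable_coord (x : T -> E) i :
  measurable_fun setT x -> measurable_fun setT (fun t => x t 0 i).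
Proof. by move=> mx; exact: (measurableT_comp (coord_measurable i) mx). Qed.

Lemma measurable_addRn (x y : T -> E) : measurable_fun setT x ->
  measurable_fun setT y -> measurable_fun setT (fun t => (x t + y t : 'rV[R]_n) : E).
Proof.
move=> mx my; apply: measurable_fun_borelRn => i; under eq_fun do rewrite mxE.
by apply: measurable_funD; exact: measurable_coord.
Qed.

(** In the game the direction is itself a function of the history, so measurability is needed
    jointly. The entries of the reflection are built from [nu] by ring operations, square root and
    inverse, all measurable even where the inverse is discontinuous. *)
Lemma measurable_plane_pt2 (nu : T -> E) (t : T -> n.-1.-tuple RR) :
  measurable_fun setT nu -> measurable_fun setT t ->
  measurable_fun setT (fun w => plane_pt (nu w) (t w) : E).
Proof.
move=> mnu mt.
have mgap i : measurable_fun setT (fun w => axis_gap (nu w) 0 i).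
  under eq_fun do rewrite !mxE; apply: measurable_funB => //.
  apply: measurable_funM; last exact: measurable_coord.
  apply: (measurableT_comp measurable_invr).
  exact: (measurableT_comp enorm_measurable).
apply: measurable_fun_borelRn => i; under eq_fun do rewrite mxE.
apply: measurable_sum => j; apply: measurable_funM.
  have [jn|jn] := leqP n.-1 j.
    rewrite (_ : (fun t => _) = cst 0)//; apply/funext => w.
    by rewrite mxE nth_default ?size_tuple.
  rewrite (_ : (fun t => _) = (fun w => tnth (t w) (Ordinal jn))).
    exact: (measurableT_comp (measurable_tnth _) mt).
  by apply/funext => w; rewrite mxE (tnth_nth 0).
have reflE nu' : reflection nu' j i = (j == i)%:R -
    2 / dot (axis_gap nu') (axis_gap nu') * (axis_gap nu' 0 j * axis_gap nu' 0 i).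
  by rewrite /reflection; move: (axis_gap nu') => v; rewrite !mxE big_ord1 mxE.
under eq_fun do rewrite reflE.
apply: measurable_funB => //; apply: measurable_funM; last exact: measurable_funM.
apply: measurable_funM => //; apply: (measurableT_comp measurable_invr).
by apply: measurable_sum => k; exact: measurable_funM.
Qed.

End joint.

(* One turn of the game, driven by a uniform [v] in $[0,1]$, which selects the
   branch, and a uniform point [t] of a ball of $R^{n-1}$. *)
Definition step (x : E) (d a : R) (nu1 nu2 : 'rV[R]_n) (vt : RR * n.-1.-tuple RR) :
    gstate R n :=
  if vt.1 < d then (true, x)
  else if vt.1 < d + (1 - d) / 2 * a then (false, (x + nu1)%R)
  else if vt.1 < d + (1 - d) / 2 then (false, (x + plane_pt nu1 vt.2)%R)
  else if vt.1 < d + (1 - d) / 2 + (1 - d) / 2 * a then (false, (x + nu2)%R)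
  else (false, (x + plane_pt nu2 vt.2)%R).

Lemma measurable_step dT (T : measurableType dT) (x nu1 nu2 : T -> E) (d a : T -> RR) :
  measurable_fun setT x -> measurable_fun setT nu1 -> measurable_fun setT nu2 ->
  measurable_fun setT d -> measurable_fun setT a ->
  measurable_fun setT (fun wv : T * (RR * n.-1.-tuple RR) =>
    step (x wv.1) (d wv.1) (a wv.1) (nu1 wv.1) (nu2 wv.1) wv.2).
Proof.
move=> mx m1 m2 md ma.
have mc d' (T' : measurableType d') (g : T -> T') : measurable_fun setT g ->
    measurable_fun setT (fun wv : T * (RR * n.-1.-tuple RR) => g wv.1).
  by move=> mg; exact: (measurableT_comp mg measurable_fst).
have mv : measurable_fun setT (fun wv : T * (RR * n.-1.-tuple RR) => wv.2.1).
  exact: (measurableT_comp measurable_fst measurable_snd).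
have mt : measurable_fun setT (fun wv : T * (RR * n.-1.-tuple RR) => wv.2.2).
  exact: (measurableT_comp measurable_snd measurable_snd).
have mh : measurable_fun setT (fun w => (1 - d w) / 2).
  by apply: measurable_funM => //; exact: measurable_funB.
have mb (b : bool) (y : T * (RR * n.-1.-tuple RR) -> E) : measurable_fun setT y ->
    measurable_fun setT (fun wv => (b, y wv) : gstate R n).
  by move=> my; apply: measurable_fun_pair => //; exact: measurable_cst.
rewrite /step; repeat (apply: measurable_fun_ifT).
- by apply: measurable_fun_ltr => //; exact: mc.
- by apply: mb; exact: mc.
- apply: measurable_fun_ltr => //.
  apply: (mc _ _ (fun w => d w + (1 - d w) / 2 * a w)).
  by apply: measurable_funD => //; exact: measurable_funM.
- by apply: mb; apply: measurable_addRn; exact: mc.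
- apply: measurable_fun_ltr => //.
  by apply: (mc _ _ (fun w => d w + (1 - d w) / 2)); exact: measurable_funD.
- by apply: mb; apply: measurable_addRn; [exact: mc|apply: measurable_plane_pt2 => //; exact: mc].
- apply: measurable_fun_ltr => //.
  apply: (mc _ _ (fun w => d w + (1 - d w) / 2 + (1 - d w) / 2 * a w)).
  by apply: measurable_funD; [exact: measurable_funD|exact: measurable_funM].
- by apply: mb; apply: measurable_addRn; exact: mc.
- by apply: mb; apply: measurable_addRn; [exact: mc|apply: measurable_plane_pt2 => //; exact: mc].
Qed.

Section noise.
Context (eps : R) (eps0 : 0 < eps).

Definition unif01 : probability RR R := uniform_prob (@ltr01 R).

Definition noise : probability (RR * n.-1.-tuple RR)%type R :=
  (unif01 \x unif_ball n.-1 eps)%E.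

Lemma bmeas_lt (l : R) : bmeas (fun v : RR => (v < l)%R%:R : R).
Proof.
rewrite (_ : (fun v => _) = \1_(`]-oo, l[)); first exact: bmeas_indic.
by apply/funext => v; rewrite indicE; congr ((nat_of_bool _)%:R); apply/idP/idP => /=; rewrite inE/= in_itv.
Qed.

Lemma mean_lt (l : R) : 0 <= l <= 1 -> \int[unif01]_v (v < l)%R%:R = l.
Proof.
move=> /andP[l0 l1].
rewrite /Rintegral integral_uniform//; last first.
  by apply/measurable_EFinP; exact: (bmeas_lt l).1.
rewrite subr0 invr1 mul1e.
transitivity (fine (\int[@lebesgue_measure R]_(x in `[0%R, 1%R]) (\1_(`]-oo, l[) x)%:E)%E).
  congr fine; apply: eq_integral => v _; rewrite indicE; congr ((nat_of_bool _)%:R%:E).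
  by apply/idP/idP => /=; rewrite inE/= in_itv.
rewrite integral_indic// (_ : _ `&` _ = `[0, l[%classic); last first.
  by apply/seteqP; split => v /=; rewrite !in_itv/= => ?; lra.
apply: etrans (congr1 fine (lebesgue_measure_itv `[0, l[)) _.
rewrite /= lte_fin; case: ltP => /=; first by rewrite subr0.
by move=> ?; apply/eqP; rewrite eq_le l0.
Qed.

Lemma mean_noise_lt (l : R) (g : n.-1.-tuple RR -> R) : 0 <= l <= 1 -> bmeas g ->
  bmeas (fun vt : RR * n.-1.-tuple RR => (vt.1 < l)%R%:R * g vt.2) /\
  \int[noise]_vt ((vt.1 < l)%R%:R * g vt.2) = l * \int[unif_ball n.-1 eps]_t g t.
Proof.
move=> l01 bg.
have bf : bmeas (fun vt : RR * n.-1.-tuple RR => (vt.1 < l)%R%:R * g vt.2).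
  apply: bmeasM; first exact: (bmeas_comp measurable_fst (bmeas_lt l)).
  exact: (bmeas_comp measurable_snd bg).
split => //; rewrite mean_prod//=.
rewrite -{2}(mean_lt l01) mulrC -meanZ; last exact: bmeas_lt.
by apply: eq_Rintegral => v _; rewrite meanZ// mulrC.
Qed.

Lemma bmeas_plane (f : E -> R) (nu x : 'rV[R]_n) : bmeas f ->
  bmeas (fun t : n.-1.-tuple RR => f (x + plane_pt nu t)).
Proof.
move=> bf; apply: (bmeas_comp _ bf); apply: measurable_addRn => //.
exact: measurable_plane_pt.
Qed.

Lemma bmeas_state (f : gstate R n -> R) b : bmeas f -> bmeas (fun x : E => f (b, x)).
Proof.
move=> bf; apply: (bmeas_comp _ bf); apply: measurable_fun_pair => //.
Qed.

Lemma meanD5 dT (T : measurableType dT) (P : probability T R) (h0 h1 h2 h3 h4 : T -> R) :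
  bmeas h0 -> bmeas h1 -> bmeas h2 -> bmeas h3 -> bmeas h4 ->
  \int[P]_x (h0 x + (h1 x + (h2 x + (h3 x + h4 x)))) =
  \int[P]_x h0 x + (\int[P]_x h1 x + (\int[P]_x h2 x + (\int[P]_x h3 x + \int[P]_x h4 x))).
Proof.
move=> b0 b1 b2 b3 b4; have b34 := bmeasD b3 b4; have b24 := bmeasD b2 b34.
by rewrite (meanD _ b0 (bmeasD b1 b24)) (meanD _ b1 b24) (meanD _ b2 b34) (meanD _ b3 b4).
Qed.

(** Summation by parts: each threshold appears in a single indicator, whose mean under the uniform
    law is the threshold itself. *)
Lemma threshold_sum (v d l1 l2 l3 y0 y1 y2 y3 y4 : R) :
  d <= l1 -> l1 <= l2 -> l2 <= l3 ->
  (if v < d then y0 else if v < l1 then y1 else if v < l2 then y2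
   else if v < l3 then y3 else y4) =
  (v < d)%R%:R * (y0 - y1) + ((v < l1)%R%:R * (y1 - y2) +
    ((v < l2)%R%:R * (y2 - y3) + ((v < l3)%R%:R * (y3 - y4) + y4))).
Proof.
move=> dl1 l12 l23.
case: (ltP v d) => [vd|_].
  by rewrite (lt_le_trans vd dl1) !(lt_le_trans vd) ?(le_trans dl1) ?(le_trans l12)//=; ring.
case: (ltP v l1) => [vl1|_].
  by rewrite (lt_le_trans vl1 l12) (lt_le_trans vl1) ?(le_trans l12)//=; ring.
case: (ltP v l2) => [vl2|_]; first by rewrite (lt_le_trans vl2 l23)/=; ring.
by case: (ltP v l3) => _ /=; ring.
Qed.

(** Undoes the summation by parts: consecutive thresholds differ by the probabilities of the
    branches of [step]. *)
Lemma threshold_mean (d a y0 y1 y2 y3 y4 : R) :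
  let l1 := d + (1 - d) / 2 * a in let l2 := d + (1 - d) / 2 in
  let l3 := l2 + (1 - d) / 2 * a in
  d * (y0 - y1) + (l1 * (y1 - y2) + (l2 * (y2 - y3) + (l3 * (y3 - y4) + y4))) =
  d * y0 + (1 - d) / 2 * ((a * y1 + (1 - a) * y2) + (a * y3 + (1 - a) * y4)).
Proof. by move=> /=; field. Qed.

Lemma mean_noise_thresholds (l0 l1 l2 l3 : R) (g0 g1 g2 g3 g4 : n.-1.-tuple RR -> R) :
  0 <= l0 <= 1 -> 0 <= l1 <= 1 -> 0 <= l2 <= 1 -> 0 <= l3 <= 1 ->
  bmeas g0 -> bmeas g1 -> bmeas g2 -> bmeas g3 -> bmeas g4 ->
  let m g := \int[unif_ball n.-1 eps]_t g t in
  \int[noise]_vt ((vt.1 < l0)%R%:R * (g0 vt.2 - g1 vt.2) +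
    ((vt.1 < l1)%R%:R * (g1 vt.2 - g2 vt.2) +
     ((vt.1 < l2)%R%:R * (g2 vt.2 - g3 vt.2) +
      ((vt.1 < l3)%R%:R * (g3 vt.2 - g4 vt.2) + g4 vt.2)))) =
  l0 * (m g0 - m g1) + (l1 * (m g1 - m g2) + (l2 * (m g2 - m g3) +
    (l3 * (m g3 - m g4) + m g4))).
Proof.
move=> l00 l10 l20 l30 b0 b1 b2 b3 b4 m.
have [B0 M0] := mean_noise_lt l00 (bmeasB b0 b1).
have [B1 M1] := mean_noise_lt l10 (bmeasB b1 b2).
have [B2 M2] := mean_noise_lt l20 (bmeasB b2 b3).
have [B3 M3] := mean_noise_lt l30 (bmeasB b3 b4).
have B4 : bmeas (fun vt : RR * n.-1.-tuple RR => g4 vt.2).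
  exact: (bmeas_comp measurable_snd b4).
have M4 : \int[noise]_vt g4 vt.2 = m g4 by rewrite mean_prod//= mean_cst.
rewrite (meanD5 _ B0 B1 B2 B3 B4) M0 M1 M2 M3 M4.
by rewrite (meanB _ b0 b1) (meanB _ b1 b2) (meanB _ b2 b3) (meanB _ b3 b4).
Qed.

Lemma mean_step (f : gstate R n -> R) (x : E) (d a : R) (nu1 nu2 : 'rV[R]_n) : bmeas f ->
  0 <= d <= 1 -> 0 <= a <= 1 ->
  \int[noise]_vt f (step x d a nu1 nu2 vt) =
  d * f (true, x) + (1 - d) / 2 *
    ((a * f (false, x + nu1) +
      (1 - a) * \int[unif_ball n.-1 eps]_t f (false, x + plane_pt nu1 t)) +
     (a * f (false, x + nu2) +
      (1 - a) * \int[unif_ball n.-1 eps]_t f (false, x + plane_pt nu2 t))).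
Proof.
move=> bf d01 a01; pose l1 := d + (1 - d) / 2 * a; pose l2 := d + (1 - d) / 2.
pose l3 := l2 + (1 - d) / 2 * a.
have [l10 l20 l30] : [/\ 0 <= l1 <= 1, 0 <= l2 <= 1 & 0 <= l3 <= 1].
  by rewrite /l3 /l1 /l2; split; nra.
have [dl1 l12 l23] : [/\ d <= l1, l1 <= l2 & l2 <= l3].
  by rewrite /l3 /l1 /l2; split; nra.
pose Y := unif_ball n.-1 eps.
pose g0 : n.-1.-tuple RR -> R := cst (f (true, x)).
pose g1 : n.-1.-tuple RR -> R := cst (f (false, x + nu1)).
pose g2 t := f (false, x + plane_pt nu1 t).
pose g3 : n.-1.-tuple RR -> R := cst (f (false, x + nu2)).
pose g4 t := f (false, x + plane_pt nu2 t).
have [b0 b1 b3] : [/\ bmeas g0, bmeas g1 & bmeas g3] by split; exact: bmeas_cst.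
have b2 : bmeas g2 by exact: (bmeas_plane _ _ (bmeas_state false bf)).
have b4 : bmeas g4 by exact: (bmeas_plane _ _ (bmeas_state false bf)).
have mean4 := mean_noise_thresholds d01 l10 l20 l30 b0 b1 b2 b3 b4.
rewrite -[RHS]threshold_mean -/l2 -/l1 -/l3.
rewrite -(mean_cst Y (f (true, x))) -(mean_cst Y (f (false, x + nu1))).
rewrite -(mean_cst Y (f (false, x + nu2))); apply: etrans mean4.
apply: eq_Rintegral => -[v t] _; rewrite /step/= -/l1 -/l2 -/l3.
by rewrite -threshold_sum// !(fun_if f).
Qed.

End noise.
End move.

(** * The strips around the boundary *)

Section domain.
Context {R : realType} {n : nat}.
Variables (eps : R) (Omega : set 'rV[R]_n).
Hypotheses (eps0 : 0 < eps) (n0 : (0 < n)%N) (Omega_neq0 : Omega !=set0)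
  (Omega_open : open Omega) (Omega_bounded : bounded_set Omega).
Implicit Types x y z : 'rV[R]_n.

Lemma dist_lbound (A : set 'rV[R]_n) x y : A y -> dist x A <= enorm (x - y).
Proof.
move=> Ay; apply: ge_inf; last by exists y.
by exists 0 => _ [z _ <-]; exact: enorm_ge0.
Qed.

Lemma dist_ge0 (A : set 'rV[R]_n) x : 0 <= dist x A.
Proof.
have [->|/set0P[y Ay]] := eqVneq A set0; first by rewrite /dist image_set0 inf0.
apply: lb_le_inf; first by exists (enorm (x - y)); exists y.
by move=> _ [z _ <-]; exact: enorm_ge0.
Qed.

Lemma dist_lt_ex (A : set 'rV[R]_n) x (r : R) : A !=set0 -> dist x A < r ->
  exists2 y, A y & enorm (x - y) < r.
Proof.
move=> [y0 Ay0] xr.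
have hi : has_inf [set enorm (x - y) | y in A].
  split; first by exists (enorm (x - y0)); exists y0.
  by exists 0 => _ [z _ <-]; exact: enorm_ge0.
have d0 : 0 < r - dist x A by rewrite subr_gt0.
have [_ [y Ay <-] h] := inf_adherent d0 hi; exists y => //.
by move: h; rewrite -/(dist x A) addrCA subrr addr0.
Qed.

Lemma dist_lipschitz (A : set 'rV[R]_n) x y : A !=set0 ->
  `|dist x A - dist y A| <= enorm (x - y).
Proof.
move=> A0; wlog xy : x y / dist y A <= dist x A => [H|].
  case: (leP (dist y A) (dist x A)) => [|/ltW] xy; first exact: H.
  by rewrite -normrN opprB enormB; exact: H.
rewrite ger0_norm ?subr_ge0// lerBlDr; apply/ler_addgt0Pr => e e0.
have [z Az yz] : exists2 z, A z & enorm (y - z) < dist y A + e.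
  by apply: dist_lt_ex => //; rewrite ltrDl.
rewrite (le_trans (dist_lbound x Az))// (le_trans (enorm_dist _ y _))//.
by rewrite -addrA lerD2l ltW.
Qed.

Lemma boundaryE x : boundary Omega x <-> closure Omega x /\ ~ Omega x.
Proof.
by rewrite /boundary; have /interior_id -> := Omega_open.
Qed.

(** The point is where the segment first leaves [Omega]. As [Omega] is open, this point is outside
    [Omega] and its parameter is positive. *)
Lemma seg_boundary x y : Omega x -> ~ Omega y ->
  exists2 t : R, 0 < t <= 1 & boundary Omega (x + t *: (y - x)).
Proof.
move=> Ox Oy; pose A := [set t : R | 0 <= t /\ ~ Omega (x + t *: (y - x))].
have A1 : A 1 by split => //; rewrite scale1r addrC subrK.
have hi : has_inf A by split; [exists 1|exists 0 => t []].
have t1 : inf A <= 1 by apply: ge_inf => //; exact: hi.2.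
have tge0 : 0 <= inf A by apply: lb_le_inf; [exact: hi.1|move=> t []].
set z := x + inf A *: (y - x).
have zE t : x + t *: (y - x) - z = (t - inf A) *: (y - x).
  by rewrite /z opprD addrACA subrr add0r -scalerBl.
pose N := enorm (y - x) + 1.
have N0 : 0 < N by rewrite ltr_pwDr// enorm_ge0.
have near_z t (d : R) : `|t - inf A| < d / N -> enorm (x + t *: (y - x) - z) < d.
  move=> td; rewrite zE enormZ.
  have d0 : 0 < d by rewrite -(pmulr_lgt0 _ (_ : 0 < N^-1)) ?invr_gt0// (le_lt_trans _ td).
  apply: (@le_lt_trans _ _ (`|t - inf A| * N)); first by rewrite ler_wpM2l// lerDl.
  by rewrite -ltr_pdivlMr.
have nOz : ~ Omega z.
  move=> Oz; have /enorm_nbhsP[d d0 dO] : nbhs z Omega by apply: open_nbhs_nbhs.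
  have [t At th] : exists2 t, A t & t < inf A + d / N.
    by have [] := @inf_adherent _ _ (d / N) _ hi; rewrite ?divr_gt0//; move=> t; exists t.
  apply: At.2; apply: dO; apply: near_z.
  by rewrite ger0_norm ?subr_ge0 ?ltrBlDl//; apply: ge_inf => //; exact: hi.2.
have tgt0 : 0 < inf A.
  rewrite lt_neqAle tge0 andbT; apply/eqP => t0; apply: nOz.
  by rewrite /z -t0 scale0r addr0.
exists (inf A); first by rewrite tgt0.
apply/boundaryE; split => //; apply/enorm_closure => e e0.
pose t := Num.max 0 (inf A - e / N / 2).
have tA : t < inf A by rewrite gt_max tgt0 ltrBlDr ltrDl !divr_gt0.
exists (x + t *: (y - x)).
  apply: contrapT => tO; have : inf A <= t.
    by apply: ge_inf; [exact: hi.2|split => //; rewrite le_max lexx].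
  by rewrite leNgt tA.
apply: near_z; rewrite ltr0_norm ?subr_lt0// opprB.
have : inf A - e / N / 2 <= t by rewrite le_max lexx orbT.
have : 0 < e / N by rewrite divr_gt0.
by lra.
Qed.

Lemma boundary_neq0 : boundary Omega !=set0.
Proof.
have [x Ox] := Omega_neq0; have [M M0 OM] := enorm_bounded Omega_bounded.
pose y : 'rV[R]_n := \row_i (M + 1).
have Oy : ~ Omega y.
  move=> /OM; apply/negP; rewrite -ltNge.
  have := coord_le_enorm y (Ordinal n0); rewrite mxE ger0_norm; last first.
    by rewrite addr_ge0// ltW.
  by move=> h; apply: lt_le_trans h; rewrite ltrDl.
by have [t _ b] := seg_boundary Ox Oy; exists (x + t *: (y - x)).
Qed.

Lemma dist_in x y : Omega x -> ~ Omega y -> dist x (boundary Omega) <= enorm (y - x).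
Proof.
move=> Ox Oy; have [t /andP[t0 t1] b] := seg_boundary Ox Oy.
rewrite (le_trans (dist_lbound _ b))// opprD addrA subrr add0r enormN enormZ.
by rewrite gtr0_norm// ler_piMl// enorm_ge0.
Qed.

(** Strict because the crossing point differs from [x]. The strictness matters: a move of length
    exactly [eps] must still land in [outer_strip], which is defined by a strict inequality. *)
Lemma dist_out x y : Omega x -> ~ Omega y -> dist y (boundary Omega) < enorm (y - x).
Proof.
move=> Ox Oy; have [t /andP[t0 t1] b] := seg_boundary Ox Oy.
have xy : 0 < enorm (y - x).
  rewrite lt_neqAle enorm_ge0 andbT eq_sym enorm_eq0 subr_eq0.
  by apply/eqP => yx; apply: Oy; rewrite yx.
rewrite (le_lt_trans (dist_lbound _ b))// opprD addrA.
rewrite (_ : y - x - _ = (1 - t) *: (y - x)); last by rewrite scalerBl scale1r.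
by rewrite enormZ ger0_norm ?subr_ge0// gtr_pMl// ltrBlDr ltrDl.
Qed.

Lemma Omega_move x y : Omega x -> enorm (y - x) <= eps -> Omega_eps eps Omega y.
Proof.
move=> Ox xy; have [Oy|Oy] := pselect (closure Omega y); [by left|right].
split => //; apply: lt_le_trans xy; apply: dist_out => // ?; apply: Oy.
exact: subset_closure.
Qed.

Lemma Omega_sub : Omega `<=` Omega_eps eps Omega.
Proof. by move=> x Ox; left; exact: subset_closure. Qed.

Lemma Omega_eps_bounded :
  exists2 M : R, 0 < M & forall x, closure (Omega_eps eps Omega) x -> enorm x <= M.
Proof.
have [M M0 OM] := enorm_bounded Omega_bounded.
have cM x : closure Omega x -> enorm x <= M + 1.
  move=> /enorm_closure/(_ 1 ltr01)[y Oy yx].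
  rewrite -(subrK y x) (le_trans (enormD _ _))// addrC enormB lerD ?OM//.
  exact: ltW.
exists (M + 1 + eps + 1) => [|x /enorm_closure/(_ 1 ltr01)[y Oy yx]].
  by rewrite !addr_gt0.
have {}Oy : enorm y <= M + 1 + eps.
  case: Oy => [/cM ?|[_ /(dist_lt_ex boundary_neq0)[z /boundaryE[/cM zM _] yz]]].
    by rewrite (le_trans _ (_ : M + 1 <= _))// lerDl ltW.
  by rewrite -(subrK z y) (le_trans (enormD _ _))// addrC lerD// ltW.
rewrite -(subrK y x) (le_trans (enormD _ _))// addrC enormB lerD//.
exact: ltW.
Qed.

Lemma K_compact : compact (closure (Omega_eps eps Omega)).
Proof.
apply: bounded_closed_compact; last exact: closed_closure.
by have [M _ KM] := Omega_eps_bounded; exact: bounded_enorm KM.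
Qed.

Lemma K_Omega x : Omega x -> closure (Omega_eps eps Omega) x.
Proof. by move=> Ox; apply: subset_closure; exact: Omega_sub. Qed.

Lemma K_move x y : Omega x -> enorm (y - x) <= eps -> closure (Omega_eps eps Omega) y.
Proof. by move=> Ox xy; apply: subset_closure; exact: Omega_move xy. Qed.

(** A point of the closure of [Omega] outside [Omega] is a limit of points of [Omega] that are as
    close to the boundary as desired. Any other point has a neighbourhood missing the closure, so
    points of [Omega_eps] near it belong to the outer strip. *)
Lemma K_Gamma x : closure (Omega_eps eps Omega) x -> ~ Omega x -> Gamma eps Omega x.
Proof.
move=> Kx Ox; have [cx|cx] := pselect (closure Omega x); [left|right].
  apply/enorm_closure => e e0.
  have me : 0 < Num.min e eps by rewrite lt_min e0.
  have [y Oy] := (enorm_closure _ _).1 cx _ me.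
  rewrite lt_min => /andP[ye yeps]; exists y => //; split => //.
  by apply: le_lt_trans (dist_in Oy Ox) _; rewrite enormB.
apply/enorm_closure => e e0.
have /enorm_nbhsP[d d0 dC] : nbhs x (~` closure Omega).
  apply: open_nbhs_nbhs; split => //.
  by apply: closed_openC; exact: closed_closure.
have me : 0 < Num.min e d by rewrite lt_min e0.
have [y Oy] := (enorm_closure _ _).1 Kx _ me.
rewrite lt_min => /andP[ye yd]; exists y => //.
by case: Oy => // /(dC _ yd).
Qed.

Lemma Gamma_K : Gamma eps Omega `<=` closure (Omega_eps eps Omega).
Proof.
move=> x [|]; apply: closure_subset => y; first by move=> [Oy _]; exact: Omega_sub.
by right.
Qed.

Lemma Gamma_closed : closed (Gamma eps Omega).
Proof. by apply: closedU; exact: closed_closure. Qed.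

Lemma Gamma_compact : compact (Gamma eps Omega).
Proof. by apply: subclosed_compact K_compact Gamma_K; exact: Gamma_closed. Qed.

Lemma inner_Gamma x : Omega x -> dist x (boundary Omega) < eps -> Gamma eps Omega x.
Proof. by move=> Ox xe; left; exact: subset_closure. Qed.

Lemma delta_out x : ~ Omega x -> delta eps Omega x = 1.
Proof.
move=> Ox; rewrite /delta; case: ifPn => [/set_mem[]//|_].
by case: ifPn => // /set_mem[].
Qed.

Lemma delta_in x : Omega x ->
  delta eps Omega x = Num.max 0 (1 - eps^-1 * dist x (boundary Omega)).
Proof.
move=> Ox; rewrite /delta.
have [xe|xe] := ltP (dist x (boundary Omega)) eps.
  rewrite memNset; last by case=> _; apply.
  rewrite mem_set// max_r// subr_ge0 mulrC ler_pdivrMr// mul1r ltW//.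
rewrite mem_set; last by split => // -[_]; rewrite ltNge xe.
by rewrite max_l// subr_le0 mulrC ler_pdivlMr// mul1r.
Qed.

Lemma delta_ge0_le1 x : 0 <= delta eps Omega x <= 1.
Proof.
have [Ox|Ox] := pselect (Omega x); last by rewrite delta_out// ler01 lexx.
rewrite delta_in// le_max lexx/= ge_max ler01/= lerBlDr lerDl.
by rewrite mulr_ge0 ?invr_ge0 ?(ltW eps0)// dist_ge0.
Qed.

(** [F] is under control only on [Gamma]. Either [x] belongs to it or the factor [delta x] removes
    [F x]. *)
Lemma delta_inner_strip x : Omega x -> dist x (boundary Omega) < eps \/ delta eps Omega x = 0.
Proof.
move=> Ox; have [|xe] := ltP (dist x (boundary Omega)) eps; [by left|right].
by rewrite delta_in// max_l// subr_le0 mulrC ler_pdivlMr// mul1r.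
Qed.

Lemma delta_lipschitz x y : Omega x -> Omega y ->
  `|delta eps Omega x - delta eps Omega y| <= eps^-1 * enorm (x - y).
Proof.
move=> Ox Oy; rewrite !delta_in//.
have h : eps^-1 * `|dist x (boundary Omega) - dist y (boundary Omega)| <=
    eps^-1 * enorm (x - y).
  by rewrite ler_pM2l ?invr_gt0// dist_lipschitz//; exact: boundary_neq0.
apply: le_trans h; set a := dist x _; set b := dist y _.
rewrite -[eps^-1 in leRHS]gtr0_norm ?invr_gt0// -normrM mulrBr.
move: (eps^-1 * a) (eps^-1 * b) => {}a {}b; rewrite ler_norml.
have /andP[h1 h2] : - `|a - b| <= a - b <= `|a - b| by rewrite -ler_norml.
have h0 := normr_ge0 (a - b); rewrite /Num.max.
by case: ifPn; case: ifPn; rewrite -?leNgt => ? ?; apply/andP; split; lra.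
Qed.

End domain.

(** * Exponential growth under the orthogonal noise *)

Section averages.
Context {R : realType} {n : nat}.
Variables (eps : R) (Omega : set 'rV[R]_n) (p : 'rV[R]_n -> R) (P : R).
Hypotheses (eps0 : 0 < eps) (n2 : (2 <= n)%N) (Omega_neq0 : Omega !=set0)
  (Omega_open : open Omega) (Omega_bounded : bounded_set Omega).
Hypotheses (p_gt1 : forall x, Omega x -> 1 < p x) (p_le : forall x, Omega x -> p x <= P).
Local Notation RR := (measurableTypeR R).
Local Notation K := (closure (Omega_eps eps Omega)).
Local Notation Y := (unif_ball n.-1 eps).
Implicit Types x y z nu : 'rV[R]_n.

Let n_gt0 : (0 < n)%N. Proof. exact: ltn_trans n2. Qed.

Let cK : compact K. Proof. exact: K_compact. Qed.

Lemma mean_ball k (f : k.-tuple RR -> R) : bmeas f ->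
  \int[unif_ball k eps]_t f t =
  (fine (lebesgue k (@eball R k eps)))^-1 * \int[lebesgue k]_(t in @eball R k eps) f t.
Proof.
move=> bf; apply: (conditional_mean (phi := id)) => //.
- exact: eball_measurable.
- exact: eball_lty.
- by rewrite invr_ge0 fine_ge0.
- by move=> A mA; exact: unif_ballE.
Qed.

(** The comparison is asked only on the ball, which carries all the mass: only there is the
    displaced token known to stay in [K]. *)
Lemma le_mean_ball k (f g : k.-tuple RR -> R) : bmeas f -> bmeas g ->
  (forall t, @eball R k eps t -> f t <= g t) ->
  \int[unif_ball k eps]_t f t <= \int[unif_ball k eps]_t g t.
Proof.
move=> bf bg fg; rewrite !mean_ball// ler_wpM2l ?invr_ge0 ?fine_ge0//.
have mB := @eball_measurable R k eps; have By := @eball_lty R k eps eps0.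
by apply: le_Rintegral => //; exact: bmeas_integrable_on.
Qed.

Lemma nu_neq0 nu : enorm nu = eps -> nu != 0.
Proof. by move=> nue; rewrite -enorm_eq0 nue gt_eqF. Qed.

Lemma plane_pt_lt nu t : enorm nu = eps -> @eball R n.-1 eps t -> enorm (plane_pt nu t) < eps.
Proof. by move=> /nu_neq0 nu0; rewrite -(plane_pt_disc eps0 nu0) => -[]. Qed.

Lemma K_plane x nu t : Omega x -> enorm nu = eps -> @eball R n.-1 eps t ->
  K (x + plane_pt nu t).
Proof.
move=> Ox nue te; apply: (K_move Omega_open Ox).
by rewrite addrC addKr ltW// plane_pt_lt.
Qed.

Lemma K_nu x nu : Omega x -> enorm nu = eps -> K (x + nu).
Proof.
move=> Ox nue; apply: (K_move Omega_open Ox).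
by rewrite addrC addKr nue.
Qed.

Lemma alpha01 x : Omega x -> 0 <= alpha p x <= 1.
Proof.
move=> Ox; have p1 := p_gt1 Ox; have pn : 0 < p x + n%:R.
  by rewrite addr_gt0// ?ltr0n ?(ltn_trans _ n2)// (lt_trans ltr01).
rewrite /alpha divr_ge0 ?ltW ?subr_ge0//= ?subr_gt0//.
rewrite ltr_pdivrMr// mul1r ltrD2l.
by rewrite (lt_le_trans (_ : -1 < 0)) ?ltrN10.
Qed.

(** The upper bound on [p] keeps the probability of a noisy move away from 0, uniformly in the
    position. *)
Lemma beta_ge x : Omega x -> n.+1%:R / (P + n%:R) <= beta p x /\ 0 < n.+1%:R / (P + n%:R).
Proof.
move=> Ox; have p1 := p_gt1 Ox; have pn : 0 < p x + n%:R.
  by rewrite addr_gt0// ?ltr0n ?(ltn_trans _ n2)// (lt_trans ltr01).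
have Pn : 0 < P + n%:R by rewrite (lt_le_trans pn)// lerD2r p_le.
split; last by rewrite divr_gt0.
rewrite /beta /alpha (_ : 1 - _ = n.+1%:R / (p x + n%:R)); last first.
  by rewrite -natr1; field; rewrite gt_eqF.
by rewrite ler_pM2l// lef_pV2 ?posrE// lerD2r p_le.
Qed.

(** [W] with the disc average pulled back to the fixed ball. It is linear and monotone on bounded
    measurable functions, whereas [W] is applied to functions that are regular only on [K]; [W_Wb]
    passes between them by zero extension. *)
Definition Wb (u : borelRn R n -> R) x nu : R :=
  alpha p x * u (x + nu) + beta p x * \int[Y]_t u (x + plane_pt nu t).

Lemma bmeas_patch (u : 'rV[R]_n -> R) : {within K, continuous u} ->
  bmeas (u \_ K : borelRn R n -> R).
Proof.
move=> uK; split; first exact: (within_patch_measurable (@closed_closure _ _) uK).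
have [M M0 uM] := compact_within_bounded cK uK.
exists M => x; rewrite patchE; case: ifPn => [/set_mem/uM//|_].
by rewrite normr0 ltW.
Qed.

Lemma W_Wb (u : 'rV[R]_n -> R) x nu : {within K, continuous u} -> Omega x ->
  enorm nu = eps -> W eps p u x nu = Wb (u \_ K) x nu.
Proof.
move=> uK Ox nue.
have bu := bmeas_patch uK.
rewrite /W /Wb patchE mem_set; last exact: K_nu.
congr (_ + _ * _); rewrite -(disc_avgE eps0 (f := fun h => (u \_ K) (x + h))) ?nu_neq0//.
  rewrite /disc_avg; congr (_ * _); apply: eq_Rintegral => h /set_mem[he _].
  rewrite patchE mem_set//; apply: (K_move Omega_open Ox).
  by rewrite addrC addKr ltW.
by apply: (bmeas_comp _ bu); apply: measurable_addRn.
Qed.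

Lemma WbD (u v : borelRn R n -> R) x nu : bmeas u -> bmeas v ->
  Wb (fun y => u y + v y) x nu = Wb u x nu + Wb v x nu.
Proof. by move=> bu bv; rewrite /Wb meanD; [ring|exact: bmeas_plane..]. Qed.

Lemma WbZ (c : R) (u : borelRn R n -> R) x nu : bmeas u ->
  Wb (fun y => c * u y) x nu = c * Wb u x nu.
Proof. by move=> bu; rewrite /Wb meanZ; [ring|exact: bmeas_plane]. Qed.

Lemma WbN (u : borelRn R n -> R) x nu : bmeas u ->
  Wb (fun y => - u y) x nu = - Wb u x nu.
Proof. by move=> bu; rewrite /Wb meanN; [ring|exact: bmeas_plane]. Qed.

Lemma WbB (u v : borelRn R n -> R) x nu : bmeas u -> bmeas v ->
  Wb (fun y => u y - v y) x nu = Wb u x nu - Wb v x nu.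
Proof. by move=> bu bv; rewrite WbD ?WbN//; exact: bmeasN. Qed.

Lemma le_Wb (u v : borelRn R n -> R) x nu : bmeas u -> bmeas v ->
  Omega x -> enorm nu = eps -> (forall y, K y -> u y <= v y) -> Wb u x nu <= Wb v x nu.
Proof.
move=> bu bv Ox nue uv; have /andP[a0 a1] := alpha01 Ox.
rewrite /Wb lerD//; first by rewrite ler_wpM2l// uv//; exact: K_nu.
rewrite ler_wpM2l ?subr_ge0//; apply: le_mean_ball; try exact: bmeas_plane.
by move=> t te; apply: uv; exact: K_plane.
Qed.

Lemma Wb_cst (c : R) x nu : Wb (fun=> c) x nu = c.
Proof. by rewrite /Wb mean_cst /beta; ring. Qed.

Lemma Wb_norm_le (u v : borelRn R n -> R) x nu : bmeas u -> bmeas v ->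
  Omega x -> enorm nu = eps -> (forall y, K y -> `|u y| <= v y) ->
  `|Wb u x nu| <= Wb v x nu.
Proof.
move=> bu bv Ox nue uv; rewrite ler_norml -WbN//; apply/andP; split;
  apply: le_Wb => //; try exact: bmeasN; by move=> y /uv; rewrite ler_norml => /andP[].
Qed.

(** Each noise coordinate has modulus between [c] and [2 * c] and the sign of the matching
    coordinate of [x] in the frame of the hyperplane. The value of [c] is that of [box_eball], so
    the box lies in the ball. *)
Definition sign_box x nu : set (n.-1.-tuple RR) :=
  let c := eps / (2 * n.-1.+1%:R) in
  let s i := 0 <= (x *m reflection nu) 0 (widen_ord (leq_pred n) i) in
  box (fun i => if s i then c else - (2 * c)) (fun i => if s i then 2 * c else - c).

(** Expand the square: the matching signs make the cross term nonnegative, and a single coordinate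
    of the noise already contributes [c ^+ 2]. *)
Lemma sign_box_dot x nu t : sign_box x nu t ->
  dot x x + (eps / (2 * n.-1.+1%:R)) ^+ 2 <= dot (x + plane_pt nu t) (x + plane_pt nu t).
Proof.
rewrite /sign_box; set c := eps / _; set s := fun i => _ => ht.
have c0 : 0 < c by rewrite divr_gt0// mulr_gt0.
have st i : c <= `|tnth t i| /\ 0 <= (x *m reflection nu) 0 (widen_ord (leq_pred n) i) * tnth t i.
  have := ht i; rewrite /s; case: ifPn => [s0|]; last rewrite -ltNge => /ltW s0.
    move=> /andP[h1 h2]; have t0 : 0 <= tnth t i by rewrite (le_trans _ h1)// ltW.
    by rewrite ger0_norm// mulr_ge0.
  move=> /andP[h1 h2]; have t0 : tnth t i <= 0 by rewrite (le_trans h2)// oppr_le0 ltW.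
  by rewrite ler0_norm// mulr_le0// lerNr.
rewrite dotDl !dotDr (dotC _ x) dot_plane_pt.
have xz : 0 <= dot x (plane_pt nu t).
  rewrite dotE /plane_pt trmx_mul trmx_reflection mulmxA -dotE.
  have n1 : (n.-1 < n)%N by rewrite prednK.
  rewrite /dot; apply: sumr_ge0 => j _; rewrite [pad t 0 j]mxE.
  have [jn|jn] := leqP n.-1 j; first by rewrite nth_default ?size_tuple// mulr0.
  have := (st (Ordinal jn)).2; rewrite (tnth_nth 0).
  by rewrite (_ : widen_ord _ _ = j)//; exact/val_inj.
(* Here [n >= 2] enters: the noise has a coordinate. *)
have n1 : (0 < n.-1)%N by rewrite -ltnS prednK.
have zz : c ^+ 2 <= \sum_i tnth t i * tnth t i.
  rewrite (bigD1 (Ordinal n1))//= -[leLHS]addr0 lerD//; last first.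
    by apply: sumr_ge0 => i _; rewrite -expr2 sqr_ge0.
  rewrite -expr2 -[leRHS]real_normK ?num_real// lerXn2r ?nnegrE ?(ltW c0)//.
  exact: (st _).1.
by lra.
Qed.

(** The signs vary with [x] and [nu], but all sides have length [c], so the volume does not. *)
Lemma unif_ball_sign_box : exists2 q : R, 0 < q & forall x nu, Y (sign_box x nu) = q%:E.
Proof.
have e0 := @eball_gt0 R n.-1 eps eps0; have ey := @eball_lty R n.-1 eps eps0.
set c := eps / (2 * n.-1.+1%:R).
have c0 : 0 < c by rewrite divr_gt0// mulr_gt0.
exists ((fine (lebesgue n.-1 (@eball R n.-1 eps)))^-1 * \prod_(i < n.-1) c).
  by rewrite mulr_gt0 ?prodr_gt0// invr_gt0 fine_gt0// e0.
move=> x nu; rewrite unif_ballE//; last exact: box_measurable.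
rewrite EFinM (_ : _ `&` _ = sign_box x nu); last first.
  by apply/setIidPr; exact: box_eball.
rewrite lebesgue_box => [|i]; last by case: ifPn => _; rewrite -/c; lra.
by congr (_ * _%:E)%E; apply: eq_bigr => i _; case: ifPn => _; rewrite -/c; lra.
Qed.

Lemma indic1 T (A : set T) (x : T) : A x -> \1_A x = 1 :> R.
Proof. by move=> Ax; rewrite indicE mem_set. Qed.

Lemma indic0 T (A : set T) (x : T) : ~ A x -> \1_A x = 0 :> R.
Proof. by move=> Ax; rewrite indicE memNset. Qed.

(* For [s] large, [expR (s * |x|^2)] grows by at least 1 in mean over one turn,
   whatever the players do: with probability bounded below the orthogonal noise
   increases [|x|^2] by a fixed amount. *)
Lemma lyapunov : exists g : borelRn R n -> R, exists A : R,
  [/\ bmeas g, 1 < A, forall x, K x -> 1 <= g x <= A &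
      forall x nu, Omega x -> enorm nu = eps -> Wb g x nu <= g x - 1].
Proof.
have [q q0 Yq] := unif_ball_sign_box.
have [M M0 KM] := Omega_eps_bounded eps0 n_gt0 Omega_neq0 Omega_open Omega_bounded.
set c := eps / (2 * n.-1.+1%:R) in Yq.
have c0 : 0 < c by rewrite divr_gt0// mulr_gt0.
have [x0 Ox0] := Omega_neq0; have [_ b0] := beta_ge Ox0.
set b := n.+1%:R / _ in b0.
(* Makes [b * q * (s * c ^+ 2)] equal to 2. Since [expR t >= t], the noise branch alone then brings
   the mean of [G] to at least [2 * G x], hence to at least [G x + 1]. *)
pose s : R := 2 / (b * q * c ^+ 2).
have c20 : 0 < c ^+ 2 by exact: exprn_gt0.
have bqc0 : 0 < b * q * c ^+ 2 by apply: mulr_gt0 => //; exact: mulr_gt0.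
have s0 : 0 < s by exact: divr_gt0.
pose G (x : borelRn R n) : R := expR (s * dot x x).
have G1 x : 1 <= G x by rewrite -expR0 ler_expR mulr_ge0 ?dot_ge0// ltW.
pose A : R := 1 + expR (s * M ^+ 2).
have GA x : K x -> G x <= A - 1.
  move=> Kx; rewrite /A addrC addKr ler_expR ler_pM2l// -enorm_sqr.
  by rewrite lerXn2r ?nnegrE ?enorm_ge0 ?(ltW M0)// KM.
have mK : measurable (K : set (borelRn R n)) by apply: closed_measurable_Rn; exact: closed_closure.
pose G' (x : borelRn R n) : R := G x * \1_K x.
have G'0 x : 0 <= G' x by rewrite mulr_ge0// ?expR_ge0// indicE.
have bG' : bmeas G'.
  split.
    apply: measurable_funM; last exact: measurable_indic.
    apply: (measurableT_comp (@measurable_expR R)).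
    apply: measurable_funM => //; apply: measurable_sum => i.
    by apply: measurable_funM; exact: coord_measurable.
  exists A => x; rewrite ger0_norm// /G'; have [Kx|Kx] := pselect (K x).
    by rewrite indic1// mulr1 (le_trans (GA _ Kx))// lerBlDr lerDl.
  by rewrite indic0// mulr0 addr_ge0// expR_ge0.
have WG' x nu : Omega x -> enorm nu = eps -> G x + 1 <= Wb G' x nu.
  move=> Ox nue; have /andP[a0 a1] := alpha01 Ox; have [bx _] := beta_ge Ox.
  have h : expR (s * (dot x x + c ^+ 2)) * q <= \int[Y]_t G' (x + plane_pt nu t).
    have mB : measurable (sign_box x nu) by exact: box_measurable.
    have -> : q = \int[Y]_t \1_(sign_box x nu) t.
      by apply: EFin_inj; rewrite mean_indic.
    rewrite -meanZ; last exact: bmeas_indic.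
    apply: le_mean_ball; [exact: bmeasZ (bmeas_indic mB)|exact: bmeas_plane|].
    move=> t te; have [tB|tB] := pselect (sign_box x nu t); last by rewrite indic0// mulr0.
    rewrite indic1// mulr1 /G' indic1; last exact: K_plane.
    by rewrite mulr1 ler_expR ler_pM2l//; exact: sign_box_dot.
  have e1 : G x * (s * c ^+ 2) <= expR (s * (dot x x + c ^+ 2)).
    rewrite mulrDr expRD -/(G x) ler_wpM2l ?expR_ge0//.
    by rewrite (le_trans _ (expR_ge1Dx _))// lerDr.
  have bq : b * (G x * (s * c ^+ 2) * q) = 2 * G x.
    by rewrite /s; field; rewrite !gt_eqF.
  apply: (@le_trans _ _ (2 * G x)).
    by rewrite mulr2n mulrDl !mul1r lerD2l.
  rewrite -bq /Wb -[leLHS]add0r lerD//; first by rewrite mulr_ge0.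
  rewrite ler_pM ?(ltW b0)// ?(le_trans _ h)//.
    apply: mulr_ge0; last exact: ltW.
    by apply: mulr_ge0; [exact: expR_ge0|apply: mulr_ge0; exact: ltW].
  by rewrite ler_wpM2r// ltW.
(* [A] exceeds the bound of [G] on [K] by 1, which gives the lower bound 1 for the difference
   there. *)
exists (fun x => A * \1_K x - G' x), A.
have bg : bmeas (fun x : borelRn R n => A * \1_K x - G' x).
  by apply: bmeasB => //; apply: bmeasZ; exact: bmeas_indic.
split => //.
- by rewrite /A ltrDl expR_gt0.
- move=> x Kx; rewrite /G' indic1// !mulr1; have := GA x Kx; have := G1 x.
  by move=> ? ?; apply/andP; split; lra.
move=> x nu Ox nue; apply: (@le_trans _ _ (Wb (fun y => A - G' y) x nu)).
  apply: le_Wb => //; first by apply: bmeasB => //; exact: bmeas_cst.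
  by move=> y Ky; rewrite indic1// mulr1.
rewrite WbB//; last exact: bmeas_cst.
rewrite Wb_cst /G' indic1 ?mulr1; last exact: K_Omega.
by have := WG' x nu Ox nue; lra.
Qed.

End averages.

(** * Stability of suprema and infima under uniform perturbation *)

Section sup_inf_dist.
Context {R : realType} {V : Type}.
Implicit Types (D : set V) (f h : V -> R).

(** The bound [M] guarantees a genuine supremum: [sup] has a default value on sets without one. *)
Lemma le_sup_dist D f h (M C : R) : D !=set0 -> (forall v, D v -> `|h v| <= M) ->
  (forall v, D v -> `|f v - h v| <= C) ->
  sup [set f v | v in D] <= sup [set h v | v in D] + C.
Proof.
move=> [v0 Dv0] hM fhC; apply: sup_le_ub; first by exists (f v0); exists v0.
move=> _ [v Dv <-]; have := fhC v Dv; rewrite ler_norml => /andP[_].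
rewrite lerBlDr addrC => /le_trans; apply; rewrite lerD2r.
apply: sup_upper_bound; last by exists v.
split; first by exists (h v0); exists v0.
by exists M => _ [w /hM + <-]; apply: le_trans; exact: ler_norm.
Qed.

Lemma sup_dist D f h (M C : R) : D !=set0 -> (forall v, D v -> `|f v| <= M) ->
  (forall v, D v -> `|h v| <= M) -> (forall v, D v -> `|f v - h v| <= C) ->
  `|sup [set f v | v in D] - sup [set h v | v in D]| <= C.
Proof.
move=> D0 fM hM fhC; rewrite ler_norml lerBrDr lerBlDr addrC lerBlDr.
apply/andP; split; last by rewrite addrC; exact: le_sup_dist hM fhC.
by apply: le_sup_dist fM _ => // v Dv; rewrite -normrN opprB fhC.
Qed.

Lemma inf_dist D f h (M C : R) : D !=set0 -> (forall v, D v -> `|f v| <= M) ->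
  (forall v, D v -> `|h v| <= M) -> (forall v, D v -> `|f v - h v| <= C) ->
  `|inf [set f v | v in D] - inf [set h v | v in D]| <= C.
Proof.
move=> D0 fM hM fhC; rewrite /inf -opprD normrN !image_comp.
apply: (@sup_dist _ _ _ M) => // v Dv /=; rewrite ?normrN ?fM ?hM//.
by rewrite -opprD normrN; exact: fhC.
Qed.

Lemma sup_norm_le D f (M : R) : D !=set0 -> (forall v, D v -> `|f v| <= M) ->
  `|sup [set f v | v in D]| <= M.
Proof.
move=> D0 fM; have [v0 Dv0] := D0.
have M0 : 0 <= M by apply: le_trans (fM _ Dv0).
have s0 : sup [set (0 : R) | v in D] = 0.
  rewrite (_ : [set _ | _ in _] = [set 0]) ?sup1//.
  by apply/seteqP; split => [_ [v _ <-]//|_ -> /=]; exists v0.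
have := @sup_dist D f (fun=> 0) M M D0 fM; rewrite s0 subr0; apply.
  by move=> v _; rewrite normr0.
by move=> v Dv; rewrite subr0 fM.
Qed.

Lemma inf_norm_le D f (M : R) : D !=set0 -> (forall v, D v -> `|f v| <= M) ->
  `|inf [set f v | v in D]| <= M.
Proof.
move=> D0 fM; rewrite /inf normrN image_comp; apply: sup_norm_le => // v Dv.
by rewrite /= normrN fM.
Qed.

End sup_inf_dist.

(** * Limits with a geometric rate *)

Section geometric.
Context {R : realType}.

Lemma geometric_limit (a : nat -> R) (C q : R) : 0 <= q < 1 ->
  (forall k, `|a k.+1 - a k| <= C * q ^+ k) ->
  exists l, forall k, `|l - a k| <= C / (1 - q) * q ^+ k.
Proof.
move=> /andP[q0 q1] aC; have q10 : 0 < 1 - q by rewrite subr_gt0.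
(* The tail of the geometric series. Its increments match the bounds on those of [a], so the
   intervals of centre [a k] and radius [e k] are nested, and the supremum of their left ends is in
   all of them. *)
pose e k := C / (1 - q) * q ^+ k.
have eS k : e k - e k.+1 = C * q ^+ k by rewrite /e exprS; field; rewrite gt_eqF.
have e0 k : 0 <= e k.
  have C0 : 0 <= C by have := aC 0%N; rewrite expr0 mulr1; exact: le_trans.
  by rewrite mulr_ge0 ?divr_ge0 ?exprn_ge0// ltW.
have lo i j : a i - e i <= a (i + j)%N - e (i + j)%N.
  elim: j => [|j IH]; first by rewrite addn0.
  rewrite addnS (le_trans IH)//; have := aC (i + j)%N; rewrite -eS ler_norml.
  by move=> /andP[? _]; lra.
have up i j : a (i + j)%N + e (i + j)%N <= a i + e i.
  elim: j => [|j IH]; first by rewrite addn0.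
  rewrite addnS; apply: le_trans IH; have := aC (i + j)%N; rewrite -eS ler_norml.
  by move=> /andP[_ ?]; lra.
have lu i j : a i - e i <= a j + e j.
  have := lo i j; have := up j i; rewrite (addnC j i) => h1 h2.
  by have := e0 (i + j)%N; lra.
pose L := [set a i - e i | i in [set: nat]].
have hL : has_sup L.
  split; first by exists (a 0%N - e 0%N); exists 0%N.
  by exists (a 0%N + e 0%N) => _ [i _ <-].
exists (sup L) => k; rewrite -/(e k) ler_norml.
have h1 : a k - e k <= sup L by apply: sup_upper_bound => //; exists k.
have h2 : sup L <= a k + e k by apply: sup_le_ub; [exact: hL.1|move=> _ [i _ <-]].
by apply/andP; split; lra.
Qed.

Lemma geometric_small (q C e : R) : 0 <= q < 1 -> 0 < e -> exists k, C * q ^+ k < e.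
Proof.
move=> /andP[q0 q1] e0.
have /cvgrPdist_lt/(_ (e / (`|C| + 1))) : (fun k => q ^+ k) @ \oo --> (0 : R).
  by apply: cvg_expr; rewrite ger0_norm.
have C1 : 0 < `|C| + 1 by rewrite ltr_pwDr.
rewrite divr_gt0// => /(_ isT)[k _ /(_ k (leqnn k))] /=.
rewrite sub0r normrN ger0_norm ?exprn_ge0// ltr_pdivlMr// => h; exists k.
apply: le_lt_trans h; rewrite mulrC ler_wpM2l ?exprn_ge0//.
by rewrite (le_trans (ler_norm C))// lerDl.
Qed.

End geometric.

(** * The fixed point *)

Section operator.
Context {R : realType} {n : nat}.
Variables (eps : R) (Omega : set 'rV[R]_n) (p F : 'rV[R]_n -> R) (P : R).
Hypotheses (eps0 : 0 < eps) (n2 : (2 <= n)%N) (Omega_neq0 : Omega !=set0)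
  (Omega_open : open Omega) (Omega_bounded : bounded_set Omega).
Hypotheses (p_gt1 : forall x, Omega x -> 1 < p x) (p_le : forall x, Omega x -> p x <= P).
Hypotheses (p_cont : {within closure Omega, continuous p})
  (F_cont : {within Gamma eps Omega, continuous F}).
Local Notation K := (closure (Omega_eps eps Omega)).
Local Notation Y := (unif_ball n.-1 eps).
Local Notation Wb := (Wb eps p).
Local Notation W := (W eps p).
Local Notation T := (T eps Omega p F).
Local Notation delta := (delta eps Omega).
Implicit Types (x y z nu : 'rV[R]_n) (u v : 'rV[R]_n -> R).

Let n_gt0 : (0 < n)%N. Proof. exact: ltn_trans n2. Qed.
Let cK : compact K. Proof. exact: K_compact. Qed.
Let bpatch u := @bmeas_patch R n eps Omega eps0 n2 Omega_neq0 Omega_open Omega_bounded u.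

Lemma sphere_neq0 : (esphere eps : set 'rV[R]_n) !=set0.
Proof.
pose w : 'rV[R]_n := const_mx 1.
have w0 : w != 0.
  apply/eqP => /rowP/(_ (Ordinal n_gt0)); rewrite !mxE => /eqP.
  by rewrite oner_eq0.
exists ((eps / enorm w) *: w); rewrite /esphere/= enormZ ger0_norm.
  by rewrite divfK// enorm_eq0.
by rewrite divr_ge0 ?enorm_ge0// ltW.
Qed.

Lemma F_bounded : exists2 M : R, 0 < M & forall x, Gamma eps Omega x -> `|F x| <= M.
Proof. by apply: compact_within_bounded F_cont; exact: Gamma_compact. Qed.

Lemma T_in u x : Omega x -> T u x = (1 - delta x) / 2 *
  (sup [set W u x nu | nu in esphere eps] + inf [set W u x nu | nu in esphere eps])
  + delta x * F x.
Proof. by move=> Ox; rewrite /T mem_set//; exact: subset_closure. Qed.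

Lemma T_out u x : ~ Omega x -> T u x = F x.
Proof.
move=> Ox; rewrite /T; case: ifPn => // _.
by rewrite delta_out// subrr !mul0r add0r mul1r.
Qed.

Lemma W_bounded u (M : R) x nu : {within K, continuous u} ->
  (forall y, K y -> `|u y| <= M) -> Omega x -> enorm nu = eps -> `|W u x nu| <= M.
Proof.
move=> uK uM Ox nue.
rewrite (W_Wb _ eps0 n2 Omega_neq0 Omega_open Omega_bounded)// -[leRHS](Wb_cst eps p M x nu).
apply: (Wb_norm_le eps0 n2 Omega_open p_gt1) => //; [exact: bpatch|exact: bmeas_cst|].
by move=> y Ky; rewrite patchE mem_set// uM.
Qed.

Section contraction.
Variables (g : borelRn R n -> R) (A : R).
Hypotheses (bg : bmeas g) (A1 : 1 <= A) (gA : forall x, K x -> 1 <= g x <= A).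
Hypothesis Wg : forall x nu, Omega x -> enorm nu = eps -> Wb g x nu <= g x - 1.

Lemma W_contract u v (M : R) x nu : {within K, continuous u} -> {within K, continuous v} ->
  0 <= M -> (forall y, K y -> `|u y - v y| <= M * g y) -> Omega x -> enorm nu = eps ->
  `|W u x nu - W v x nu| <= M * (g x - 1).
Proof.
move=> uK vK M0 uvM Ox nue.
rewrite !(W_Wb _ eps0 n2 Omega_neq0 Omega_open Omega_bounded)//.
rewrite -WbB; [|exact: bpatch..].
apply: (@le_trans _ _ (Wb (fun y => M * g y) x nu)).
  apply: (Wb_norm_le eps0 n2 Omega_open p_gt1) => //.
  - by apply: bmeasB; exact: bpatch.
  - exact: bmeasZ.
  - by move=> y Ky; rewrite !patchE mem_set// uvM.
by rewrite WbZ// ler_wpM2l// Wg.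
Qed.

(** One turn lowers the weight from [g x] to [g x - 1], and [g x - 1 <= (1 - A^-1) * g x] because
    [g x <= A]. Outside [Omega] the operator does not depend on its argument. *)
Lemma T_contract u v (M : R) : {within K, continuous u} -> {within K, continuous v} ->
  0 <= M -> (forall y, K y -> `|u y - v y| <= M * g y) ->
  forall x, K x -> `|T u x - T v x| <= M * (1 - A^-1) * g x.
Proof.
move=> uK vK M0 uvM x Kx; have /andP[g1 gxA] := gA Kx.
have A0 : 0 < A by exact: lt_le_trans A1.
have i1 : 0 <= 1 - A^-1 by rewrite subr_ge0 invf_le1.
have [Ox|Ox] := pselect (Omega x); last first.
  by rewrite !T_out// subrr normr0 mulr_ge0 ?mulr_ge0// (le_trans _ g1).
have [Mu _ uM] := compact_within_bounded cK uK.
have [Mv _ vM] := compact_within_bounded cK vK.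
have Wu nu : esphere eps nu -> `|W u x nu| <= Num.max Mu Mv.
  by move=> nue; rewrite le_max (W_bounded uK uM).
have Wv nu : esphere eps nu -> `|W v x nu| <= Num.max Mu Mv.
  by move=> nue; rewrite le_max (W_bounded vK vM)// orbT.
have Wuv nu : esphere eps nu -> `|W u x nu - W v x nu| <= M * (g x - 1).
  by move=> nue; exact: W_contract.
have hs := sup_dist sphere_neq0 Wu Wv Wuv.
have hi := inf_dist sphere_neq0 Wu Wv Wuv.
apply: (@le_trans _ _ (M * (g x - 1))); last first.
  rewrite -mulrA ler_wpM2l// mulrBl mul1r lerD2l lerN2.
  by rewrite mulrC ler_pdivrMr// mul1r.
rewrite !T_in//; set s := sup _ in hs *; set s' := sup _ in hs *.
set i := inf _ in hi *; set i' := inf _ in hi *.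
have /andP[d0 d1] := delta_ge0_le1 Omega eps0 x.
have C0 : 0 <= M * (g x - 1) by rewrite mulr_ge0// subr_ge0.
move: (delta x) (M * (g x - 1)) d0 d1 C0 hs hi => d C d0 d1 C0.
rewrite !ler_norml => /andP[? ?] /andP[? ?].
have -> : (1 - d) / 2 * (s + i) + d * F x - ((1 - d) / 2 * (s' + i') + d * F x) =
  (1 - d) / 2 * ((s - s') + (i - i')) by ring.
by apply/andP; split; nra.
Qed.

End contraction.

(** [alpha] is 1 minus [(n + 1) / (p + n)]; the difference quotient in [p] is at most 1 because both
    denominators are at least [n + 1]. *)
Lemma alpha_lipschitz x y : Omega x -> Omega y ->
  `|alpha p x - alpha p y| <= `|p x - p y|.
Proof.
move=> Ox Oy; have px := p_gt1 Ox; have py := p_gt1 Oy.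
have n0 : 0 < n%:R :> R by rewrite ltr0n.
have xn : 0 < p x + n%:R by rewrite addr_gt0// (lt_trans ltr01).
have yn : 0 < p y + n%:R by rewrite addr_gt0// (lt_trans ltr01).
have -> : alpha p x - alpha p y = (p x - p y) * ((n%:R + 1) / ((p x + n%:R) * (p y + n%:R))).
  by rewrite /alpha; field; rewrite !gt_eqF.
rewrite normrM ler_piMr// ger0_norm; last first.
  by apply: divr_ge0; [rewrite addr_ge0|rewrite ltW ?mulr_gt0].
by rewrite ler_pdivrMr ?mulr_gt0// mul1r; nra.
Qed.

Lemma within_nearP (B : set 'rV[R]_n) u : {within B, continuous u} <->
  forall x, B x -> forall e : R, 0 < e -> \forall y \near x, B y -> `|u y - u x| < e.
Proof.
rewrite within_contP; split => h x Bx e e0.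
  by have [d d0 dP] := h x Bx e e0; apply/enorm_nbhsP; exists d => // y yx By; exact: dP.
by have /enorm_nbhsP[d d0 dP] := h x Bx e e0; exists d => // y By yx; exact: dP.
Qed.

Lemma closure_Omega_compact : compact (closure Omega).
Proof.
apply: (subclosed_compact (@closed_closure _ _) cK).
by apply: closure_subset; exact: Omega_sub.
Qed.

(** Moving [x] to [y] shifts every evaluation point of [u] by the same vector, whatever [nu] and the
    noise are, so one modulus of uniform continuity serves all directions. *)
Lemma W_equicont u (e : R) : {within K, continuous u} -> 0 < e ->
  exists2 d : R, 0 < d & forall x y, Omega x -> Omega y -> enorm (y - x) < d ->
    forall nu, enorm nu = eps -> `|W u y nu - W u x nu| <= e.
Proof.
move=> uK e0; have [M M0 uM] := compact_within_bounded cK uK.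
have e2 : 0 < e / 2 by rewrite divr_gt0.
(* A change of [alpha] multiplies a difference of two values bounded by [M]; the cost must stay
   within [e / 2]. *)
have e4 : 0 < e / (4 * M) by rewrite divr_gt0// mulr_gt0.
have [d d0 dP] := compact_within_unif cK uK e2.
have [d' d'0 pP] := compact_within_unif closure_Omega_compact p_cont e4.
exists (Num.min d d') => [|x y Ox Oy]; first by rewrite lt_min d0.
rewrite lt_min => /andP[yx yx'] nu nue.
have pxy := pP x y (subset_closure Ox) (subset_closure Oy) yx'.
have bu := bpatch uK.
rewrite !(W_Wb _ eps0 n2 Omega_neq0 Omega_open Omega_bounded)// /Wb.
set a := u \_ K; set ay := \int[_]_t a (y + _); set ax := \int[_]_t a (x + _).
have aK z : K z -> a z = u z by move=> Kz; rewrite /a patchE mem_set.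
have aM z : `|a z| <= M.
  rewrite /a patchE; case: ifPn => [/set_mem/uM//|_]; by rewrite normr0 ltW.
have ayM : `|ay| <= M by apply: mean_norm_le => //; exact: bmeas_plane.
have ua : `|a (y + nu) - a (x + nu)| <= e / 2.
  have Ky := K_nu Omega_open Oy nue; have Kx := K_nu Omega_open Ox nue.
  rewrite !aK//; apply/ltW/dP => //.
  by rewrite opprD addrACA subrr addr0.
have uay : `|ay - ax| <= e / 2.
  rewrite /ay /ax -meanB; [|exact: bmeas_plane..].
  have bd : bmeas (fun t => a (y + plane_pt nu t) - a (x + plane_pt nu t)).
    by apply: bmeasB; exact: bmeas_plane.
  have dt t : @eball R n.-1 eps t ->
      `|a (y + plane_pt nu t) - a (x + plane_pt nu t)| <= e / 2.
    move=> te; have Ky := K_plane eps0 Omega_open Oy nue te.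
    have Kx := K_plane eps0 Omega_open Ox nue te.
    rewrite !aK//; apply/ltW/dP => //.
    by rewrite opprD addrACA subrr addr0.
  rewrite ler_norml; apply/andP; split.
    rewrite -[leLHS](mean_cst Y); apply: (le_mean_ball eps0) => //; first exact: bmeas_cst.
    by move=> t /dt; rewrite ler_norml => /andP[].
  rewrite -[leRHS](mean_cst Y); apply: (le_mean_ball eps0) => //; first exact: bmeas_cst.
  by move=> t /dt; rewrite ler_norml => /andP[].
have /andP[x0 x1] := alpha01 n2 p_gt1 Ox.
have al : `|alpha p y - alpha p x| * (2 * M) <= e / 2.
  have := le_lt_trans (alpha_lipschitz Oy Ox) pxy.
  by rewrite ltr_pdivlMr ?mulr_gt0// => h; lra.
move: al x0 x1; rewrite /beta; move: (alpha p x) (alpha p y) => s s' al x0 x1.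
have -> : s' * a (y + nu) + (1 - s') * ay - (s * a (x + nu) + (1 - s) * ax) =
   (s * (a (y + nu) - a (x + nu)) + (1 - s) * (ay - ax)) + (s' - s) * (a (y + nu) - ay).
  by ring.
apply: le_trans (ler_normD _ _) _; rewrite (splitr e) lerD//.
  have s1 : 0 <= 1 - s by rewrite subr_ge0.
  apply: le_trans (ler_normD _ _) _; rewrite !normrM (ger0_norm x0) (ger0_norm s1).
  rewrite [leRHS](_ : _ = s * (e / 2) + (1 - s) * (e / 2)); last by ring.
  by apply: lerD; rewrite ler_wpM2l.
rewrite normrM (le_trans _ al)// ler_wpM2l//; apply: le_trans (ler_normB _ _) _.
by rewrite mulr2n mulrDl !mul1r lerD.
Qed.

Lemma T_near_in u x (e : R) : {within K, continuous u} -> Omega x -> 0 < e ->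
  \forall y \near x, `|T u y - T u x| < e.
Proof.
move=> uK Ox e0; have [M M0 uM] := compact_within_bounded cK uK.
have [MF MF0 FM] := F_bounded.
pose D := delta x; pose S y := sup [set W u y nu | nu in esphere eps].
pose I y := inf [set W u y nu | nu in esphere eps].
have e4 : 0 < e / 4 by rewrite divr_gt0.
have eM : 0 < e / (4 * (M + MF)) by rewrite divr_gt0// mulr_gt0// addr_gt0.
have WM y nu : Omega y -> esphere eps nu -> `|W u y nu| <= M.
  by move=> Oy nue; exact: W_bounded.
have SM y : Omega y -> `|S y| <= M.
  by move=> Oy; apply: sup_norm_le => [|nu]; [exact: sphere_neq0|exact: WM].
have IM y : Omega y -> `|I y| <= M.
  by move=> Oy; apply: inf_norm_le => [|nu]; [exact: sphere_neq0|exact: WM].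
have [d d0 dP] := W_equicont uK e4.
have ny : \forall y \near x, enorm (y - x) < d by apply/enorm_nbhsP; exists d.
have nO : nbhs x Omega by apply: open_nbhs_nbhs.
have nd : \forall y \near x, Omega y -> `|delta y - delta x| < e / (4 * (M + MF)).
  apply/enorm_nbhsP; exists (eps * (e / (4 * (M + MF)))); first by rewrite mulr_gt0.
  move=> y yx Oy; apply: le_lt_trans (delta_lipschitz _ _ _ _ _ Oy Ox) _ => //.
  by rewrite mulrC ltr_pdivrMr// mulrC.
(* [F] is continuous only on [Gamma]. Inside the strip its continuity applies; outside it
   [delta x = 0], and the term at [y] is at most [MF * delta y], which is small by continuity of
   [delta]. *)
have nF : \forall y \near x, Omega y ->
    `|delta y * F y - delta x * F x| <= e / 4 + MF * `|delta y - delta x|.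
  have [xe|xe] := ltP (dist x (boundary Omega)) eps.
    have xG := inner_Gamma Ox xe.
    have nFx := (within_nearP _ _).1 F_cont x xG _ e4.
    have ne : \forall y \near x, dist y (boundary Omega) < eps.
      apply/enorm_nbhsP; exists (eps - dist x (boundary Omega)); first by rewrite subr_gt0.
      move=> y yx; have := dist_lipschitz y x (boundary_neq0 n_gt0 Omega_neq0 Omega_open Omega_bounded).
      by rewrite ler_norml => /andP[_ ?]; lra.
    near=> y => Oy.
    have yG : Gamma eps Omega y by apply: inner_Gamma => //; near: y.
    have Fyx : `|F y - F x| < e / 4 by move: yG; near: y.
    have /andP[dy0 dy1] := delta_ge0_le1 Omega eps0 y.
    rewrite (_ : _ - _ = delta y * (F y - F x) + F x * (delta y - delta x)); last by ring.
    apply: le_trans (ler_normD _ _) _; rewrite !normrM (ger0_norm dy0) lerD//.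
      by rewrite -[leRHS]mul1r ler_pM// ltW.
    by rewrite ler_wpM2r// FM.
  have dx : delta x = 0.
    by rewrite delta_in// max_l// subr_le0 mulrC ler_pdivlMr// mul1r.
  near=> y => Oy; rewrite dx mul0r !subr0 normrM.
  case: (delta_inner_strip eps0 Oy) => [yG|->]; last first.
    by rewrite normr0 mul0r mulr0 addr0 ltW.
  apply: (@le_trans _ _ (MF * `|delta y|)); last by rewrite lerDr ltW.
  rewrite [leLHS]mulrC; apply: ler_wpM2r => //.
  by apply: FM; exact: inner_Gamma.
near=> y.
have Oy : Omega y by near: y.
have Wyx nu : enorm nu = eps -> `|W u y nu - W u x nu| <= e / 4.
  by apply: dP => //; near: y.
have dyx : `|delta y - delta x| < e / (4 * (M + MF)) by move: Oy; near: y.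
have Fyx : `|delta y * F y - delta x * F x| <= e / 4 + MF * `|delta y - delta x|.
  by move: Oy; near: y.
have hS : `|S y - S x| <= e / 4.
  by apply: (@sup_dist _ _ _ _ _ M) => //; [exact: sphere_neq0|move=> nu; exact: WM..].
have hI : `|I y - I x| <= e / 4.
  by apply: (@inf_dist _ _ _ _ _ M) => //; [exact: sphere_neq0|move=> nu; exact: WM..].
have /andP[dy0 dy1] := delta_ge0_le1 Omega eps0 y.
rewrite !T_in// -/(S y) -/(I y) -/(S x) -/(I x).
rewrite (_ : _ - _ = (1 - delta y) / 2 * ((S y - S x) + (I y - I x)) +
  (delta x - delta y) / 2 * (S x + I x) + (delta y * F y - delta x * F x)); last by ring.
have t1 : `|(1 - delta y) / 2 * ((S y - S x) + (I y - I x))| <= e / 4.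
  rewrite normrM (ger0_norm (_ : 0 <= (1 - delta y) / 2)); last first.
    by rewrite divr_ge0 ?subr_ge0.
  have : `|(S y - S x) + (I y - I x)| <= e / 4 + e / 4.
    by apply: le_trans (ler_normD _ _) _; exact: lerD.
  by move: (normr_ge0 (S y - S x + (I y - I x))) => ? ?; nra.
have t2 : `|(delta x - delta y) / 2 * (S x + I x)| <= M * `|delta y - delta x|.
  rewrite normrM normrM (ger0_norm (_ : 0 <= 2^-1)) ?invr_ge0// (distrC (delta x)).
  have : `|S x + I x| <= M + M.
    by apply: le_trans (ler_normD _ _) _; apply: lerD; [exact: SM|exact: IM].
  move: (normr_ge0 (delta y - delta x)) => ? ?.
  rewrite -mulrA mulrC ler_wpM2r//; lra.
apply: le_lt_trans (ler_normD _ _) _.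
have t12 : `|(1 - delta y) / 2 * ((S y - S x) + (I y - I x)) +
  (delta x - delta y) / 2 * (S x + I x)| <= e / 4 + M * `|delta y - delta x|.
  by apply: le_trans (ler_normD _ _) _; exact: lerD.
have dM : (M + MF) * `|delta y - delta x| < e / 4.
  have := dyx; rewrite ltr_pdivlMr ?mulr_gt0 ?addr_gt0// => h; lra.
by lra.
Unshelve. all: by end_near. Qed.

(** Approaching [x] from [Omega], the distance to the boundary is at most [enorm (y - x)], so
    [1 - delta y] tends to 0 and kills the game part of [T]; what remains is [F y], close to
    [F x]. *)
Lemma T_near_out u x (e : R) : {within K, continuous u} -> K x -> ~ Omega x -> 0 < e ->
  \forall y \near x, K y -> `|T u y - T u x| < e.
Proof.
move=> uK Kx Ox e0; have [M M0 uM] := compact_within_bounded cK uK.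
have [MF MF0 FM] := F_bounded.
have e2 : 0 < e / 2 by rewrite divr_gt0.
have eM : 0 < eps * (e / (2 * (M + MF))).
  by rewrite mulr_gt0// divr_gt0// mulr_gt0// addr_gt0.
have xG := K_Gamma eps0 Omega_open Kx Ox.
have nF := (within_nearP _ _).1 F_cont x xG _ e2.
have ne : \forall y \near x, enorm (y - x) < Num.min eps (eps * (e / (2 * (M + MF)))).
  apply/enorm_nbhsP; exists (Num.min eps (eps * (e / (2 * (M + MF))))) => //.
  by rewrite lt_min eps0.
near=> y => Ky; rewrite (T_out _ Ox).
have [Oy|Oy] := pselect (Omega y); last first.
  rewrite T_out//; have yG := K_Gamma eps0 Omega_open Ky Oy.
  by apply: (@lt_trans _ _ (e / 2)); [move: yG; near: y|lra].
have : enorm (y - x) < Num.min eps (eps * (e / (2 * (M + MF)))) by near: y.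
rewrite lt_min => /andP[ye yM].
have dy : dist y (boundary Omega) <= enorm (y - x).
  by rewrite enormB; exact: (dist_in Omega_open).
have yG : Gamma eps Omega y by apply: inner_Gamma => //; exact: le_lt_trans dy ye.
have Fyx : `|F y - F x| < e / 2 by move: yG; near: y.
have /andP[dy0 dy1] := delta_ge0_le1 Omega eps0 y.
have d1 : (1 - delta y) * (M + MF) < e / 2.
  have : 1 - delta y < e / (2 * (M + MF)).
    rewrite ltrBlDr -ltrBlDl delta_in// lt_max; apply/orP; right.
    rewrite ltrD2l ltrN2 mulrC ltr_pdivrMr// mulrC.
    exact: le_lt_trans dy yM.
  by rewrite ltr_pdivlMr ?mulr_gt0 ?addr_gt0// => h; lra.
rewrite T_in//; set S := sup _; set I := inf _.
have SM : `|S| <= M.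
  by apply: sup_norm_le => [|nu nue]; [exact: sphere_neq0|exact: W_bounded].
have IM : `|I| <= M.
  by apply: inf_norm_le => [|nu nue]; [exact: sphere_neq0|exact: W_bounded].
rewrite (_ : _ - _ = (1 - delta y) * ((S + I) / 2 - F y) + (F y - F x)); last by field.
apply: le_lt_trans (ler_normD _ _) _; rewrite (splitr e) ltrD//.
apply: le_lt_trans d1; rewrite normrM ger0_norm ?subr_ge0// ler_wpM2l ?subr_ge0//.
apply: le_trans (ler_normB _ _) _; apply: lerD; last exact: FM.
rewrite normrM (ger0_norm (_ : 0 <= 2^-1)) ?invr_ge0//.
have : `|S + I| <= M + M by apply: le_trans (ler_normD _ _) _; exact: lerD.
by lra.
Unshelve. all: by end_near. Qed.

Lemma T_cont u : {within K, continuous u} -> {within K, continuous (T u)}.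
Proof.
move=> uK; apply/within_nearP => x Kx e e0.
have [Ox|Ox] := pselect (Omega x); last exact: T_near_out.
by apply: filterS (T_near_in uK Ox e0).
Qed.

Lemma T_fixpoint : exists u, [/\ {within K, continuous u},
  (forall x, K x -> u x = T u x) &
  forall v, {within K, continuous v} -> (forall x, K x -> v x = T v x) ->
    forall x, K x -> v x = u x].
Proof.
have [g [A [bg A1 gA Wg]]] :=
  lyapunov eps0 n2 Omega_neq0 Omega_open Omega_bounded p_gt1 p_le.
pose q := 1 - A^-1.
have A0 : 0 < A by exact: lt_trans A1.
have q01 : 0 <= q < 1 by rewrite subr_ge0 invf_le1// (ltW A1)/= ltrBlDr ltrDl invr_gt0.
have /andP[q0 q1] := q01.
have contr u v (M : R) : {within K, continuous u} -> {within K, continuous v} -> 0 <= M ->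
    (forall y, K y -> `|u y - v y| <= M * g y) ->
    forall x, K x -> `|T u x - T v x| <= M * q * g x.
  by move=> *; exact: (T_contract bg (ltW A1) gA Wg).
have cst0 : {within K, continuous (fun _ : 'rV[R]_n => 0 : R)}.
  by apply/within_contP => x _ e e0; exists 1 => // y _ _; rewrite subrr normr0.
pose U k := iter k T (fun=> 0).
have UK k : {within K, continuous (U k)}.
  by elim: k => [//|k IH]; exact: T_cont.
have [C C0 UC] := compact_within_bounded cK (UK 1%N).
have U1 k x : K x -> `|U k.+1 x - U k x| <= C * q ^+ k * g x.
  elim: k x => [|k IH] x Kx.
    have /andP[g1 _] := gA x Kx.
    rewrite expr0 mulr1 subr0 (le_trans (UC x Kx))// ler_peMr// ltW//.
  rewrite exprSr mulrA; apply: (contr (U k.+1) (U k)); [exact: UK|exact: UK| |exact: IH|exact: Kx].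
  by rewrite mulr_ge0 ?exprn_ge0// ltW.
have lim x : exists l, K x -> forall k, `|l - U k x| <= C * A / (1 - q) * q ^+ k.
  have [Kx|Kx] := pselect (K x); last by exists 0.
  have [l lP] : exists l, forall k, `|l - U k x| <= C * A / (1 - q) * q ^+ k.
    apply: geometric_limit => // k; apply: le_trans (U1 k x Kx) _.
    have /andP[g1 gxA] := gA x Kx.
    by rewrite mulrAC ler_wpM2r ?exprn_ge0// ler_wpM2l// ltW.
  by exists l.
(* A pointwise limit, with a rate that is uniform on [K]; the rate carries continuity over to
   [u]. *)
have [u uP] := choice lim; set B := C * A / (1 - q) in uP.
have B0 : 0 <= B by rewrite divr_ge0 ?mulr_ge0 ?subr_ge0 ?(ltW C0) ?(ltW A0) ?(ltW q1).
have uK : {within K, continuous u}.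
  apply/within_contP => x Kx e e0.
  have e3 : 0 < e / 3 by rewrite divr_gt0.
  have [k kP] := geometric_small B q01 e3.
  have [d d0 dP] := (within_contP _ _).1 (UK k) x Kx _ e3.
  exists d => // y Ky yx; have := dP y Ky yx; have := uP x Kx k; have := uP y Ky k.
  move: (U k y) (U k x) => a b; rewrite !ler_norml !ltr_norml.
  by move=> /andP[? ?] /andP[? ?] /andP[? ?]; apply/andP; split; lra.
have uT x : K x -> u x = T u x.
  move=> Kx; apply/eqP; rewrite -subr_eq0 -normr_le0; apply/ler_addgt0Pr => e e0.
  rewrite add0r; have [k kP] := geometric_small (B + B * A) q01 e0.
  rewrite (le_trans _ (ltW kP))//.
  have Bk : 0 <= B * q ^+ k := mulr_ge0 B0 (exprn_ge0 k q0).
  (* [u - T u] is split at [U k.+1 = T (U k)]: the rate bounds one part and the contraction the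
     other. *)
  have h1 : `|T (U k) x - T u x| <= B * q ^+ k * q * g x.
    apply: (contr (U k) u); [exact: UK|exact: uK|exact: Bk| |exact: Kx].
    move=> y Ky; rewrite distrC (le_trans (uP y Ky k))// ler_peMr//.
    by have /andP[] := gA y Ky.
  have h2 := uP x Kx k.+1.
  have /andP[g1 gxA] := gA x Kx.
  have qk : 0 <= q ^+ k by rewrite exprn_ge0.
  have h3 : B * q ^+ k * q * g x <= B * q ^+ k * A.
    rewrite -mulrA ler_wpM2l// -[leRHS]mul1r ler_pM// ?(ltW q1)//.
    by rewrite (le_trans _ g1).
  have h4 : B * q ^+ k.+1 <= B * q ^+ k.
    by rewrite ler_wpM2l// exprS ler_piMl// ltW.
  rewrite -(subrKA (U k.+1 x)); apply: le_trans (ler_normD _ _) _.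
  by rewrite mulrDl (mulrAC B A) lerD//; [exact: le_trans h4|exact: le_trans h3].
exists u; split => // v vK vT x Kx.
have [Cu _ uC] := compact_within_bounded cK uK.
have [Cv _ vC] := compact_within_bounded cK vK.
pose D := Cv + Cu.
have D0 : 0 <= D.
  have := le_trans (normr_ge0 _) (uC x Kx); have := le_trans (normr_ge0 _) (vC x Kx).
  by rewrite /D; lra.
(* Uniqueness: the crude bound [D] on two fixed points shrinks by the factor [q] at each application
   of [T]. *)
have Dk k y : K y -> `|v y - u y| <= D * q ^+ k * g y.
  elim: k y => [|k IH] y Ky.
    have /andP[g1 _] := gA y Ky.
    rewrite expr0 mulr1; apply: le_trans (ler_normB _ _) _.
    by rewrite (le_trans (lerD (vC y Ky) (uC y Ky)))// ler_peMr.
  rewrite exprSr mulrA vT// uT//; apply: contr; [exact: vK|exact: uK| |exact: IH|exact: Ky].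
  by rewrite mulr_ge0 ?exprn_ge0.
apply/eqP; rewrite -subr_eq0 -normr_le0; apply/ler_addgt0Pr => e e0.
rewrite add0r; have [k kP] := geometric_small (D * g x) q01 e0.
by rewrite (le_trans (Dk k x Kx))// mulrAC ltW.
Qed.

End operator.

(** * Laws of the game *)

Section laws.
Context {R : realType}.

Lemma mean_law d1 (T1 : measurableType d1) d2 (T2 : measurableType d2) d (T : measurableType d)
    (P : probability T1 R) (Q : probability T2 R) (phi : T1 -> T) (psi : T2 -> T) (f : T -> R) :
  measurable_fun setT phi -> measurable_fun setT psi ->
  (forall B, measurable B -> P (phi @^-1` B) = Q (psi @^-1` B)) -> bmeas f ->
  \int[P]_x f (phi x) = \int[Q]_x f (psi x).
Proof.
move=> mphi mpsi PQ bf; congr fine.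
have mf : measurable_fun setT (EFin \o f) by apply/measurable_EFinP; exact: bf.1.
have i1 : P.-integrable (phi @^-1` setT) ((EFin \o f) \o phi).
  by rewrite preimage_setT; apply: bmeas_integrable => //; exact: bmeas_comp.
have i2 : Q.-integrable (psi @^-1` setT) ((EFin \o f) \o psi).
  by rewrite preimage_setT; apply: bmeas_integrable => //; exact: bmeas_comp.
have := integral_pushforward mphi mf i1 measurableT.
have := integral_pushforward mpsi mf i2 measurableT.
rewrite !preimage_setT => <- <-.
by apply: eq_measure_integral => A mA _; exact: PQ.
Qed.

Lemma le_mean_ae d (T : measurableType d) (P : probability T R) (A : set T) (f g : T -> R) :
  bmeas f -> bmeas g -> measurable A -> P A = 1%E -> (forall x, A x -> f x <= g x) ->
  \int[P]_x f x <= \int[P]_x g x.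
Proof.
move=> bf bg mA PA fg; have [_ [M fM]] := bf; have [_ [N gN]] := bg.
have bI : bmeas (\1_(~` A) : T -> R) by apply: bmeas_indic; exact: measurableC.
have I0 : \int[P]_x \1_(~` A) x = 0 :> R.
  apply: EFin_inj; rewrite mean_indic; last exact: measurableC.
  by rewrite probability_setC// PA subee.
(* Adding to [g] a multiple of the indicator of a null set keeps its mean and turns the inequality
   into one valid everywhere. *)
have -> : \int[P]_x g x = \int[P]_x (g x + (M + N) * \1_(~` A) x).
  by rewrite meanD//; [rewrite meanZ// I0 mulr0 addr0|exact: bmeasZ].
apply: le_mean => //; first by apply: bmeasD => //; exact: bmeasZ.
move=> x; have [Ax|Ax] := pselect (A x).
  by rewrite indicE memNset ?mulr0 ?addr0 ?fg// => /(_ Ax).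
rewrite indicE mem_set// mulr1; have := fM x; have := gN x; rewrite !ler_norml.
by move=> /andP[? ?] /andP[? ?]; lra.
Qed.

Lemma mean_dirac d (T : measurableType d) (a : T) (f : T -> R) : bmeas f ->
  \int[\d_a : probability T R]_x f x = f a.
Proof.
move=> bf; rewrite /Rintegral integral_dirac//; last first.
  by apply/measurable_EFinP; exact: bf.1.
by rewrite diracT mul1e.
Qed.

Lemma probability_full d (T : measurableType d) (P : probability T R) (A B : set T) :
  measurable A -> measurable B -> P A = 1%E -> P (A `&` B) = P B.
Proof.
move=> mA mB PA; have mAB := measurableI _ _ mA mB.
have nA : P (~` A) = 0%E by rewrite probability_setC// PA subee.
apply/eqP; rewrite eq_le le_measure ?inE//=.
have -> : P B = P ((A `&` B) `|` (~` A `&` B)) by rewrite -setIUl setUv setTI.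
apply: le_trans (measureU2 _ _ _) _ => //; first by apply: measurableI => //; exact: measurableC.
rewrite [X in (_ + X)%E](_ : _ = 0%E) ?adde0//; apply/eqP; rewrite eq_le measure_ge0 andbT.
by rewrite -nA le_measure ?inE//; [apply: measurableI => //|]; exact: measurableC.
Qed.

End laws.

(** * Measurability of plays and one turn as a function of history and noise *)

Section plays.
Context {R : realType} {n : nat}.
Local Notation E := (borelRn R n).
Local Notation state := (gstate R n).
Local Notation play := (play R n).

Lemma measurable_coord_play j : measurable_fun setT (fun w : play => w j : state).
Proof.
move=> _ B mB; rewrite setTI; apply: sub_gen_smallest.
by exists j, B.
Qed.

Lemma measurable_fun_play d (T : measurableType d) (f : T -> play) :
  (forall j, measurable_fun setT (fun t => f t j : state)) -> measurable_fun setT f.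
Proof.
move=> mf; apply: (@measurability _ _ T play setT f (@cylinders R n)) => //.
move=> _ [_ [j [B mB ->]] <-]; rewrite setTI -[X in measurable X]setTI.
exact: (mf j).
Qed.

Lemma measurable_past j : measurable_fun setT (@past R n j).
Proof.
apply/measurable_fun_tnthP => i.
rewrite (_ : _ \o _ = (fun w : play => w i)); first exact: measurable_coord_play.
by apply/funext => w /=; rewrite tnth_mktuple.
Qed.

Lemma past_last j (w : play) : tnth (past j w) ord_max = w j.
Proof. by rewrite tnth_mktuple. Qed.

Lemma measurable_mem d (T : measurableType d) (A : set T) : measurable A ->
  measurable_fun setT (fun x => x \in A).
Proof.
move=> mA; apply: (measurable_fun_bool true).
rewrite setTI (_ : _ @^-1` _ = A)//.
by apply/seteqP; split => x /=; [exact: set_mem|exact: mem_set].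
Qed.

Lemma measurable_if_mem d (T : measurableType d) d' (T' : measurableType d') (A : set T)
    (f : T -> T') (a : T') : measurable A -> measurable_fun A f ->
  measurable_fun setT (fun x => if x \in A then f x else a).
Proof.
move=> mA mf; apply: measurable_fun_if => //; first exact: measurable_mem.
rewrite setTI (_ : _ @^-1` _ = A)//.
by apply/seteqP; split => x /=; [exact: set_mem|exact: mem_set].
Qed.

Variables (eps : R) (Omega : set 'rV[R]_n) (p F : 'rV[R]_n -> R).
Hypotheses (eps0 : 0 < eps) (n2 : (2 <= n)%N) (Omega_neq0 : Omega !=set0)
  (Omega_open : open Omega) (Omega_bounded : bounded_set Omega).
Hypotheses (p_gt1 : forall x, Omega x -> 1 < p x).
Hypotheses (p_cont : {within closure Omega, continuous p}).
Local Notation delta := (delta eps Omega).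
Local Notation legal := (@legal R n eps Omega).
Local Notation history j := (j.+1.-tuple state).
Local Notation RR := (measurableTypeR R).

Let n_gt0 : (0 < n)%N. Proof. exact: ltn_trans n2. Qed.

Lemma measurable_dist_boundary :
  measurable_fun setT (fun x : E => dist x (boundary Omega)).
Proof.
by apply: lipschitz_measurable => x y; apply: dist_lipschitz; exact: boundary_neq0.
Qed.

Lemma measurable_Omega : measurable (Omega : set E).
Proof. exact: open_measurable_Rn. Qed.

Lemma measurable_Omega_eps : measurable (Omega_eps eps Omega : set E).
Proof.
have mC : measurable (closure Omega : set E).
  by apply: closed_measurable_Rn; exact: closed_closure.
have -> : Omega_eps eps Omega = closure Omega `|` (~` closure Omega `&`
    ((fun x => dist x (boundary Omega)) @^-1` `]-oo, eps[)).
  by rewrite /Omega_eps /outer_strip; apply/seteqP; split => x /=; rewrite in_itv/=.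
apply: measurableU => //; apply: measurableI; first exact: measurableC.
by rewrite -[X in measurable X]setTI; exact: measurable_dist_boundary.
Qed.

Lemma measurable_delta : measurable_fun setT (delta : E -> RR).
Proof.
have -> : delta = (fun x => if x \in Omega then Num.max 0 (1 - eps^-1 * dist x (boundary Omega)) else 1).
  apply/funext => x; case: ifPn => [/set_mem/delta_in ->//|/negP Ox].
  by rewrite delta_out// => /mem_set.
apply: measurable_if_mem; first exact: measurable_Omega.
apply: measurable_funTS; apply: measurable_maxr => //.
apply: measurable_funB => //; apply: measurable_funM => //.
exact: measurable_dist_boundary.
Qed.

(** [alpha p x] is known to be a probability only in [Omega]. Elsewhere [delta] is 1 and the value 0
    merely keeps the thresholds of [step] in order. *)
Definition alpha0 (x : E) : R := if x \in Omega then alpha p x else 0.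

Lemma measurable_alpha0 : measurable_fun setT (alpha0 : E -> RR).
Proof.
have -> : alpha0 = (fun x => if x \in Omega then alpha (p \_ (closure Omega)) x else 0).
  apply/funext => x; rewrite /alpha0; case: ifPn => // /set_mem Ox.
  by rewrite /alpha patchE mem_set//; exact: subset_closure.
apply: measurable_if_mem; first exact: measurable_Omega.
have mp := within_patch_measurable (@closed_closure _ _) p_cont.
apply: measurable_funTS; apply: measurable_funM; first exact: measurable_funB.
by apply: (measurableT_comp (measurable_invr)); exact: measurable_funD.
Qed.

Lemma alpha0_in x : Omega x -> alpha0 x = alpha p x.
Proof. by move=> Ox; rewrite /alpha0 mem_set. Qed.

Lemma alpha0_ge0_le1 x : 0 <= alpha0 x <= 1.
Proof.
by rewrite /alpha0; case: ifPn => [/set_mem/(alpha01 n2 p_gt1)//|_]; rewrite lexx ler01.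
Qed.

Lemma measurable_legal j : measurable (@legal j).
Proof.
have -> : @legal j = \bigcap_(i in [set: 'I_j.+1])
    ((fun h : history j => (tnth h i).2) @^-1` Omega_eps eps Omega).
  by apply/seteqP; split => h /= H i => [_|]; exact: H.
apply: fin_bigcap_measurable => // i _; rewrite -[X in measurable X]setTI.
have m : measurable_fun setT (fun h : history j => (tnth h i).2).
  exact: (measurableT_comp measurable_snd (measurable_tnth i)).
by apply: m => //; exact: measurable_Omega_eps.
Qed.

Variables (S1 S2 : forall j, history j -> 'rV[R]_n).
Hypotheses (S1s : strategy eps Omega S1) (S2s : strategy eps Omega S2).

Definition totalize (S : forall j, history j -> 'rV[R]_n) j (h : history j) : E :=
  if h \in @legal j then S j h else 0.

Lemma measurable_totalize S j : strategy eps Omega S -> measurable_fun setT (@totalize S j).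
Proof.
move=> Ss; apply: measurable_if_mem; first exact: measurable_legal.
by have [] := Ss j.
Qed.

Definition play_step j (hv : history j * (RR * n.-1.-tuple RR)) : state :=
  let s := tnth hv.1 ord_max in
  if s.1 then (true, s.2)
  else step s.2 (delta s.2) (alpha0 s.2) (totalize S1 hv.1) (totalize S2 hv.1) hv.2.

Lemma measurable_play_step j : measurable_fun setT (@play_step j).
Proof.
have ml : measurable_fun setT (fun h : history j => tnth h ord_max).
  exact: measurable_tnth.
have m1 := measurableT_comp measurable_fst ml.
have m2 := measurableT_comp measurable_snd ml.
apply: measurable_fun_ifT.
- exact: (measurableT_comp m1 measurable_fst).
- apply: measurable_fun_pair; first exact: measurable_cst.
  exact: (measurableT_comp m2 measurable_fst).
apply: (measurable_step (x := fun h : history j => (tnth h ord_max).2)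
  (nu1 := @totalize S1 j) (nu2 := @totalize S2 j)
  (d := fun h : history j => delta (tnth h ord_max).2)
  (a := fun h : history j => alpha0 (tnth h ord_max).2)) => //.
- exact: measurable_totalize.
- exact: measurable_totalize.
- exact: (measurableT_comp measurable_delta m2).
- exact: (measurableT_comp measurable_alpha0 m2).
Qed.

Lemma legal_last j (h : history j) : legal h -> Omega_eps eps Omega (tnth h ord_max).2.
Proof. exact. Qed.

Lemma totalize_legal S j (h : history j) : legal h -> totalize S h = S j h.
Proof. by move=> hl; rewrite /totalize mem_set. Qed.

Lemma mean_play_step_dead j (h : history j) (f : state -> R) : (tnth h ord_max).1 ->
  \int[noise eps]_v f (play_step (h, v)) = f (true, (tnth h ord_max).2).
Proof.
move=> c; rewrite -[RHS](mean_cst (@noise R n eps)); apply: eq_Rintegral => v _.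
by rewrite /play_step /= c.
Qed.

(** Off [Omega] the exit probability is 1, so live and exited tokens have the same next state. *)
Lemma mean_play_step_out j (h : history j) (f : state -> R) : bmeas f ->
  ~ Omega (tnth h ord_max).2 ->
  \int[noise eps]_v f (play_step (h, v)) = f (true, (tnth h ord_max).2).
Proof.
move=> bf Ox; have [c|c] := boolP (tnth h ord_max).1; first exact: mean_play_step_dead.
rewrite /play_step /= (negbTE c) mean_step//; last 2 first.
- exact: delta_ge0_le1.
- exact: alpha0_ge0_le1.
by rewrite delta_out// subrr !mul0r addr0 mul1r.
Qed.

Lemma mean_play_step_in j (h : history j) (f : state -> R) : bmeas f -> legal h ->
  ~~ (tnth h ord_max).1 -> Omega (tnth h ord_max).2 ->
  let x := (tnth h ord_max).2 in
  \int[noise eps]_v f (play_step (h, v)) = delta x * f (true, x) + (1 - delta x) / 2 *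
    (Wb eps p (fun y => f (false, y)) x (S1 h) + Wb eps p (fun y => f (false, y)) x (S2 h)).
Proof.
move=> bf hl c Ox x; rewrite /play_step /= (negbTE c) -/x.
rewrite (totalize_legal S1 hl) (totalize_legal S2 hl) (alpha0_in Ox) /Wb /beta.
apply: mean_step => //; first exact: delta_ge0_le1.
exact: (alpha01 n2 p_gt1 Ox).
Qed.

Lemma strategy_norm S j (h : history j) : strategy eps Omega S -> legal h -> enorm (S j h) = eps.
Proof. by move=> Ss; have [_] := Ss j; exact. Qed.

Lemma turnE (x nu : 'rV[R]_n) (B : set state) : measurable B -> enorm nu = eps ->
  turn eps p x nu B = (Wb eps p (fun y => \1_B (false, y)) x nu)%:E.
Proof.
move=> mB nue; rewrite /turn /Wb; move: (alpha p x) (beta p x) => a b.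
rewrite EFinD !EFinM diracE indicE; congr (_ + _ * _)%E.
have ma : measurable_fun setT (fun z : E => (false, (x + z)%R) : state).
  by apply: measurable_fun_pair; [exact: measurable_cst|exact: measurable_addRn].
have mC : measurable ([set z | B (false, (x + z)%R)] : set E).
  by rewrite -[X in measurable X]setTI; exact: ma.
rewrite unif_discE ?(nu_neq0 eps0)// -mean_indic//.
by rewrite -[X in measurable X]setTI; exact: measurable_plane_pt.
Qed.

Lemma transitionE j (h : history j) (B : set state) : legal h -> measurable B ->
  transition eps Omega p S1 S2 h B = noise eps [set v | B (play_step (h, v))].
Proof.
move=> hl mB; have bB : bmeas (\1_B : state -> R) by exact: bmeas_indic.
have mC : measurable [set v | B (play_step (h, v))].
  rewrite -[X in measurable X]setTI.
  exact: (measurable_fun_pair2 h (@measurable_play_step j)).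
rewrite -mean_indic// (_ : \int[_]_v _ = \int[noise eps]_v \1_B (play_step (h, v)))//.
rewrite /transition; case: ifPn => [c|c].
  by rewrite mean_play_step_dead// diracE indicE.
set x := (tnth h ord_max).2.
rewrite !turnE ?strategy_norm// diracE -!EFinM -EFinD; congr EFin.
have [Ox|Ox] := pselect (Omega x); last first.
  by rewrite (mean_play_step_out bB Ox) (delta_out eps Ox) subrr mul0r addr0 mul1r indicE.
rewrite (mean_play_step_in bB hl c Ox) -/x indicE.
move: (Wb _ _ _ _ _) (Wb _ _ _ _ _) => w1 w2.
by congr (_ + _); rewrite -mulrDr mulrA.
Qed.

(** The second clause of [is_law] at one time, with the kernel integral replaced by a product
    measure (see [integral_transition]). The time is a parameter because a stopped law obeys it only
    up to the stopping time. *)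
Definition law_step (P : probability play R) j :=
  forall (A : set (history j)) (B : set state), measurable A -> A `<=` @legal j ->
  measurable B -> P [set w | A (past j w) /\ B (w j.+1)] =
    (P \x noise eps)%E [set wv | A (past j wv.1) /\ B (play_step (past j wv.1, wv.2))].

Lemma measurable_past_step j : measurable_fun setT
  (fun wv : play * (RR * n.-1.-tuple RR) => play_step (past j wv.1, wv.2)).
Proof.
apply: (measurableT_comp (@measurable_play_step j)).
apply: measurable_fun_pair => //.
exact: (measurableT_comp (@measurable_past j) measurable_fst).
Qed.

Lemma integral_transition (P : probability play R) j (A : set (history j)) (B : set state) :
  measurable A -> A `<=` @legal j -> measurable B ->
  (\int[P]_(w in [set w | A (past j w)]) transition eps Omega p S1 S2 (past j w) B =
   (P \x noise eps) [set wv | A (past j wv.1) /\ B (play_step (past j wv.1, wv.2))])%E.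
Proof.
move=> mA Al mB; rewrite integral_mkcond.
apply: eq_integral => w _; rewrite patchE /=.
case: ifPn => [/set_mem/= Aw|/negP Aw].
  rewrite transitionE//; last exact: Al.
  congr (noise eps _); apply/seteqP; split => v /=; rewrite /xsection/= in_setE//=.
  by case.
rewrite (_ : xsection _ _ = set0) ?measure0//; apply/seteqP; split => v //=.
by rewrite /xsection/= in_setE/= => -[Aw' _]; apply: Aw; rewrite in_setE.
Qed.

(** From [Omega] a turn moves the token by at most [eps], almost surely; elsewhere it leaves the
    token in place. *)
Lemma noise_legal j (h : history j) : legal h ->
  noise eps [set v | Omega_eps eps Omega (play_step (h, v)).2] = 1%E.
Proof.
move=> hl; pose B : set state := [set s : state | Omega_eps eps Omega s.2].
have mB : measurable B.
  by rewrite -[X in measurable X]setTI; apply: measurable_snd => //; exact: measurable_Omega_eps.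
have bB : bmeas (\1_B : state -> R) by exact: bmeas_indic.
have mC : measurable [set v | Omega_eps eps Omega (play_step (h, v)).2].
  rewrite -[X in measurable X]setTI.
  exact: (measurableT_comp (@measurable_snd _ _ _ _)
    (measurable_fun_pair2 h (@measurable_play_step j))) measurable_Omega_eps.
rewrite -mean_indic// (_ : \int[_]_v _ = \int[noise eps]_v \1_B (play_step (h, v)))//.
congr EFin; set x := (tnth h ord_max).2.
have Bx b : \1_B (b, x) = 1 :> R by rewrite indicE mem_set//; exact: legal_last.
have [Ox|Ox] := pselect (Omega x); last by rewrite (mean_play_step_out bB Ox).
case: (boolP (tnth h ord_max).1) => c; first by rewrite mean_play_step_dead.
have B1 y : enorm (y - x) <= eps -> \1_B (false, y) = 1 :> R.
  by move=> xy; rewrite indicE mem_set//; apply: (Omega_move Omega_open Ox).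
have WB nu : enorm nu = eps -> Wb eps p (fun y => \1_B (false, y)) x nu = 1.
  move=> nue; rewrite /Wb B1; last by rewrite addrC addKr nue.
  rewrite (_ : \int[_]_t _ = 1) ?/beta; first by ring.
  have bp := bmeas_plane nu x (bmeas_state false bB).
  apply/eqP; rewrite eq_le; apply/andP; split.
    rewrite -[leRHS](mean_cst (unif_ball n.-1 eps)).
    apply: le_mean; [exact: bp|exact: bmeas_cst|].
    by move=> t; rewrite indicE; case: (_ \in _).
  rewrite -[leLHS](mean_cst (unif_ball n.-1 eps)).
  apply: (le_mean_ball eps0); [exact: bmeas_cst|exact: bp|].
  by move=> t te; rewrite B1// addrC addKr ltW//; exact: plane_pt_lt.
by rewrite (mean_play_step_in bB hl c Ox) -/x !WB ?strategy_norm// Bx; field.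
Qed.

(** * Legality of plays and the submartingale inequality *)

Variable x0 : 'rV[R]_n.
Hypothesis Ox0 : Omega x0.

Definition init_law (P : probability play R) := forall B : set state, measurable B ->
  P [set w | B (w 0%N)] = (\d_((false, x0) : state) B : \bar R).

Lemma legal_full (P : probability play R) N : init_law P ->
  (forall j, (j < N)%N -> law_step P j) ->
  forall j, (j <= N)%N -> P [set w | legal (past j w)] = 1%E.
Proof.
move=> P0 PS; elim=> [_|j IH jN].
  rewrite (_ : [set w | legal (past 0 w)] = [set w | [set s : state | Omega_eps eps Omega s.2] (w 0%N)]).
    rewrite P0 ?diracE ?mem_set//=; first exact: Omega_sub.
    rewrite -[X in measurable X]setTI; apply: measurable_snd => //.
    exact: measurable_Omega_eps.
  apply/seteqP; split => w /= H; first by have := H ord0; rewrite tnth_mktuple.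
  by move=> i; rewrite tnth_mktuple ord1.
pose B : set state := [set s : state | Omega_eps eps Omega s.2].
have mB : measurable B.
  by rewrite -[X in measurable X]setTI; apply: measurable_snd => //; exact: measurable_Omega_eps.
rewrite (_ : [set w | legal (past j.+1 w)] = [set w | @legal j (past j w) /\ B (w j.+1)]); last first.
  apply/seteqP; split => w /= H.
    split=> [i|]; last by have := H ord_max; rewrite tnth_mktuple.
    have := H (widen_ord (leqnSn _) i); by rewrite !tnth_mktuple.
  case: H => H Bw i; rewrite tnth_mktuple.
  have [ij|ij] := ltnP i j.+1; first by have := H (Ordinal ij); rewrite tnth_mktuple.
  by rewrite (_ : i = j.+1 :> nat)//; apply/eqP; rewrite eqn_leq ij -ltnS ltn_ord.
have ml := @measurable_legal j.
rewrite PS// -integral_transition//.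
rewrite -[RHS](IH (ltnW jN)).
transitivity (\int[P]_(w in [set w | @legal j (past j w)]) (cst 1 w))%E.
  apply: eq_integral => w; rewrite in_setE/= => wl.
  by rewrite transitionE//; exact: noise_legal.
rewrite integral_cst ?mul1e//.
by rewrite -[X in measurable X]setTI; exact: (@measurable_past j).
Qed.

(** [law_step] speaks of legal histories only; these have full measure, so it determines the
    unconditional law of the next state. *)
Lemma mean_next (P : probability play R) j (f : state -> R) : law_step P j ->
  P [set w | legal (past j w)] = 1%E -> bmeas f ->
  \int[P]_w f (w j.+1) = \int[P]_w \int[noise eps]_v f (play_step (past j w, v)).
Proof.
move=> PS Pl bf; have ml := @measurable_legal j.
have ml' : measurable [set w : play | legal (past j w)].
  by rewrite -[X in measurable X]setTI; exact: (@measurable_past j).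
pose phi (wv : play * (RR * n.-1.-tuple RR)) := play_step (past j wv.1, wv.2).
have mphi : measurable_fun setT phi by exact: measurable_past_step.
rewrite -(@mean_prod _ _ _ _ _ P (noise eps) (f \o phi)); last exact: bmeas_comp.
apply: (@mean_law _ _ _ _ _ _ _ P (P \x noise eps)%E (fun w : play => w j.+1) phi) => //.
  exact: measurable_coord_play.
move=> B mB.
rewrite -(probability_full ml' (_ : measurable ((fun w : play => w j.+1) @^-1` B)) Pl); last first.
  by rewrite -[X in measurable X]setTI; exact: (@measurable_coord_play j.+1).
have PSB := PS _ B ml (@subset_refl _ _) mB.
have -> : [set w : play | legal (past j w)] `&` (fun w : play => w j.+1) @^-1` B =
  [set w | @legal j (past j w) /\ B (w j.+1)] by [].
rewrite PSB.
have -> : [set wv : play * (RR * n.-1.-tuple RR) |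
    @legal j (past j wv.1) /\ B (play_step (past j wv.1, wv.2))] =
  fst @^-1` [set w | legal (past j w)] `&` phi @^-1` B by [].
apply: (probability_full (P := (P \x noise eps)%E : probability _ R)).
- by rewrite -[X in measurable X]setTI; exact: measurable_fst.
- by rewrite -[X in measurable X]setTI; exact: mphi.
rewrite (_ : _ @^-1` _ = [set w | legal (past j w)] `*` setT).
  apply: etrans (product_measure1E P (noise eps) ml' measurableT) _.
  rewrite [X in (X * _)%E]Pl mul1e; exact: probability_setT.
by apply/seteqP; split => -[w v] //= [].
Qed.

Lemma bmeas_if (psi phi : E -> R) : bmeas psi -> bmeas phi ->
  bmeas (fun s : state => if s.1 then psi s.2 else phi s.2).
Proof.
move=> [mpsi [M psiM]] [mphi [N phiN]]; split.
  apply: measurable_fun_ifT; first exact: measurable_fst.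
    exact: (measurableT_comp mpsi measurable_snd).
  exact: (measurableT_comp mphi measurable_snd).
by exists (Num.max M N) => s; case: ifPn => _; rewrite le_max ?psiM ?phiN// orbT.
Qed.

Lemma bmeas_coord_play (f : state -> R) j : bmeas f -> bmeas (fun w : play => f (w j)).
Proof.
by move=> bf; apply: (bmeas_comp _ bf); exact: measurable_coord_play.
Qed.

(** The function equal to [psi] on exited states and to [phi j] on live ones has nondecreasing mean.
    Time enters [phi] for the geometric weights of [alive_bound], and the bound [N] lets stopped
    laws qualify. *)
Lemma submartingale (P : probability play R) N (phi : nat -> E -> R) (psi : E -> R) :
  init_law P -> (forall j, (j < N)%N -> law_step P j) ->
  (forall j, bmeas (phi j)) -> bmeas psi ->
  (forall j x, Omega_eps eps Omega x -> ~ Omega x -> phi j x <= psi x) ->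
  (forall j (h : history j), legal h -> let x := (tnth h ord_max).2 in Omega x ->
     phi j x <= delta x * psi x + (1 - delta x) / 2 *
       (Wb eps p (phi j.+1) x (S1 h) + Wb eps p (phi j.+1) x (S2 h))) ->
  phi 0%N x0 <= \int[P]_w (if (w N).1 then psi (w N).2 else phi N (w N).2).
Proof.
move=> P0 PS bphi bpsi phi_out phi_in.
pose f j (s : state) := if s.1 then psi s.2 else phi j s.2.
have bf j : bmeas (f j) by exact: bmeas_if.
rewrite -/(f N _); suff : forall j, (j <= N)%N -> phi 0%N x0 <= \int[P]_w f j (w j).
  exact.
elim=> [_|j IH jN].
  rewrite (@mean_law _ _ _ _ _ _ _ P (\d_((false, x0) : state) : probability _ R)
    (fun w : play => w 0%N) id (f 0%N))//; first by rewrite mean_dirac.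
  exact: measurable_coord_play.
apply: le_trans (IH (ltnW jN)) _.
have Pl := legal_full P0 PS (ltnW jN).
rewrite (mean_next (PS _ jN) Pl (bf _)).
have ml' : measurable [set w : play | legal (past j w)].
  by rewrite -[X in measurable X]setTI; apply: (@measurable_past j) => //; exact: measurable_legal.
apply: (le_mean_ae _ _ ml' Pl).
- exact: bmeas_coord_play.
- apply: (@bmeas_fubini _ _ play _ (RR * n.-1.-tuple RR)%type P (noise eps)
    (fun wv => f j.+1 (play_step (past j wv.1, wv.2)))).
  by apply: (bmeas_comp _ (bf _)); exact: measurable_past_step.
move=> w /= wl; have := past_last j w; set h := past j w in wl * => hl; rewrite -hl.
have [Ox|Ox] := pselect (Omega (tnth h ord_max).2); last first.
  rewrite (mean_play_step_out (bf _) Ox) /f /=; case: ifPn => // _.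
  by apply: phi_out => //; exact: legal_last.
case: (boolP (tnth h ord_max).1) => c; first by rewrite mean_play_step_dead// /f c.
rewrite (mean_play_step_in (bf _) wl c Ox) /f (negbTE c) /=.
exact: phi_in.
Qed.

(** * Geometric decay of the probability that the game goes on *)

Section alive.
Variables (g : E -> R) (A : R).
Hypotheses (bg : bmeas g) (A1 : 1 < A)
  (gA : forall x, closure (Omega_eps eps Omega) x -> 1 <= g x <= A).
Hypothesis Wg : forall x nu, Omega x -> enorm nu = eps -> Wb eps p g x nu <= g x - 1.

(** With [q = 1 - A^-1] a turn shrinks [g] by the factor [q], so [q ^- j * g] on live states has
    nonincreasing mean; it starts at most at [A], and [g >= 1]. The sign is reversed to apply
    [submartingale]. *)
Lemma alive_bound (P : probability play R) N : init_law P ->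
  (forall j, (j < N)%N -> law_step P j) ->
  \int[P]_w (~~ (w N).1)%:R <= A * (1 - A^-1) ^+ N.
Proof.
move=> P0 PS; pose q := 1 - A^-1; have A0 : 0 < A by exact: lt_trans A1.
have q0 : 0 < q by rewrite subr_gt0 invf_lt1.
have Wq x nu : Omega x -> enorm nu = eps -> Wb eps p g x nu <= q * g x.
  move=> Ox nue; apply: le_trans (Wg Ox nue) _.
  have /andP[_ gxA] := gA (K_Omega eps Ox).
  by rewrite mulrBl mul1r lerD2l lerN2 mulrC ler_pdivrMr// mul1r.
have b1 j : bmeas (fun x => - (q ^- j * g x)) by apply: bmeasN; exact: bmeasZ.
have bc : bmeas (cst 0 : E -> R) by exact: bmeas_cst.
have sub := @submartingale P N (fun j x => - (q ^- j * g x)) (cst 0) P0 PS b1 bc.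
have : - (q ^- 0 * g x0) <= \int[P]_w (if (w N).1 then cst 0 (w N).2 else - (q ^- N * g (w N).2)).
  apply: sub => [j x Kx Ox|j h hl x Ox].
    rewrite oppr_le0 mulr_ge0// ?invr_ge0 ?exprn_ge0 ?(ltW q0)//.
    by have /andP[+ _] := gA (subset_closure Kx); exact: le_trans.
  have /andP[d0 d1] := delta_ge0_le1 Omega eps0 x.
  have /andP[g1 _] := gA (K_Omega eps Ox).
  rewrite !WbN ?WbZ//; [|exact: bmeasZ..].
  have w1 := Wq x (S1 h) Ox (strategy_norm S1s hl).
  have w2 := Wq x (S2 h) Ox (strategy_norm S2s hl).
  have -> : q ^- j = q ^- j.+1 * q by rewrite exprSr invfM mulfVK ?gt_eqF.
  have qj : 0 < q ^- j.+1 by rewrite invr_gt0 exprn_gt0.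
  move: (q ^- j.+1) qj (Wb _ _ _ _ _) (Wb _ _ _ _ _) w1 w2 => r r0 a b ab1 ab2.
  rewrite mulr0 add0r [leRHS](_ : _ = - (r * ((1 - delta x) * ((a + b) / 2)))); last by field.
  rewrite lerN2 -mulrA ler_pM2l//.
  have qg : 0 <= q * g x by rewrite mulr_ge0 ?(ltW q0)// (le_trans _ g1).
  by move: (delta x) d0 d1 => d d0 d1; nra.
rewrite expr0 invr1 mul1r => h.
have bN : bmeas (fun w : play => (~~ (w N).1)%:R : R).
  apply: (bmeas_coord_play N (f := fun s => (~~ s.1)%:R)).
  have bc1 : bmeas (cst 1 : E -> R) by exact: bmeas_cst.
  have := bmeas_if bc bc1; congr bmeas.
  by apply/funext => s; case: s.1.
have : \int[P]_w (if (w N).1 then cst 0 (w N).2 else - (q ^- N * g (w N).2)) <=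
    \int[P]_w (- q ^- N * (~~ (w N).1)%:R).
  have Pl := legal_full P0 PS (leqnn N).
  have ml' : measurable [set w : play | legal (past N w)].
    by rewrite -[X in measurable X]setTI; apply: (@measurable_past N) => //; exact: measurable_legal.
  apply: (le_mean_ae _ _ ml' Pl).
  - apply: (bmeas_coord_play N (f := fun s => if s.1 then cst 0 s.2 else - (q ^- N * g s.2))).
    exact: (bmeas_if bc (b1 N)).
  - exact: bmeasZ.
  move=> w /legal_last; rewrite past_last => wl; case: (w N).1; first by rewrite mulr0.
  rewrite mulr1 lerN2 ler_peMr ?invr_ge0 ?exprn_ge0 ?(ltW q0)//.
  by have /andP[] := gA (subset_closure wl).
rewrite meanZ// => h'.
have /andP[_ gxA] := gA (K_Omega eps Ox0).
have qN : 0 < q ^+ N by rewrite exprn_gt0.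
have := le_trans h h'; rewrite mulNr lerN2 mulrC ler_pdivrMr//.
by move=> /le_trans; apply; rewrite ler_pM2r.
Qed.

End alive.

(** * Plays are almost surely absorbed on exit *)

Lemma law_null (P : probability play R) j (A : set (history j)) (B : set state) :
  law_step P j -> P [set w | legal (past j w)] = 1%E -> measurable A -> measurable B ->
  (forall h v, A h -> ~ B (play_step (h, v))) ->
  P [set w | A (past j w) /\ B (w j.+1)] = 0%E.
Proof.
move=> PS Pl mA mB AB; have ml := @measurable_legal j.
have mp (C : set (history j)) : measurable C -> measurable [set w : play | C (past j w)].
  by move=> mC; rewrite -[X in measurable X]setTI; exact: (@measurable_past j).
have mBw : measurable [set w : play | B (w j.+1)].
  by rewrite -[X in measurable X]setTI; exact: (@measurable_coord_play j.+1).
have mE : measurable [set w : play | A (past j w) /\ B (w j.+1)].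
  by apply: measurableI => //; exact: mp.
rewrite -(probability_full (mp _ ml) mE Pl).
have -> : [set w : play | legal (past j w)] `&` [set w | A (past j w) /\ B (w j.+1)] =
    [set w | (A `&` @legal j) (past j w) /\ B (w j.+1)].
  by apply/seteqP; split => w /= [] => [? []|[]].
rewrite PS//; last exact: measurableI.
rewrite (_ : [set _ | _] = set0) ?measure0//.
by apply/seteqP; split => -[w v] //= [[/AB +] _]; apply.
Qed.

Lemma play_step_stop j (h : history j) v :
  ((play_step (h, v)).1 -> (play_step (h, v)).2 = (tnth h ord_max).2) /\
  ((tnth h ord_max).1 -> (play_step (h, v)).1).
Proof.
rewrite /play_step /=; case: ifPn => //= _; split => //.
by rewrite /step; do 4 (case: ifP => //= _).
Qed.

Definition half (b : bool) (q : R) (i : 'I_n) (x : E) : bool :=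
  if b then x 0 i < q else q < x 0 i.

(* The game never leaves an exited state, and never moves the token on exit. These
   countably many null events contain all violations, rational half-spaces
   detecting [x_(j+1) <> x_j]. *)
Definition sep_event (k : option (nat * option ('I_n * rat * bool))) : set play :=
  match k with
  | None => [set w : play | (w 0%N).1]
  | Some (j, None) => [set w : play | (w j).1 /\ ~~ (w j.+1).1]
  | Some (j, Some (i, q, b)) => [set w : play | half b (ratr q) i (w j).2 /\
      ((w j.+1).1 /\ half (~~ b) (ratr q) i (w j.+1).2)]
  end.

Lemma measurable_half (b : bool) (q : R) (i : 'I_n) :
  measurable [set s : state | half b q i s.2].
Proof.
have m : measurable_fun setT (fun s : state => s.2 0 i).
  exact: (measurable_coord i measurable_snd).
rewrite /half; case: b; rewrite -[X in measurable X]setTI.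
  rewrite (_ : [set _ | _] = (fun s : state => s.2 0 i) @^-1` `]-oo, q[); first exact: m.
  by apply/seteqP; split => s /=; rewrite in_itv.
rewrite (_ : [set _ | _] = (fun s : state => s.2 0 i) @^-1` `]q, +oo[); first exact: m.
by apply/seteqP; split => s /=; rewrite in_itv/= andbT.
Qed.

Lemma measurable_exited : measurable [set s : state | s.1].
Proof.
rewrite (_ : [set _ | _] = (fst : state -> bool) @^-1` [set true]).
  by rewrite -[X in measurable X]setTI; exact: measurable_fst.
by apply/seteqP; split => s /= ->.
Qed.

Lemma sep_event_null (P : probability play R) k : init_law P -> (forall j, law_step P j) ->
  measurable (sep_event k) /\ P (sep_event k) = 0%E.
Proof.
move=> P0 PS; have mx := measurable_exited.
have mnx : measurable [set s : state | ~~ s.1].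
  rewrite (_ : [set _ | _] = ~` [set s : state | s.1]); first exact: measurableC.
  by apply/seteqP; split => s /= /negP.
have mw j (B : set state) : measurable B -> measurable [set w : play | B (w j)].
  by move=> mB; rewrite -[X in measurable X]setTI; exact: (@measurable_coord_play j).
have ml j (B : set state) : measurable B ->
    measurable [set h : history j | B (tnth h ord_max)].
  by move=> mB; rewrite -[X in measurable X]setTI; exact: (measurable_tnth ord_max).
have Pl j : P [set w | legal (past j w)] = 1%E.
  by apply: (legal_full (N := j)).
have null j (B C : set state) : measurable B -> measurable C ->
    (forall h v, B (tnth h ord_max) -> ~ C (play_step (j := j) (h, v))) ->
    measurable [set w : play | B (w j) /\ C (w j.+1)] /\ P [set w | B (w j) /\ C (w j.+1)] = 0%E.
  move=> mB mC BC; split; first by apply: measurableI; exact: mw.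
  have := @law_null P j [set h | B (tnth h ord_max)] C (PS j) (Pl j) (ml _ _ mB) mC BC.
  by congr (P _ = _); apply/seteqP; split => w /=; rewrite past_last.
case: k => [[j [[[i q] b]|]]|] /=.
- pose B : set state := [set s : state | half b (ratr q) i s.2].
  pose C : set state := [set s : state | s.1 /\ half (~~ b) (ratr q) i s.2].
  have mB : measurable B by exact: measurable_half.
  have mC : measurable C by apply: measurableI => //; exact: measurable_half.
  apply: (null j B C mB mC) => h v; rewrite /B /C /= => h1 [c].
  have [/(_ c) -> _] := play_step_stop h v.
  by move: h1; rewrite /half; case: b {B C mB mC} => h1; apply/negP; rewrite -leNgt ltW.
- apply: (null j _ _ mx mnx) => h v /= h1.
  by have [_ /(_ h1) ->] := play_step_stop h v.
split; first exact: (mw 0%N _ mx).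
by rewrite (P0 [set s : state | s.1])// diracE memNset.
Qed.

Lemma absorption (P : probability play R) : init_law P -> (forall j, law_step P j) ->
  exists Z : set play, [/\ measurable Z, P Z = 1%E & forall w, Z w -> ~~ (w 0%N).1 /\
    forall j, ((w j.+1).1 -> (w j.+1).2 = (w j).2) /\ ((w j).1 -> (w j.+1).1)].
Proof.
move=> P0 PS.
pose G k := if unpickle k is Some e then sep_event e else set0.
have mG k : measurable (G k).
  by rewrite /G; case: unpickle => // e; exact: (sep_event_null e P0 PS).1.
have G0 k : P (G k) = 0%E.
  rewrite /G; case: unpickle => [e|]; last exact: measure0.
  exact: (sep_event_null e P0 PS).2.
have mU : measurable (\bigcup_k G k) by exact: bigcup_measurable.
exists (~` \bigcup_k G k); split; first exact: measurableC.
  have nU : P.-negligible (\bigcup_k G k).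
    by apply: negligible_bigcup => k; exists (G k); split; [exact: mG|exact: G0|exact: subset_refl].
  by rewrite probability_setC// (measure_negligible mU nU) sube0.
move=> w Zw.
have nG e : ~ sep_event e w.
  by move=> ew; apply: Zw; exists (pickle e) => //; rewrite /G pickleK.
split; first by apply/negP => w0; exact: (nG None).
move=> j; split => [c|c]; last first.
  by apply: contrapT => /negP c'; apply: (nG (Some (j, None))).
apply/rowP => i; apply/eqP/negP => /negP; rewrite neq_lt => /orP[] /rat_in_itvoo[q];
  rewrite in_itv/= => /andP[h1 h2].
- by apply: (nG (Some (j, Some (i, q, false)))).
- by apply: (nG (Some (j, Some (i, q, true)))).
Qed.

(** * The payoff as a bounded measurable function *)

Section payoff.
Hypothesis F_cont : {within Gamma eps Omega, continuous F}.
Local Notation FG := (F \_ (Gamma eps Omega)).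

Lemma bmeas_FG : bmeas (FG : E -> R).
Proof.
split; first exact: (within_patch_measurable (@Gamma_closed _ _ _ _) F_cont).
have [M M0 FM] := F_bounded eps0 n2 Omega_neq0 Omega_open Omega_bounded F_cont.
exists M => x; rewrite patchE; case: ifPn => [/set_mem/FM//|_].
by rewrite normr0 ltW.
Qed.

(** Payoff of an exit seen within [k] turns from time [j] on. Along each play these are eventually
    constant in [k], so [payoff] is a pointwise limit of measurable functions. *)
Fixpoint payoff_within k j (w : play) : R :=
  if k is k'.+1 then if (w j.+1).1 then FG (w j).2 else payoff_within k' j.+1 w else 0.

Lemma measurable_payoff_within k j : measurable_fun setT (payoff_within k j).
Proof.
elim: k j => [|k IH] j /=; first exact: measurable_cst.
apply: measurable_fun_ifT => //.
  exact: (measurableT_comp measurable_fst (@measurable_coord_play j.+1)).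
apply: (measurableT_comp bmeas_FG.1).
exact: (measurableT_comp measurable_snd (@measurable_coord_play j)).
Qed.

Lemma payoff_withinE w k j m : (forall i, (i < m)%N -> ~~ (w i.+1).1) -> (w m.+1).1 ->
  (j <= m < j + k)%N -> payoff_within k j w = FG (w m).2.
Proof.
move=> wi wm; elim: k j => [|k IH] j; first by rewrite addn0 ltnNge andbN.
rewrite /= => /andP[jm mk]; have [jm'|jm'] := eqVneq j m; first by rewrite jm' wm.
have jm1 : (j < m)%N by rewrite ltn_neqAle jm'.
by rewrite (negbTE (wi _ jm1)) IH// jm1 addSnnS.
Qed.

Lemma exit_timeP (w : play) : match exit_time w with
  | Some m => (w m.+1).1 /\ forall i, (i < m)%N -> ~~ (w i.+1).1
  | None => forall j, ~~ (w j.+1).1 end.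
Proof.
rewrite /exit_time; case: pselect => [e|ne].
  case: ex_minnP => m wm mmin; split => // i im; apply/negP => /mmin.
  by rewrite leqNgt im.
by move=> j; apply/negP => wj; apply: ne; exists j.
Qed.

Lemma bmeas_payoff : bmeas (payoff eps Omega F : play -> R).
Proof.
have [_ [M FM]] := bmeas_FG; split; last first.
  exists M => w; rewrite /payoff; case: exit_time => [m|]; first exact: FM.
  by rewrite normr0; apply: le_trans (FM 0).
apply: (@measurable_fun_cvg _ _ _ _ (fun k => payoff_within k 0)).
  by move=> k; exact: measurable_payoff_within.
move=> w _; rewrite /payoff; have := exit_timeP w.
case: exit_time => [m [wm wi]|nw].
  apply: cvg_near_cst; exists m.+1 => // k mk.
  by rewrite /= (payoff_withinE wi wm).
rewrite (_ : (fun k => _) = fun=> 0); first exact: cvg_cst.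
apply/funext => k; elim: k 0%N => //= k IH j.
by rewrite (negbTE (nw j)) IH.
Qed.

(** [payoff] reads the position just before the flag is raised, while the estimates see the exited
    state. On an absorbed play these agree: the token does not move at the exit or afterwards. *)
Lemma payoff_exit (w : play) : ~~ (w 0%N).1 ->
  (forall j, ((w j.+1).1 -> (w j.+1).2 = (w j).2) /\ ((w j).1 -> (w j.+1).1)) ->
  forall j, (w j).1 -> payoff eps Omega F w = FG (w j).2.
Proof.
move=> w0 ws j wj; rewrite /payoff; have := exit_timeP w.
case: exit_time => [m [wm wi]|nw]; last first.
  by case: j wj => [|j] wj; [rewrite wj in w0|have := nw j; rewrite wj].
have mj : (m < j)%N.
  rewrite ltnNge; apply/negP => jm; case: j wj jm => [|j] wj jm; first by rewrite wj in w0.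
  by have := wi j jm; rewrite wj.
suff [_ e] : (w (m.+1 + (j - m.+1))%N).1 /\ (w (m.+1 + (j - m.+1))%N).2 = (w m).2.
  by rewrite -e subnKC.
elim: (j - m.+1)%N => [|k [IH1 IH2]]; first by rewrite addn0 ((ws m).1 wm).
rewrite addnS; have c := (ws _).2 IH1; split => //.
by rewrite ((ws _).1 c).
Qed.

(** Serves both players: [h] is the payoff or its opposite. The submartingale is evaluated at a
    finite time [k], where it differs from [h] only on plays still alive. *)
Lemma expected_payoff_ge (P : probability play R) (h : play -> R) (psi phi : E -> R) :
  init_law P -> (forall j, law_step P j) -> bmeas h -> bmeas psi -> bmeas phi ->
  (forall w, ~~ (w 0%N).1 ->
    (forall j, ((w j.+1).1 -> (w j.+1).2 = (w j).2) /\ ((w j).1 -> (w j.+1).1)) ->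
    forall j, (w j).1 -> h w = psi (w j).2) ->
  (exists (g : E -> R) (A : R), [/\ bmeas g, 1 < A,
    forall x, closure (Omega_eps eps Omega) x -> 1 <= g x <= A &
    forall x nu, Omega x -> enorm nu = eps -> Wb eps p g x nu <= g x - 1]) ->
  (forall x, Omega_eps eps Omega x -> ~ Omega x -> phi x <= psi x) ->
  (forall j (h : history j), legal h -> let x := (tnth h ord_max).2 in Omega x ->
     phi x <= delta x * psi x + (1 - delta x) / 2 *
       (Wb eps p phi x (S1 h) + Wb eps p phi x (S2 h))) ->
  phi x0 <= \int[P]_w h w.
Proof.
move=> P0 PS bh bpsi bphi hpsi [g [A [bg A1 gA Wg]]] out inn.
have [Z [mZ PZ Zw]] := absorption P0 PS.
have [_ [M hM]] := bh; have [_ [N phiN]] := bphi.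
have A0 : 0 < A by exact: lt_trans A1.
have q01 : 0 <= 1 - A^-1 < 1.
  by rewrite subr_ge0 invf_le1// (ltW A1)/= ltrBlDr ltrDl invr_gt0.
have MN0 : 0 <= M + N.
  apply: addr_ge0; first exact: le_trans (hM (fun=> (false, x0))).
  exact: le_trans (phiN x0).
apply/ler_addgt0Pr => e e0.
have [k kP] := geometric_small ((M + N) * A) q01 e0.
have sub := submartingale P0 (fun j _ => PS j) (fun=> bphi) bpsi (fun=> out) inn (N := k).
apply: le_trans sub _.
pose I (w : play) : R := (~~ (w k).1)%:R.
have bI : bmeas I.
  apply: (bmeas_coord_play k (f := fun s => (~~ s.1)%:R)).
  have bc0 : bmeas (cst 0 : E -> R) by exact: bmeas_cst.
  have bc1 : bmeas (cst 1 : E -> R) by exact: bmeas_cst.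
  have := bmeas_if bc0 bc1; congr bmeas.
  by apply/funext => s; case: s.1.
(* On live plays the two functions differ by at most [M + N], and [k] was chosen to make this error
   less than [e] in mean. *)
apply: (@le_trans _ _ (\int[P]_w (h w + (M + N) * I w))).
  apply: (le_mean_ae _ _ mZ PZ).
  - exact: (bmeas_coord_play k (bmeas_if bpsi bphi)).
  - by apply: bmeasD => //; exact: bmeasZ.
  move=> w /Zw[w0 ws]; rewrite /I; case: (boolP (w k).1) => c /=.
    by rewrite mulr0 addr0 (hpsi w w0 ws k c).
  rewrite mulr1; have := hM w; have := phiN (w k).2; rewrite !ler_norml.
  by move=> /andP[? ?] /andP[? ?]; lra.
rewrite meanD//; last exact: bmeasZ.
rewrite lerD2l meanZ//; apply: le_trans (ltW kP).
rewrite -mulrA ler_wpM2l//; apply: (alive_bound bg A1 gA Wg P0) => j _; exact: PS.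
Qed.

End payoff.

(** * Stopped games and the construction of a law *)

(** The new state is written at all times after [k], so the image is again a complete play, constant
    from [k.+1] on. *)
Definition stepmap k (wv : play * (RR * n.-1.-tuple RR)) : play :=
  fun i => if (i <= k)%N then wv.1 i else play_step (past k wv.1, wv.2).

Lemma measurable_stepmap k : measurable_fun setT (stepmap k).
Proof.
apply: measurable_fun_play => i; rewrite /stepmap; case: (boolP (i <= k)%N) => _.
  exact: (measurableT_comp (@measurable_coord_play i) measurable_fst).
exact: measurable_past_step.
Qed.

Definition stepfun k : {mfun (play * (RR * n.-1.-tuple RR))%type >-> play} :=
  HB.pack (stepmap k) (isMeasurableFun.Build _ _ _ _ _ (@measurable_stepmap k)).

(* Law of the game stopped after [k] turns, the play being constant from then on. *)
Fixpoint stopped_law k : probability play R :=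
  if k is k'.+1
  then distribution ((stopped_law k' \x noise eps)%E : probability _ R) (stepfun k')
  else \d_((fun=> (false, x0)) : play).
Local Notation Q := stopped_law.

Lemma stopped_lawS k B : Q k.+1 B = (Q k \x noise eps)%E (stepmap k @^-1` B).
Proof. by []. Qed.

Lemma past_stepmap k i wv : (i <= k)%N -> past i (stepmap k wv) = past i wv.1.
Proof.
move=> ik; apply: eq_from_tnth => l; rewrite !tnth_mktuple /stepmap.
by rewrite (leq_trans _ ik)// -ltnS.
Qed.

Lemma prod_noise_fst (P : probability play R) (B : set play) : measurable B ->
  (P \x @noise R n eps)%E (fst @^-1` B) = P B.
Proof.
move=> mB; rewrite (_ : _ @^-1` _ = B `*` setT); last first.
  by apply/seteqP; split => -[w v] //= [].
apply: etrans (product_measure1E P (noise eps) mB measurableT) _.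
by rewrite [X in (_ * X)%E](_ : _ = 1%E) ?mule1//; exact: probability_setT.
Qed.

Lemma stopped_law_stable k (B : set play) : measurable B ->
  (forall wv, B (stepmap k wv) <-> B wv.1) -> Q k.+1 B = Q k B.
Proof.
move=> mB Bk; rewrite stopped_lawS -(prod_noise_fst _ mB); congr (_ _).
by apply/seteqP; split => wv /= /Bk.
Qed.

Lemma measurable_past_set j (A : set (history j)) : measurable A ->
  measurable [set w : play | A (past j w)].
Proof. by move=> mA; rewrite -[X in measurable X]setTI; exact: (@measurable_past j). Qed.

Lemma stopped_law_past k j (A : set (history j)) : measurable A -> (j <= k)%N ->
  Q k [set w | A (past j w)] = Q j [set w | A (past j w)].
Proof.
move=> mA jk; rewrite -(subnK jk); elim: (k - j)%N => // i IH.
rewrite addSn -IH; apply: stopped_law_stable; first exact: measurable_past_set.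
by move=> wv /=; rewrite past_stepmap// leq_addl.
Qed.

(** By Fubini the left side is the mean of a function of the past, so only the law of the past
    matters. This moves the one-turn rule from one stopped law to another and to the limit. *)
Lemma prod_noise_law (P P' : probability play R) j (C : set (history j * (RR * n.-1.-tuple RR))) :
  measurable C -> (forall A : set (history j), measurable A ->
    P [set w | A (past j w)] = P' [set w | A (past j w)]) ->
  (P \x noise eps)%E [set wv | C (past j wv.1, wv.2)] =
  (P' \x noise eps)%E [set wv | C (past j wv.1, wv.2)].
Proof.
move=> mC PP'.
have bC : bmeas (\1_C : _ -> R) by exact: bmeas_indic.
have mphi : measurable_fun setT
    (fun wv : play * (RR * n.-1.-tuple RR) => (past j wv.1, wv.2)).
  by apply: measurable_fun_pair => //; exact: (measurableT_comp (@measurable_past j) measurable_fst).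
have mD : measurable [set wv : play * (RR * n.-1.-tuple RR) | C (past j wv.1, wv.2)].
  by rewrite -[X in measurable X]setTI; exact: mphi.
have E1 (P0 : probability play R) : (P0 \x noise eps)%E [set wv | C (past j wv.1, wv.2)] =
    (\int[P0]_w \int[noise eps]_v \1_C (past j w, v))%:E.
  rewrite -(@mean_prod _ _ _ _ _ P0 (noise eps) (\1_C \o (fun wv => (past j wv.1, wv.2)))).
    by rewrite -(@mean_indic _ _ _ ((P0 \x noise eps)%E : probability _ R) _ mD).
  exact: (bmeas_comp mphi bC).
rewrite !E1; congr EFin.
have bf : bmeas (fun h : history j => \int[noise eps]_v \1_C (h, v)).
  exact: (@bmeas_fubini _ _ _ _ _ (distribution P (HB.pack_for {mfun play >-> history j}
    (@past R n j) (isMeasurableFun.Build _ _ _ _ _ (@measurable_past j)))) (noise eps) _ bC).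
exact: (mean_law (@measurable_past j) (@measurable_past j) PP' bf).
Qed.

Lemma measurable_step_set j (A : set (history j)) (B : set state) :
  measurable A -> measurable B ->
  measurable [set hv : history j * (RR * n.-1.-tuple RR) | A hv.1 /\ B (play_step hv)].
Proof.
move=> mA mB; apply: measurableI; rewrite -[X in measurable X]setTI.
  exact: measurable_fst.
exact: (@measurable_play_step j).
Qed.

Lemma stopped_law_init k : init_law (Q k).
Proof.
move=> B mB; elim: k => [|k IH]; first by rewrite /= !diracE.
rewrite -IH; apply: stopped_law_stable => //.
by rewrite -[X in measurable X]setTI; exact: (@measurable_coord_play 0%N).
Qed.

Lemma stopped_law_step k j : (j < k)%N -> law_step (Q k) j.
Proof.
elim: k => // k IH; rewrite ltnS leq_eqVlt => jk A B mA Al mB.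
have mE : measurable [set w : play | A (past j w) /\ B (w j.+1)].
  apply: measurableI; first exact: measurable_past_set.
  by rewrite -[X in measurable X]setTI; exact: (@measurable_coord_play j.+1).
transitivity ((Q k \x noise eps)%E
    [set wv | A (past j wv.1) /\ B (play_step (past j wv.1, wv.2))]); last first.
  apply: (@prod_noise_law _ _ j [set hv | A hv.1 /\ B (play_step hv)]).
    exact: measurable_step_set.
  move=> A' mA'; apply/esym/stopped_law_stable; first exact: measurable_past_set.
  move=> wv /=; rewrite past_stepmap//.
  by case/predU1P: jk => [-> //|/ltnW].
(* An earlier turn is not altered by [stepmap k]; the last one is the turn that it appends. *)
case/predU1P: jk => [jk|jk]; last first.
  rewrite -IH//; apply: stopped_law_stable => // wv /=.
  by rewrite past_stepmap ?(ltnW jk)// /stepmap jk.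
rewrite -{k}jk in IH *; rewrite stopped_lawS; congr (_ _).
by apply/seteqP; split => wv /=; rewrite past_stepmap// /stepmap ltnn.
Qed.

Section limit_law.
Variables (g : E -> R) (A : R).
Hypotheses (bg : bmeas g) (A1 : 1 < A)
  (gA : forall x, closure (Omega_eps eps Omega) x -> 1 <= g x <= A).
Hypothesis Wg : forall x nu, Omega x -> enorm nu = eps -> Wb eps p g x nu <= g x - 1.

Definition exited k : set play := [set w : play | (w k).1].

Lemma measurable_exited_at k : measurable (exited k).
Proof.
rewrite -[X in measurable X]setTI.
exact: (@measurable_coord_play k measurableT _ measurable_exited).
Qed.

Lemma measurable_exit_at k : measurable (exited k.+1 `\` exited k).
Proof. by apply: measurableD; exact: measurable_exited_at. Qed.

(* Exited plays are frozen, so the law of the plays that have exited by time [k]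
   increases with [k]; its limit is the law of the whole game because the game
   ends almost surely. *)
Definition limit_law : set play -> \bar R :=
  mseries (fun k => mrestr (Q k.+1) (measurable_exit_at k)) 0.

Definition frozen k (w : play) : play := fun i => if (i <= k)%N then w i else w k.

Lemma stopped_law_frozen k (B : set play) : Q k [set w | B (frozen k w)] = Q k B.
Proof.
case: k => [|k].
  rewrite /= !diracE; congr ((nat_of_bool _)%:R%:E).
  have fz : frozen 0 (fun=> (false, x0)) = (fun=> (false, x0)).
    by apply/funext => i; rewrite /frozen if_same.
  by apply/idP/idP => /set_mem /= Bw; apply/mem_set => /=; rewrite fz in Bw *.
rewrite !stopped_lawS; congr (_ _); apply/seteqP; split => wv /=;
  rewrite (_ : frozen k.+1 (stepmap k wv) = stepmap k wv)//; apply/funext => i;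
  by rewrite /frozen; case: leqP => // ki; rewrite /stepmap ltnn leqNgt (ltnW ki).
Qed.

(** On an exited play a further turn only repeats the last state, so [stepmap k] acts as [frozen k],
    which the law stopped at [k] does not see. *)
Lemma stopped_law_exited k (B : set play) : measurable B ->
  Q k.+1 (B `&` exited k.+1 `&` exited k) = Q k (B `&` exited k).
Proof.
move=> mB; have mBk : measurable (B `&` exited k).
  by apply: measurableI => //; exact: measurable_exited_at.
have mfz : measurable [set w | (B `&` exited k) (frozen k w)].
  rewrite -[X in measurable X]setTI; apply: measurable_fun_play => // i.
  rewrite /frozen; case: (i <= k)%N; exact: measurable_coord_play.
rewrite -(stopped_law_frozen k (B `&` exited k)) stopped_lawS -(prod_noise_fst _ mfz).
have fz (wv : play * (RR * n.-1.-tuple RR)) : (wv.1 k).1 -> stepmap k wv = frozen k wv.1.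
  move=> c; apply/funext => i; rewrite /stepmap /frozen; case: ifPn => // _.
  by rewrite /play_step /= past_last c [RHS]surjective_pairing c.
congr (_ _); apply/seteqP; split => wv /=; rewrite /exited /=.
  move=> [[Bw _]]; rewrite {1}/stepmap leqnn => c.
  by rewrite -fz// {2}/stepmap leqnn.
rewrite {2}/frozen leqnn => -[Bw c]; rewrite fz//; split; last first.
  by rewrite /frozen leqnn.
by split => //; rewrite /frozen ltnn.
Qed.

Lemma stopped_law_sum N (B : set play) : measurable B ->
  (\sum_(0 <= k < N) Q k.+1 (B `&` (exited k.+1 `\` exited k)) = Q N (B `&` exited N))%E.
Proof.
move=> mB; elim: N => [|N IH].
  rewrite big_geq// /= diracE memNset//= => -[_].
  by rewrite /exited.
rewrite big_nat_recr//= -/(Q _) IH -stopped_law_exited//.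
have mN := measurable_exited_at N; have mN1 := measurable_exited_at N.+1.
rewrite -[LHS]/((Q N.+1 (B `&` exited N.+1 `&` exited N) +
  Q N.+1 (B `&` (exited N.+1 `\` exited N)))%E).
rewrite -measureU.
- by rewrite setIDA setDE -setIUr setUv setIT.
- by apply: measurableI => //; exact: measurableI.
- by apply: measurableI => //; exact: measurableD.
- by apply/seteqP; split => w //= [[[_ _] c] [_ [_ nc]]]; exact: nc.
Qed.

(** The mass lost by requiring an exit before [N] is at most the probability of being alive at [N],
    which decays geometrically. *)
Lemma stopped_law_cvg (B : set play) N0 : measurable B ->
  (forall N, (N0 <= N)%N -> Q N B = Q N0 B) ->
  (fun N => Q N (B `&` exited N)) @ \oo --> Q N0 B.
Proof.
move=> mB QB; pose a := \int[Q N0]_w (\1_B w : R).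
have Qm N (C : set play) : measurable C -> Q N C = (\int[Q N]_w (\1_C w : R))%:E.
  by move=> mC; rewrite mean_indic.
have mBN N : measurable (B `&` exited N).
  by apply: measurableI => //; exact: measurable_exited_at.
rewrite (Qm _ _ mB) -/a.
under eq_fun do rewrite Qm//.
apply: cvg_EFin; first by apply: nearW.
apply/cvgrPdist_lt => e e0.
have A0 : 0 < A by exact: lt_trans A1.
have q01 : 0 <= 1 - A^-1 < 1.
  by rewrite subr_ge0 invf_le1// (ltW A1)/= ltrBlDr ltrDl invr_gt0.
have [k kP] := geometric_small A q01 e0.
exists (maxn N0 k) => // N; rewrite /= geq_max => /andP[N0N kN].
have aN : a = \int[Q N]_w (\1_B w : R) by apply: EFin_inj; rewrite -!Qm// QB.
have h1 : \int[Q N]_w (\1_(B `&` exited N) w : R) <= a.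
  rewrite aN; apply: le_mean; [exact: bmeas_indic|exact: bmeas_indic|].
  by move=> w; rewrite indicI /= mulrC ler_piMl// indicE; case: (_ \in _).
have h2 : a <= \int[Q N]_w (\1_(B `&` exited N) w : R) + \int[Q N]_w (~~ (w N).1)%:R.
  have bI : bmeas (fun w : play => (~~ (w N).1)%:R : R).
    apply: (bmeas_coord_play N (f := fun s => (~~ s.1)%:R)).
    have bc0 : bmeas (cst 0 : E -> R) by exact: bmeas_cst.
    have bc1 : bmeas (cst 1 : E -> R) by exact: bmeas_cst.
    have := bmeas_if bc0 bc1; congr bmeas.
    by apply/funext => s; case: s.1.
  rewrite aN -meanD//; last exact: bmeas_indic.
  apply: le_mean; [exact: bmeas_indic|by apply: bmeasD => //; exact: bmeas_indic|].
  move=> w; rewrite indicI /=; case: (boolP (w N).1) => c.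
    by rewrite [\1_(exited N) w]indicE mem_set// mulr1 addr0.
  by rewrite [\1_(exited N) w]indicE memNset ?mulr0 ?add0r ?indicE; [case: (_ \in _)|apply/negP].
have h3 := alive_bound bg A1 gA Wg (@stopped_law_init N) (@stopped_law_step N).
have h4 : A * (1 - A^-1) ^+ N <= A * (1 - A^-1) ^+ k.
  rewrite ler_pM2l// ler_wiXn2l//; have /andP[? /ltW ?] := q01; by [].
by rewrite ger0_norm ?subr_ge0//; lra.
Qed.

(** Applies to events whose stopped probabilities stabilise: those about a finite past, and the
    whole space, which gives total mass 1. *)
Lemma limit_lawE (B : set play) N0 : measurable B ->
  (forall N, (N0 <= N)%N -> Q N B = Q N0 B) -> limit_law B = Q N0 B.
Proof.
move=> mB QB; have := stopped_law_cvg mB QB.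
under eq_fun do rewrite -stopped_law_sum//.
by move=> /cvg_lim <-.
Qed.

HB.instance Definition _ := Measure.copy limit_law
  (mseries (fun k => mrestr (Q k.+1) (measurable_exit_at k)) 0).

Lemma limit_law_setT : limit_law setT = 1%E.
Proof.
rewrite (limit_lawE (N0 := 0%N)) ?probability_setT// => N _.
by rewrite !probability_setT.
Qed.

HB.instance Definition _ := Measure_isProbability.Build _ _ _ limit_law limit_law_setT.

Lemma limit_law_past j (C : set (history j)) : measurable C ->
  limit_law [set w | C (past j w)] = Q j [set w | C (past j w)].
Proof.
move=> mC; apply: limit_lawE => [|N jN]; first exact: measurable_past_set.
exact: stopped_law_past.
Qed.

Lemma limit_law_is_law : is_law eps Omega p x0 S1 S2 (limit_law : probability play R).
Proof.
split=> [B mB|j C B mC Cl mB].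
  apply: etrans (limit_lawE (N0 := 0%N) _ _) (stopped_law_init 0 mB).
    by rewrite -[X in measurable X]setTI; exact: (@measurable_coord_play 0%N).
  by move=> N _; rewrite !stopped_law_init.
rewrite integral_transition//.
have mE : measurable [set w : play | C (past j w) /\ B (w j.+1)].
  apply: measurableI; first exact: measurable_past_set.
  by rewrite -[X in measurable X]setTI; exact: (@measurable_coord_play j.+1).
transitivity (Q j.+1 [set w : play | C (past j w) /\ B (w j.+1)]).
  apply: limit_lawE => // N jN.
  (* The event concerns times up to [j.+1]; it is rewritten as an event on that longer past, which
     later turns leave alone. *)
  pose C' : set (history j.+1) := [set h | C [tuple tnth h (widen_ord (leqnSn _) i) | i < j.+1] /\
    B (tnth h ord_max)].
  have EC : [set w : play | C (past j w) /\ B (w j.+1)] = [set w | C' (past j.+1 w)].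
    have pj w : [tuple tnth (past j.+1 w) (widen_ord (leqnSn _) i) | i < j.+1] = past j w.
      by apply: eq_from_tnth => i; rewrite !tnth_mktuple.
    by apply/seteqP; split => w; rewrite /C' /= pj tnth_mktuple.
  rewrite EC; apply: stopped_law_past => //.
  apply: measurableI; rewrite -[X in measurable X]setTI; last exact: (measurable_tnth ord_max).
  have mt : measurable_fun setT
    (fun h : history j.+1 => [tuple tnth h (widen_ord (leqnSn _) i) | i < j.+1]).
    apply/measurable_fun_tnthP => i; rewrite (_ : _ \o _ = (fun h => tnth h (widen_ord (leqnSn _) i))).
      exact: measurable_tnth.
    by apply/funext => h /=; rewrite tnth_mktuple.
  exact: mt.
rewrite stopped_law_step//.
apply: (@prod_noise_law _ _ j [set hv | C hv.1 /\ B (play_step hv)]).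
  exact: measurable_step_set.
move=> C' mC'; rewrite [RHS]limit_law_past//.
exact: stopped_law_past.
Qed.

End limit_law.

End plays.

(** * The value of the game *)

Section selection.
Context {R : realType} {n : nat}.
Local Notation E := (borelRn R n).
Implicit Types x y nu : 'rV[R]_n.

Definition cell (h : R) x : 'rV[int]_n := \row_i Num.floor (x 0 i / h).

Lemma cell_near (h : R) x y : 0 < h -> cell h x = cell h y -> enorm (y - x) <= n%:R * h.
Proof.
move=> h0 /rowP xy; apply: enorm_le_coord => i; rewrite !mxE.
have := xy i; rewrite !mxE => fxy.
have := floor_itv (x 0 i / h); have := floor_itv (y 0 i / h); rewrite fxy !intrD.
rewrite !ler_pdivlMr// !ltr_pdivrMr// !mulrDl mul1r => /andP[? ?] /andP[? ?].
by rewrite ler_norml; apply/andP; split; lra.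
Qed.

Lemma measurable_cell (h : R) (z : 'rV[int]_n) : 0 < h ->
  measurable ([set x | cell h x = z] : set E).
Proof.
move=> h0.
have -> : [set x | cell h x = z] = \bigcap_(i in [set: 'I_n])
    ((fun x => x 0 i / h) @^-1` `[(z 0 i)%:~R, (z 0 i + 1)%:~R[).
  apply/seteqP; split => x /= xz.
    move=> i _ /=; rewrite in_itv/= -floor_ge_int -floor_lt_int.
    by rewrite -xz mxE lexx ltrDl ltr01.
  apply/rowP => i; have := xz i Logic.I; rewrite /= in_itv/= -floor_ge_int -floor_lt_int.
  by rewrite mxE ltzD1 => /andP[h1 h2]; apply/eqP; rewrite eq_le h1 h2.
apply: fin_bigcap_measurable => // i _; rewrite -[X in measurable X]setTI.
have m : measurable_fun setT (fun x : E => x 0 i / h).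
  by apply: measurable_funM => //; exact: coord_measurable.
exact: m.
Qed.

(** There are countably many cells, so a choice constant on cells is measurable. A direction optimal
    up to [e] at one point of the cell loses two more [e] when carried to [x], one for each of the
    two directions compared. *)
Lemma measurable_selection (D S : set 'rV[R]_n) (V : 'rV[R]_n -> 'rV[R]_n -> R) (M e : R) :
  S !=set0 -> 0 < e -> (forall x nu, D x -> S nu -> `|V x nu| <= M) ->
  (exists2 d : R, 0 < d & forall x y, D x -> D y -> enorm (y - x) < d ->
    forall nu, S nu -> `|V y nu - V x nu| <= e) ->
  exists s : E -> E, [/\ measurable_fun setT s, forall x, S (s x) &
    forall x nu, D x -> S nu -> V x nu <= V x (s x) + 3 * e].
Proof.
move=> [nu0 Snu0] e0 VM [d d0 Vd].
(* Two points of a cell are within [n%:R * h < d] of each other. *)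
pose h := d / n.+1%:R; have h0 : 0 < h by rewrite divr_gt0.
have near_opt y : D y -> exists2 nu, S nu & forall nu', S nu' -> V y nu' <= V y nu + e.
  move=> Dy; pose L := [set V y nu | nu in S].
  have hL : has_sup L.
    split; first by exists (V y nu0); exists nu0.
    by exists M => _ [nu Snu <-]; rewrite (le_trans (ler_norm _))// VM.
  have [_ [nu Snu <-] lt] := sup_adherent e0 hL.
  exists nu => // nu' Snu'; rewrite -lerBlDr; apply: ltW; apply: le_lt_trans lt.
  by rewrite lerD2r; apply: sup_upper_bound => //; exists nu'.
have /choice[s sP] (z : 'rV[int]_n) : exists nu, S nu /\
    ((exists2 y, D y & cell h y = z) -> exists y, [/\ D y, cell h y = z &
      forall nu', S nu' -> V y nu' <= V y nu + e]).
  have [[y Dy yz]|ny] := pselect (exists2 y, D y & cell h y = z); last by exists nu0.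
  have [nu Snu nuP] := near_opt y Dy; exists nu; split => // _.
  by exists y; split.
exists (s \o cell h); split => [|x|x nu Dx Snu] /=; last 2 first.
- exact: (sP _).1.
- have [y [Dy yz yP]] := (sP (cell h x)).2 (ex_intro2 _ _ x Dx erefl).
  have xy : enorm (y - x) < d.
    apply: le_lt_trans (cell_near h0 (esym yz)) _.
    by rewrite /h mulrA ltr_pdivrMr// mulrC ltr_pM2l// ltr_nat.
  have := Vd x y Dx Dy xy nu Snu; have := Vd x y Dx Dy xy _ (sP (cell h x)).1.
  have := yP nu Snu; rewrite !ler_norml.
  by move=> ? /andP[? ?] /andP[? ?]; lra.
move=> _ B mB; rewrite setTI.
have -> : (s \o cell h) @^-1` B = \bigcup_(z in [set z | B (s z)]) [set x | cell h x = z].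
  apply/seteqP; split => [x Bx|x [z Bz /= xz]]; first by exists (cell h x).
  by rewrite /= xz.
rewrite bigcup_mkcond; apply: countable_bigcupT_measurable => // z.
by case: ifPn => // _; exact: measurable_cell.
Qed.

End selection.

(** * Both values equal the fixed point *)

Section value.
Context {R : realType} {n : nat}.
Variables (eps : R) (Omega : set 'rV[R]_n) (p F : 'rV[R]_n -> R) (P : R).
Hypotheses (eps0 : 0 < eps) (n2 : (2 <= n)%N) (Omega_neq0 : Omega !=set0)
  (Omega_open : open Omega) (Omega_bounded : bounded_set Omega).
Hypotheses (p_gt1 : forall x, Omega x -> 1 < p x) (p_le : forall x, Omega x -> p x <= P).
Hypotheses (p_cont : {within closure Omega, continuous p})
  (F_cont : {within Gamma eps Omega, continuous F}).
Local Notation K := (closure (Omega_eps eps Omega)).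
Local Notation E := (borelRn R n).
Local Notation W := (W eps p).
Local Notation Wb := (Wb eps p).
Local Notation T := (T eps Omega p F).
Local Notation delta := (delta eps Omega).
Local Notation strategy := (@strategy R n eps Omega).
Variable u : 'rV[R]_n -> R.
Hypotheses (uK : {within K, continuous u}) (uT : forall x, K x -> u x = T u x).
Variable x0 : 'rV[R]_n.
Hypothesis Ox0 : Omega x0.

Let n_gt0 : (0 < n)%N. Proof. exact: ltn_trans n2. Qed.
Let cK : compact K. Proof. exact: K_compact. Qed.

Definition markov (s : E -> E) j (h : j.+1.-tuple (gstate R n)) : 'rV[R]_n :=
  s (tnth h ord_max).2.

Lemma markov_strategy (s : E -> E) : measurable_fun setT s ->
  (forall x, enorm (s x : 'rV[R]_n) = eps) -> strategy (markov s).
Proof.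
move=> ms se j; split; last by move=> h _; exact: se.
apply: measurable_funTS; apply: (measurableT_comp ms).
exact: (measurableT_comp measurable_snd (measurable_tnth ord_max)).
Qed.

Lemma u_out x : K x -> ~ Omega x -> u x = F x.
Proof. by move=> Kx Ox; rewrite uT// T_out. Qed.

(** The existence of a law makes [xget] return one instead of its default. *)
Lemma law_is_law S1 S2 : strategy S1 -> strategy S2 ->
  is_law eps Omega p x0 S1 S2 (law eps Omega p x0 S1 S2).
Proof.
move=> S1s S2s; have [g [A [bg A1 gA Wg]]] :=
  lyapunov eps0 n2 Omega_neq0 Omega_open Omega_bounded p_gt1 p_le.
rewrite /law; apply: (@xgetPex _ _ [set P | is_law eps Omega p x0 S1 S2 P]).
eexists; exact: (limit_law_is_law eps0 n2 Omega_neq0 Omega_open Omega_bounded p_gt1 p_cont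
  S1s S2s Ox0 bg A1 gA Wg).
Qed.

Lemma W_u_bounded : exists M : R, forall x nu, Omega x -> esphere eps nu -> `|W u x nu| <= M.
Proof.
have [M M0 uM] := compact_within_bounded cK uK; exists M => x nu Ox nue.
exact: (W_bounded eps0 n2 Omega_neq0 Omega_open Omega_bounded p_gt1 uK uM Ox nue).
Qed.

Lemma delta_FG x : Omega x -> delta x * (F \_ (Gamma eps Omega)) x = delta x * F x.
Proof.
move=> Ox; have [xe|->] := delta_inner_strip eps0 Ox; last by rewrite !mul0r.
by rewrite patchE mem_set//; exact: inner_Gamma.
Qed.

(** The drift of [g] pays for the near-optimal choice: the two possible turns together gain [2 * r],
    while the first player's choice loses at most [r]. *)
Lemma one_turn (d F0 s i w1 w2 v1 v2 g0 r : R) : 0 <= d <= 1 -> 0 <= r -> 1 <= g0 ->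
  s <= w1 + r -> i <= w2 -> v1 <= g0 - 1 -> v2 <= g0 - 1 ->
  (1 - d) / 2 * (s + i) + d * F0 - r * g0 <=
  d * F0 + (1 - d) / 2 * ((w1 - r * v1) + (w2 - r * v2)).
Proof.
move=> /andP[d0 d1] r0 g1 sw iw vg1 vg2.
have h1 : r * v1 <= r * (g0 - 1) by rewrite ler_wpM2l.
have h2 : r * v2 <= r * (g0 - 1) by rewrite ler_wpM2l.
have c0 : 0 <= (1 - d) / 2 by rewrite divr_ge0 ?subr_ge0.
have h3 : (1 - d) / 2 * (s + i - 2 * (r * g0)) <=
    (1 - d) / 2 * ((w1 - r * v1) + (w2 - r * v2)) by rewrite ler_wpM2l//; lra.
have h4 : 0 <= d * (r * g0) by rewrite !mulr_ge0// (le_trans _ g1).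
by lra.
Qed.

Lemma value_ge (e : R) : 0 < e -> exists2 S1, strategy S1 &
  forall S2, strategy S2 -> ((u x0 - e)%:E <= expected_payoff eps Omega p F x0 S1 S2)%E.
Proof.
move=> e0; have [g [A [bg A1 gA Wg]]] :=
  lyapunov eps0 n2 Omega_neq0 Omega_open Omega_bounded p_gt1 p_le.
have A0 : 0 < A by exact: lt_trans A1.
(* Then [r * g x0 <= e], the full price of replacing [u] by [u - r * g]. The selection is run with
   [r / 3] because it loses three times its tolerance. *)
pose r := e / A; have r0 : 0 < r by rewrite divr_gt0.
have r3 : 0 < r / 3 by rewrite divr_gt0.
have [M WM] := W_u_bounded.
have [s [ms se sW]] := measurable_selection (sphere_neq0 eps0 n2) r3 WM
  (W_equicont eps0 n2 Omega_neq0 Omega_open Omega_bounded p_gt1 p_cont uK r3).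
exists (markov s) => [|S2 S2s]; first exact: markov_strategy.
have S1s : strategy (markov s) by exact: markov_strategy.
have [P0 PS] := law_is_law S1s S2s.
set Q := law _ _ _ _ _ _ in P0 PS.
have bu := bmeas_patch eps0 n2 Omega_neq0 Omega_open Omega_bounded uK.
have bF := bmeas_FG eps0 n2 Omega_neq0 Omega_open Omega_bounded F_cont.
have bp := bmeas_payoff eps0 n2 Omega_neq0 Omega_open Omega_bounded F_cont.
pose phi (y : E) : R := (u \_ K) y - r * g y.
have bphi : bmeas phi by apply: bmeasB => //; exact: bmeasZ.
have phiE y : K y -> phi y = u y - r * g y by move=> Ky; rewrite /phi patchE mem_set.
have -> : expected_payoff eps Omega p F x0 (markov s) S2 = (\int[Q]_w payoff eps Omega F w)%:E.
  by rewrite /expected_payoff unlock bmeas_mean.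
rewrite lee_fin; apply: (@le_trans _ _ (phi x0)).
  rewrite phiE; last exact: K_Omega.
  have /andP[_ gx] := gA _ (K_Omega eps Ox0).
  by rewrite lerD2l lerN2 /r mulrAC ler_pdivrMr// ler_pM2l.
apply: (expected_payoff_ge eps0 n2 Omega_neq0 Omega_open Omega_bounded p_gt1 p_cont S1s S2s Ox0
  (psi := F \_ (Gamma eps Omega))) => //.
- move=> j C B mC Cl mB; rewrite PS//.
  exact: (integral_transition eps0 n2 Omega_neq0 Omega_open Omega_bounded p_gt1 p_cont S1s S2s).
- by move=> w w0 ws j wj; exact: payoff_exit.
- by exists g, A.
- move=> x Kx Ox; have {}Kx : K x by exact: subset_closure.
  rewrite phiE// u_out// patchE mem_set; last exact: K_Gamma.
  have /andP[g1 _] := gA _ Kx.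
  by rewrite gerBl mulr_ge0 ?(ltW r0)// (le_trans _ g1).
move=> j h hl x Ox; have Kx := K_Omega eps Ox.
have nu1 : enorm (markov s h) = eps by exact: se.
have nu2 : enorm (S2 j h) = eps by have [_] := S2s j; exact.
rewrite phiE// uT// T_in// delta_FG//.
rewrite !WbB ?WbZ//; [|exact: bmeasZ..].
rewrite -!(W_Wb _ eps0 n2 Omega_neq0 Omega_open Omega_bounded uK Ox)//.
have /andP[g1 _] := gA _ Kx.
apply: one_turn => //; [exact: delta_ge0_le1|exact: ltW| | |exact: Wg|exact: Wg].
- apply: sup_le_ub; first by have [nu nue] := sphere_neq0 eps0 n2; exists (W u x nu); exists nu.
  move=> _ [nu nue <-]; have := sW x nu Ox nue.
  by rewrite /markov (_ : 3 * (r / 3) = r)//; field.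
- apply: ge_inf; last by exists (S2 j h).
  by exists (- M) => _ [nu nue <-]; have := WM x nu Ox nue; rewrite ler_norml => /andP[].
Qed.

(** The lower estimate is applied to the opposite of the payoff, and the selection to [- W u], so
    that it finds nearly minimizing directions. *)
Lemma value_le (e : R) : 0 < e -> exists2 S2, strategy S2 &
  forall S1, strategy S1 -> (expected_payoff eps Omega p F x0 S1 S2 <= (u x0 + e)%:E)%E.
Proof.
move=> e0; have [g [A [bg A1 gA Wg]]] :=
  lyapunov eps0 n2 Omega_neq0 Omega_open Omega_bounded p_gt1 p_le.
have A0 : 0 < A by exact: lt_trans A1.
pose r := e / A; have r0 : 0 < r by rewrite divr_gt0.
have r3 : 0 < r / 3 by rewrite divr_gt0.
have [M WM] := W_u_bounded.
have WMN x nu : Omega x -> esphere eps nu -> `|- W u x nu| <= M.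
  by move=> Ox nue; rewrite normrN WM.
have [d d0 Wd] := W_equicont eps0 n2 Omega_neq0 Omega_open Omega_bounded p_gt1 p_cont uK r3.
have WdN : exists2 d : R, 0 < d & forall x y, Omega x -> Omega y -> enorm (y - x) < d ->
    forall nu, esphere eps nu -> `|- W u y nu - - W u x nu| <= r / 3.
  exists d => // x y Ox Oy yx nu nue; rewrite -opprD normrN.
  exact: Wd.
have [s [ms se sW]] := measurable_selection (sphere_neq0 eps0 n2) r3 WMN WdN.
exists (markov s) => [|S1 S1s]; first exact: markov_strategy.
have S2s : strategy (markov s) by exact: markov_strategy.
have [P0 PS] := law_is_law S1s S2s.
set Q := law _ _ _ _ _ _ in P0 PS.
have bu := bmeas_patch eps0 n2 Omega_neq0 Omega_open Omega_bounded uK.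
have bF := bmeas_FG eps0 n2 Omega_neq0 Omega_open Omega_bounded F_cont.
have bp := bmeas_payoff eps0 n2 Omega_neq0 Omega_open Omega_bounded F_cont.
pose phi (y : E) : R := - (u \_ K) y - r * g y.
have bphi : bmeas phi by apply: bmeasB; [exact: bmeasN|exact: bmeasZ].
have phiE y : K y -> phi y = - u y - r * g y by move=> Ky; rewrite /phi patchE mem_set.
have -> : expected_payoff eps Omega p F x0 S1 (markov s) = (\int[Q]_w payoff eps Omega F w)%:E.
  by rewrite /expected_payoff unlock bmeas_mean.
rewrite lee_fin -lerN2 -meanN//; apply: (@le_trans _ _ (phi x0)).
  rewrite phiE; last exact: K_Omega.
  have /andP[_ gx] := gA _ (K_Omega eps Ox0).
  by rewrite opprD lerD2l lerN2 /r mulrAC ler_pdivrMr// ler_pM2l.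
apply: (expected_payoff_ge eps0 n2 Omega_neq0 Omega_open Omega_bounded p_gt1 p_cont S1s S2s Ox0
  (psi := fun y => - (F \_ (Gamma eps Omega)) y)) => //.
- move=> j C B mC Cl mB; rewrite PS//.
  exact: (integral_transition eps0 n2 Omega_neq0 Omega_open Omega_bounded p_gt1 p_cont S1s S2s).
- exact: bmeasN.
- exact: bmeasN.
- by move=> w w0 ws j wj; congr (- _); exact: payoff_exit.
- by exists g, A.
- move=> x Kx Ox; have {}Kx : K x by exact: subset_closure.
  rewrite phiE// u_out// patchE mem_set; last exact: K_Gamma.
  have /andP[g1 _] := gA _ Kx.
  by rewrite gerBl mulr_ge0 ?(ltW r0)// (le_trans _ g1).
move=> j h hl x Ox; have Kx := K_Omega eps Ox.
have nu1 : enorm (S1 j h) = eps by have [_] := S1s j; exact.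
have nu2 : enorm (markov s h) = eps by exact: se.
rewrite phiE// uT// T_in// mulrN delta_FG//.
rewrite !WbB ?WbN ?WbZ//; [|by [exact: bmeasN|exact: bmeasZ]..].
rewrite -!(W_Wb _ eps0 n2 Omega_neq0 Omega_open Omega_bounded uK Ox)//.
have /andP[g1 _] := gA _ Kx.
set sS := sup _; set iS := inf _.
rewrite (_ : - _ - r * g x = (1 - delta x) / 2 * (- iS + - sS) + delta x * (- F x) - r * g x);
  last by ring.
(* [one_turn] lists the near-optimal player first, here Player II, so the two turns are swapped. *)
rewrite -(mulrN (delta x)) [X in _ <= _ + _ / _ * X]addrC.
apply: one_turn => //; [exact: delta_ge0_le1|exact: ltW| | |exact: Wg|exact: Wg].
- rewrite lerNl opprD opprK.
  apply: lb_le_inf; first by have [nu nue] := sphere_neq0 eps0 n2; exists (W u x nu); exists nu.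
  move=> _ [nu nue <-]; have := sW x nu Ox nue.
  have -> : 3 * (r / 3) = r by field.
  by rewrite /markov lerNl opprD opprK.
- rewrite lerN2; apply: sup_upper_bound; last by exists (S1 j h).
  split; first by exists (W u x (S1 j h)); exists (S1 j h).
  by exists M => _ [nu nue <-]; rewrite (le_trans (ler_norm _))// WM.
Qed.

Lemma values : (u x0)%:E = value1 eps Omega p F x0 /\ (u x0)%:E = value2 eps Omega p F x0.
Proof.
have v12 : (value1 eps Omega p F x0 <= value2 eps Omega p F x0)%E.
  apply: ge_ereal_sup => _ [S1 S1s <-]; apply: le_ereal_inf_tmp => _ [S2 S2s <-].
  apply: (@le_trans _ _ (expected_payoff eps Omega p F x0 S1 S2)).
    by apply: ereal_inf_lbound; exists S2.
  by apply: ereal_sup_ubound; exists S1.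
have v1 : ((u x0)%:E <= value1 eps Omega p F x0)%E.
  apply/lee_subgt0Pr => e e0; have [S1 S1s S1P] := value_ge e0.
  apply: (@le_trans _ _ (ereal_inf [set expected_payoff eps Omega p F x0 S1 S2 | S2 in strategy])).
    by apply: le_ereal_inf_tmp => _ [S2 S2s <-]; exact: S1P.
  by apply: ereal_sup_ubound; exists S1.
have v2 : (value2 eps Omega p F x0 <= (u x0)%:E)%E.
  apply/lee_addgt0Pr => e e0; have [S2 S2s S2P] := value_le e0.
  apply: (@le_trans _ _ (ereal_sup [set expected_payoff eps Omega p F x0 S1 S2 | S1 in strategy])).
    by apply: ereal_inf_lbound; exists S2.
  by apply: ge_ereal_sup => _ [S1 S1s <-]; exact: S2P.
split; apply/eqP; rewrite eq_le; apply/andP; split=> //.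
- exact: le_trans v2.
- exact: le_trans v12.
Qed.

End value.

Theorem theorem3p7 (R : realType) (n : nat) (hn : (2 <= n)%N)
    (eps : R) (eps_gt0 : 0 < eps)
    (Omega : set 'rV[R]_n) (Omega_neq0 : Omega !=set0)
    (Omega_open : open Omega) (Omega_connected : connected Omega)
    (Omega_bounded : bounded_set Omega)
    (p : 'rV[R]_n -> R) (p_cont : {within closure Omega, continuous p})
    (p_inf : (1%:E < ereal_inf [set (p x)%:E | x in Omega])%E)
    (p_sup : (ereal_sup [set (p x)%:E | x in Omega] < +oo)%E)
    (F : 'rV[R]_n -> R) (F_cont : {within Gamma eps Omega, continuous F}) :
  exists u : 'rV[R]_n -> R,
    [/\ {within closure (Omega_eps eps Omega), continuous u},
        (forall x, closure (Omega_eps eps Omega) x -> ~ Omega x -> u x = F x),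
        (forall x, closure (Omega_eps eps Omega) x -> u x = T eps Omega p F u x),
        (forall v : 'rV[R]_n -> R,
           {within closure (Omega_eps eps Omega), continuous v} ->
           (forall x, closure (Omega_eps eps Omega) x ->
              v x = T eps Omega p F v x) ->
           forall x, closure (Omega_eps eps Omega) x -> v x = u x) &
        (forall x, Omega x -> (u x)%:E = value1 eps Omega p F x /\
                              (u x)%:E = value2 eps Omega p F x)].
Proof.
have p_gt1 x : Omega x -> 1 < p x.
  move=> Ox; rewrite -lte_fin; apply: lt_le_trans p_inf _.
  by apply: ereal_inf_lbound; exists x.
have [P p_le] : exists P, forall x, Omega x -> p x <= P.
  have [x0 Ox0] := Omega_neq0.
  have ub x : Omega x -> ((p x)%:E <= ereal_sup [set (p x)%:E | x in Omega])%E.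
    by move=> Ox; apply: ereal_sup_ubound; exists x.
  (* Of the infinite values, [+oo] contradicts [p_sup] and [-oo] contradicts the bound at [x0]. *)
  move: p_sup ub; case: ereal_sup => [P|//|] _ ub; last by have := ub x0 Ox0.
  by exists P => x /ub; rewrite lee_fin.
have [u [uK uT uniq]] :=
  T_fixpoint eps_gt0 hn Omega_neq0 Omega_open Omega_bounded p_gt1 p_le p_cont F_cont.
exists u; split => //.
- by move=> x Kx Ox; exact: (u_out uT Kx Ox).
- move=> x Ox.
  exact: (values eps_gt0 hn Omega_neq0 Omega_open Omega_bounded p_gt1 p_le p_cont F_cont uK uT Ox).
Qed.
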